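(* With $X,Y,X^*,Y^*$ as defined in the context and $\Sigma\to\infty$ meaning $\Sigma=rI$ with $r\to+\infty$: (i) For all $0\le T_0<T$ and all $\mathbf a\in\mathbb{R}^d$, $$\lim_{\Sigma\to\infty}\mathbf a^T\big[X(\Sigma,\Sigma_V,T_0,T)-X^*(\Sigma_V,T_0,T)\big]\mathbf a=0.$$ (ii) For fixed $T$, $$\lim_{\Sigma\to\infty}\big[Y(\Sigma,\Sigma_V,T_0,T)-Y^*(\Sigma_V,T_0,T)\big]\longrightarrow\infty\quad\text{as }T_0\to0^+,$$ no slower than logarithmically; that is, there exist $c>0$ and $\tau_0\in(0,T)$ such that this limit is at least $c\log(1/T_0)$ for all $0<T_0<\tau_0$.
   Context: Setting. Fix $d\ge1$, $T>0$. Let $Q\neq0$ be symmetric positive semidefinite, $R,\Sigma_V$ symmetric positive definite, $\Sigma_{\mathbf q_0},\Sigma$ symmetric positive semidefinite $d\times d$ matrices, and $\Sigma_W=I$. For $0\le T_0<T$ and drift $\mathbf a\in\mathbb{R}^d$ consider $$d\mathbf q=(\mathbf a+\mathbf u)\,dt+d\mathbf W,\qquad d\mathbf y=\mathbf q\,dt+d\mathbf V,\qquad \mathbf y(0)=0,$$ with $\mathbf W,\mathbf V$ independent $d$-dimensional Wiener processes of covariances $\Sigma_Wt$ and $\Sigma_Vt$, and $\mathbf q(0)\sim\mathcal N(0,\Sigma_{\mathbf q_0})$ independent of them; the control satisfies $\mathbf u(t)=0$ for $t<T_0$. The cost is $\mathbb{E}\big[\int_{T_0}^T(\mathbf q^TQ\mathbf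 q+\mathbf u^TR\mathbf u)\,dt\big]$. Let $F=\begin{bmatrix}0&I\\0&0\end{bmatrix}$, $B=G=\begin{bmatrix}I\\0\end{bmatrix}$, $H=\begin{bmatrix}I&0\end{bmatrix}$, $\tilde Q=\begin{bmatrix}Q&0\\0&0\end{bmatrix}$. Let the symmetric matrices $P=\begin{bmatrix}P_{11}&P_{12}\\P_{12}^T&P_{22}\end{bmatrix}$ and $S=\begin{bmatrix}S_{11}&S_{12}\\S_{12}^T&S_{22}\end{bmatrix}$ solve $$\dot P=FP+PF^T-PH^T\Sigma_V^{-1}HP+G\Sigma_WG^T,\quad P(0)=\begin{bmatrix}\Sigma_{\mathbf q_0}&0\\0&\Sigma\end{bmatrix},$$ $$-\dot S=SF+F^TS+\tilde Q-SBR^{-1}B^TS,\quad S(T)=0.$$ Bayesian strategy for the prior $\mathcal N(0,\Sigma)$: $\mathbf u=-R^{-1}(S_{11}\hat{\mathbf q}+S_{12}\hat{\mathbf a})$ on $[T_0,T]$, $\mathbf u=0$ on $[0,T_0)$, where $$d\hat{\mathbf q}=(\hat{\mathbf a}+\mathbf u)\,dt+P_{11}\Sigma_V^{-1}(d\mathbf y-\hat{\mathbf q}\,dt),\quad d\hat{\mathbf a}=P_{12}^T\Sigma_V^{-1}(d\mathbf y-\hat{\mathbf q}\,dt),\quad\hat{\mathbf q}(0)=\hat{\mathbf a}(0)=0.$$ For a fixed (deterministic) true value $\mathbf a$, the means of the processes generated by this strategy are linear in $\mathbf a$: $\mathbb{E}[\mathbf q(t)]=C_1(t)\mathbf a$,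 $\mathbb{E}[\hat{\mathbf q}(t)]=C_2(t)\mathbf a$, $\mathbb{E}[\hat{\mathbf a}(t)]=C_3(t)\mathbf a$, and the covariances $\Sigma_{\xi\eta}(t)=\mathbb{E}[(\xi-\mathbb{E}\xi)(\eta-\mathbb{E}\eta)^T]$ for $\xi,\eta\in\{\mathbf q,\hat{\mathbf q},\hat{\mathbf a}\}$ do not depend on $\mathbf a$. Define $$X(\Sigma,\Sigma_V,T_0,T)=\int_{T_0}^T\Big[C_1^TQC_1+(S_{11}C_2+S_{12}C_3)^TR^{-1}(S_{11}C_2+S_{12}C_3)\Big]dt,$$ $$Y(\Sigma,\Sigma_V,T_0,T)=\int_{T_0}^T\operatorname{Trace}\Big(Q\Sigma_{\mathbf q\mathbf q}+S_{11}^TR^{-1}S_{11}\Sigma_{\hat{\mathbf q}\hat{\mathbf q}}+2S_{11}^TR^{-1}S_{12}\Sigma_{\hat{\mathbf q}\hat{\mathbf a}}^T+S_{12}^TR^{-1}S_{12}\Sigma_{\hat{\mathbf a}\hat{\mathbf a}}\Big)dt,$$ so that the cost of the Bayesian strategy at $\mathbf a$ is $\mathbf a^TX\mathbf a+Y$. Optimal control with known $\mathbf a$: $\mathbf u^*=-R^{-1}(S_{11}\hat{\mathbf q}^*+S_{12}\mathbf a)$ on $[T_0,T]$, $\mathbf u^*=0$ on $[0,T_0)$, where $\dot P_{11}^*=-P_{11}^{*T}\Sigma_V^{-1}P_{11}^*+\Sigma_W$, $P_{11}^*(0)=\Sigma_{\mathbf q_0}$, and $d\hat{\mathbf q}^*=(\mathbf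 a+\mathbf u^* )\,dt+P_{11}^*\Sigma_V^{-1}(d\mathbf y-\hat{\mathbf q}^*dt)$, $\hat{\mathbf q}^*(0)=0$. With $\mathbf q^*$ the resulting state, write $\mathbb{E}[\mathbf q^*(t)]=C_1^*(t)\mathbf a$, $\mathbb{E}[\hat{\mathbf q}^*(t)]=C_2^*(t)\mathbf a$, and let $\Sigma^*_{\mathbf q\mathbf q},\Sigma^*_{\hat{\mathbf q}\hat{\mathbf q}}$ be the covariance matrices of $\mathbf q^*(t)$ and $\hat{\mathbf q}^*(t)$ (independent of $\mathbf a$). Define $$X^*(\Sigma_V,T_0,T)=\int_{T_0}^T\Big[C_1^{*T}QC_1^*+(S_{11}C_2^*+S_{12})^TR^{-1}(S_{11}C_2^*+S_{12})\Big]dt,$$ $$Y^*(\Sigma_V,T_0,T)=\int_{T_0}^T\operatorname{Trace}\Big(Q\Sigma^*_{\mathbf q\mathbf q}+S_{11}^TR^{-1}S_{11}\Sigma^*_{\hat{\mathbf q}\hat{\mathbf q}}\Big)dt,$$ so that the optimal cost with known $\mathbf a$ is $\mathbf a^TX^*\mathbf a+Y^*$. *)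

(* Defs.v *)
From HB Require Import structures.
From mathcomp Require Export all_boot all_order all_algebra.
From mathcomp Require Export all_classical all_reals all_analysis.
Set Implicit Arguments.
Unset Strict Implicit.
Unset Printing Implicit Defensive.
Import Order.TTheory GRing.Theory Num.Theory.
Export numFieldNormedType.Exports.
Local Open Scope classical_set_scope.
Local Open Scope ring_scope.

Section LinearAlgebra.
Variables (R : realType) (d : nat).

Definition sym_psd (A : 'M[R]_d) : Prop :=
  A^T = A /\ forall v : 'cV[R]_d, 0 <= (v^T *m A *m v) 0 0.

Definition sym_pd (A : 'M[R]_d) : Prop :=
  A^T = A /\ forall v : 'cV[R]_d, v != 0 -> 0 < (v^T *m A *m v) 0 0.

Definition SigW : 'M[R]_d := 1%:M.

End LinearAlgebra.
Arguments SigW {R d}.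

Section Calculus.
Variable R : realType.

Definition continuous_mx m n (T : R) (f : R -> 'M[R]_(m, n)) : Prop :=
  forall i j, {within `[0, T], continuous (fun t => f t i j)}.

Definition solves_ode m n (T : R) (rhs : 'M[R]_(m, n) -> 'M[R]_(m, n))
    (f : R -> 'M[R]_(m, n)) : Prop :=
  continuous_mx T f /\
  forall t, t \in `]0, T[ ->
    forall i j, is_derive t (1 : R) (fun s => f s i j) (rhs (f t) i j).

Definition integral_mx m n (s t : R) (f : R -> 'M[R]_(m, n)) : 'M[R]_(m, n) :=
  \matrix_(i, j) Rintegral lebesgue_measure `[s, t] (fun x => f x i j).

(* The integral of the deterministic matrix K against the path y over [0, t],
   as the limit of the left-endpoint (Ito) sums along uniform partitions.  It is
   only used for K continuous on [0, t] with a bounded derivative on ]0, t[: the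
   sums then converge along every continuous path, and their pathwise limit is
   almost surely the Ito integral. *)
Definition ito_integral m n (K : R -> 'M[R]_(m, n)) (y : R -> 'cV[R]_n)
    (t : R) : 'cV[R]_m :=
  let node N k : R := t * k%:R / N%:R in
  \col_i limn (fun N =>
    (\sum_(k < N) K (node N k) *m (y (node N k.+1) - y (node N k))) i 0).

End Calculus.

Section Probability.
Variables (R : realType) (d : nat).
Context (disp : measure_display) (Om : measurableType disp).
Variable Pr : probability Om R.

Definition random_vector (X : Om -> 'cV[R]_d) : Prop :=
  forall i, measurable_fun [set: Om] (fun w => X w i 0).

Definition mean (X : Om -> 'cV[R]_d) : 'cV[R]_d :=
  \col_i fine (expectation Pr (fun w => X w i 0)).

Definition cov (X Y : Om -> 'cV[R]_d) : 'M[R]_d :=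
  \matrix_(i, j) fine (covariance Pr (fun w => X w i 0) (fun w => Y w j 0)).

(* The law N(0, s2) on R; [normal_prob] is not a point mass at deviation 0. *)
Definition centered_normal (s2 : R) (B : set R) : \bar R :=
  if s2 == 0 then \d_(0 : R) B else normal_prob 0 (Num.sqrt s2) B.

(* X ~ N(0, C), with C possibly singular: every linear form of X is normal. *)
Definition gaussian_vector (C : 'M[R]_d) (X : Om -> 'cV[R]_d) : Prop :=
  random_vector X /\
  forall (v : 'cV[R]_d) (B : set R), measurable B ->
    Pr ((fun w => (v^T *m X w) 0 0) @^-1` B)
    = centered_normal ((v^T *m C *m v) 0 0) B.

(* The sigma-algebra generated by the vectors X t, t in D. *)
Definition sigma_of (I : Type) (D : set I) (X : I -> Om -> 'cV[R]_d) :
    set (set Om) :=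
  <<s [set A | exists t, exists i, exists B : set R,
         [/\ D t, measurable B & A = (fun w => X t w i 0) @^-1` B] ]>>.

Definition sigma_of_vector (X : Om -> 'cV[R]_d) : set (set Om) :=
  sigma_of [set: unit] (fun _ => X).

Definition indep2 (F G : set (set Om)) : Prop :=
  forall A B, F A -> G B -> Pr (A `&` B) = (Pr A * Pr B)%E.

(* Mutual independence; the pairwise rules are the cases where one event is the
   whole space. *)
Definition indep3 (F G H : set (set Om)) : Prop :=
  forall A B C, F A -> G B -> H C ->
    Pr (A `&` B `&` C) = (Pr A * Pr B * Pr C)%E.

Definition wiener (C : 'M[R]_d) (W : R -> Om -> 'cV[R]_d) : Prop :=
  [/\ forall t, 0 <= t -> random_vector (W t),
      {ae Pr, forall w, W 0 w = 0 /\
                        forall T, continuous_mx T (fun t => W t w)},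
      forall s t, 0 <= s -> s <= t ->
        gaussian_vector ((t - s) *: C) (fun w => W t w - W s w) &
      forall s t, 0 <= s -> s <= t ->
        indep2 (sigma_of `[0, s] W) (sigma_of_vector (fun w => W t w - W s w))].

(* W has covariance t SigW, V has covariance t SigV, q0 ~ N(0, Sigq0). *)
Definition noise (SigV Sigq0 : 'M[R]_d) (W V : R -> Om -> 'cV[R]_d)
    (q0 : Om -> 'cV[R]_d) : Prop :=
  [/\ wiener SigW W, wiener SigV V, gaussian_vector Sigq0 q0 &
      indep3 (sigma_of `[0, +oo[ W) (sigma_of `[0, +oo[ V)
             (sigma_of_vector q0)].

End Probability.

Section Riccati.
Variables (R : realType) (d : nat).
Local Notation MM := 'M[R]_(d + d).

Definition Fmx : MM := block_mx 0 1%:M 0 0.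
Definition Bmx : 'M[R]_(d + d, d) := col_mx 1%:M 0.
Definition Gmx : 'M[R]_(d + d, d) := Bmx.
Definition Hmx : 'M[R]_(d, d + d) := row_mx 1%:M 0.
Definition Qtilde (Q : 'M[R]_d) : MM := block_mx Q 0 0 0.

Definition filter_riccati (T : R) (SigV Sigq0 Sig : 'M[R]_d)
    (P : R -> MM) : Prop :=
  [/\ forall t, t \in `[0, T] -> (P t)^T = P t,
      P 0 = block_mx Sigq0 0 0 Sig &
      solves_ode T (fun p => Fmx *m p + p *m Fmx^T
                       - p *m Hmx^T *m invmx SigV *m Hmx *m p
                       + Gmx *m SigW *m Gmx^T) P].

Definition control_riccati (T : R) (Q Rc : 'M[R]_d) (S : R -> MM) : Prop :=
  [/\ forall t, t \in `[0, T] -> (S t)^T = S t,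
      S T = 0 &
      solves_ode T (fun s => - (s *m Fmx + Fmx^T *m s + Qtilde Q
                       - s *m Bmx *m invmx Rc *m Bmx^T *m s)) S].

Definition known_filter_riccati (T : R) (SigV Sigq0 : 'M[R]_d)
    (P : R -> 'M[R]_d) : Prop :=
  P 0 = Sigq0 /\
  solves_ode T (fun p => - (p^T *m invmx SigV *m p) + SigW) P.

End Riccati.

Section Strategies.
Variables (R : realType) (d : nat).
Variables (T : R) (Q Rc SigV Sigq0 : 'M[R]_d).
Context (disp : measure_display) (Om : measurableType disp).
Variables (Pr : probability Om R) (W V : R -> Om -> 'cV[R]_d).
Variable q0 : Om -> 'cV[R]_d.
Variable S : R -> 'M[R]_(d + d).

Let S11 t : 'M[R]_d := ulsubmx (S t).
Let S12 t : 'M[R]_d := ursubmx (S t).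

Definition control (T0 : R) (qh ah : R -> 'cV[R]_d) (t : R) : 'cV[R]_d :=
  if t < T0 then 0 else - (invmx Rc *m (S11 t *m qh t + S12 t *m ah t)).

(* One path of the closed loop, as a system of integral equations on [0, T]. *)
Definition bayes_path (P : R -> 'M[R]_(d + d)) (T0 : R) (a x0 : 'cV[R]_d)
    (w v q y qh ah : R -> 'cV[R]_d) : Prop :=
  let u := control T0 qh ah in
  let K1 t := ulsubmx (P t) *m invmx SigV in
  let K2 t := (ursubmx (P t))^T *m invmx SigV in
  [/\ continuous_mx T q, continuous_mx T qh, continuous_mx T ah &
   forall t, t \in `[0, T] ->
   [/\ q t = x0 + integral_mx 0 t (fun s => a + u s) + w t,
       y t = integral_mx 0 t q + v t,
       qh t = integral_mx 0 t (fun s => ah s + u s - K1 s *m qh s)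
              + ito_integral K1 y t &
       ah t = integral_mx 0 t (fun s => - (K2 s *m qh s))
              + ito_integral K2 y t]].

Definition bayes_process (P : R -> 'M[R]_(d + d)) (T0 : R) (a : 'cV[R]_d)
    (q y qh ah : R -> Om -> 'cV[R]_d) : Prop :=
  (forall t, t \in `[0, T] ->
     [/\ random_vector (q t), random_vector (y t),
         random_vector (qh t) & random_vector (ah t)]) /\
  {ae Pr, forall w, bayes_path P T0 a (q0 w) (W ^~ w) (V ^~ w)
                      (q ^~ w) (y ^~ w) (qh ^~ w) (ah ^~ w)}.

Definition known_path (P : R -> 'M[R]_d) (T0 : R) (a x0 : 'cV[R]_d)
    (w v q y qh : R -> 'cV[R]_d) : Prop :=
  let u := control T0 qh (fun _ => a) in
  let K t := P t *m invmx SigV in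
  [/\ continuous_mx T q, continuous_mx T qh &
   forall t, t \in `[0, T] ->
   [/\ q t = x0 + integral_mx 0 t (fun s => a + u s) + w t,
       y t = integral_mx 0 t q + v t &
       qh t = integral_mx 0 t (fun s => a + u s - K s *m qh s)
              + ito_integral K y t]].

Definition known_process (P : R -> 'M[R]_d) (T0 : R) (a : 'cV[R]_d)
    (q y qh : R -> Om -> 'cV[R]_d) : Prop :=
  (forall t, t \in `[0, T] ->
     [/\ random_vector (q t), random_vector (y t) & random_vector (qh t)]) /\
  {ae Pr, forall w, known_path P T0 a (q0 w) (W ^~ w) (V ^~ w)
                      (q ^~ w) (y ^~ w) (qh ^~ w)}.

(* X and Y are X(Sig, SigV, T0, T) and Y(Sig, SigV, T0, T): the existentially
   quantified data are determined on [0, T], so this determines X and Y. *)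
Definition bayes_cost (Sig : 'M[R]_d) (T0 : R) (X : 'M[R]_d) (Y : R) : Prop :=
  exists P C1 C2 C3 Cqq Chh Cha Caa,
  [/\ filter_riccati T SigV Sigq0 Sig P,
      forall a, exists q, exists y, exists qh, exists ah,
        bayes_process P T0 a q y qh ah /\
        forall t, t \in `[0, T] ->
          [/\ mean Pr (q t) = C1 t *m a,
              mean Pr (qh t) = C2 t *m a &
              mean Pr (ah t) = C3 t *m a] /\
          [/\ cov Pr (q t) (q t) = Cqq t,
              cov Pr (qh t) (qh t) = Chh t,
              cov Pr (qh t) (ah t) = Cha t &
              cov Pr (ah t) (ah t) = Caa t],
      X = integral_mx T0 T (fun t =>
            (C1 t)^T *m Q *m C1 t
            + (S11 t *m C2 t + S12 t *m C3 t)^T *m invmx Rc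
              *m (S11 t *m C2 t + S12 t *m C3 t)) &
      Y = Rintegral lebesgue_measure `[T0, T] (fun t =>
            \tr (Q *m Cqq t
                 + (S11 t)^T *m invmx Rc *m S11 t *m Chh t
                 + 2 *: ((S11 t)^T *m invmx Rc *m S12 t *m (Cha t)^T)
                 + (S12 t)^T *m invmx Rc *m S12 t *m Caa t))].

Definition known_cost (T0 : R) (X : 'M[R]_d) (Y : R) : Prop :=
  exists P C1 C2 Cqq Chh,
  [/\ known_filter_riccati T SigV Sigq0 P,
      forall a, exists q, exists y, exists qh,
        known_process P T0 a q y qh /\
        forall t, t \in `[0, T] ->
          [/\ mean Pr (q t) = C1 t *m a,
              mean Pr (qh t) = C2 t *m a,
              cov Pr (q t) (q t) = Cqq t &
              cov Pr (qh t) (qh t) = Chh t],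
      X = integral_mx T0 T (fun t =>
            (C1 t)^T *m Q *m C1 t
            + (S11 t *m C2 t + S12 t)^T *m invmx Rc
              *m (S11 t *m C2 t + S12 t)) &
      Y = Rintegral lebesgue_measure `[T0, T] (fun t =>
            \tr (Q *m Cqq t + (S11 t)^T *m invmx Rc *m S11 t *m Chh t))].

End Strategies.

(* Main.v *)
(* Let p be the error covariance of the filter that knows the drift, J = SigV^-1,
   U' = 1 - p J U with U(0) = 0, and M(t) = int_0^t U^T J U the Fisher information
   of the observations about the drift.  For the prior N(0, r 1) the Bayesian filter
   is explicit: P22 = (1/r + M)^-1, P12 = U P22, P11 = p + U P22 U^T.  The error on
   the drift has mean P22 a / r and covariance proportional to P22 M P22, and
   completing the square with the control Riccati equation gives, for
   beta = S11 U + S12,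
     a^T (X - X* ) a = int_[T0,T] |beta P22 a / r|^2  (in the norm of R^-1),
     Y - Y* = int_[T0,T] tr (R^-1 beta P22 M P22 beta^T).
   The first integrand is bounded and tends to 0 for t > 0.  The second tends to
   tr (R^-1 beta M^-1 beta^T) uniformly on [T0,T]; as M(t) = O(t^3) and
   beta(0) = S12(0) is nonzero, its integral is at least of order 1 / T0^2. *)
From HB Require Import structures.
Require Import Defs.
From mathcomp Require Import measurable_realfun.
From mathcomp Require Import ring lra.
Set Implicit Arguments.
Unset Strict Implicit.
Unset Printing Implicit Defensive.
Import Order.TTheory GRing.Theory Num.Theory.
Local Open Scope classical_set_scope.
Local Open Scope ring_scope.

(** * Bounded measurable functions on an interval and their primitives *)

(** The control jumps at [T0], so the closed loop has discontinuous coefficients and its means and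
    covariances need not be differentiable there. All equations are therefore read in integral form,
    with bounded measurable derivatives. Identities between solutions are mostly proved in one way:
    the difference of the two sides satisfies a homogeneous linear equation with zero initial value.
    The same argument identifies the existentially quantified data of the two costs.

    The gains are deterministic and Lipschitz, so every stochastic integral can be integrated by
    parts along each path. Only first and second moments of the resulting expressions enter; they
    are obtained as L2 limits of dyadic sums.

    Neither cost is computed outright. Completing the square writes each one as the same base term,
    depending on [p], [S] and [T0], plus an excess driven by the error on the drift. The excess is
    zero when the drift is known, and the base terms cancel in the difference.

    The rate 1 / T0^2 comes from integrating t^-3 over the window [T0, 2 T0]; the logarithm follows
    from ln x < x. *)

Section BoundedMeasurable.
Variables (R : realType) (T : R).
Implicit Types (f g h : R -> R) (r s t B C : R).
Local Notation mu := (@lebesgue_measure R).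

(** Continuity would be too strong a requirement: the loop gains are cut off before [T0]. This class
    is closed under such cut-offs, and its members are integrable on every subinterval of [0, T]. *)
Definition bm f : Prop :=
  measurable_fun `[0, T] f /\
  exists B : R, forall t : R, 0 <= t <= T -> `|f t| <= B.

Definition int0 f (t : R) : R := Rintegral mu `[0, t] f.

Lemma bm_bound f : bm f ->
  exists2 B, 0 < B & forall t, 0 <= t <= T -> `|f t| <= B.
Proof.
case=> _ [B hB]; exists (Num.max B 1); first by rewrite lt_max ltr01 orbT.
by move=> t /hB h; rewrite le_max h.
Qed.

Lemma bm_cst c : bm (fun=> c).
Proof. by split; [exact: measurable_cst | exists `|c|]. Qed.

Lemma bmD f g : bm f -> bm g -> bm (fun t => f t + g t).
Proof.
move=> [mf [B hB]] [mg [C hC]]; split; first exact: measurable_funD.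
exists (B + C) => t tT; apply: le_trans (ler_normD _ _) _.
by apply: lerD; [exact: hB | exact: hC].
Qed.

Lemma bmM f g : bm f -> bm g -> bm (fun t => f t * g t).
Proof.
move=> [mf [B hB]] [mg [C hC]]; split; first exact: measurable_funM.
exists (B * C) => t tT; rewrite normrM.
by apply: ler_pM => //; [exact: hB | exact: hC].
Qed.

Lemma bmN f : bm f -> bm (fun t => - f t).
Proof.
move=> [mf [B hB]]; split; first exact: measurableT_comp.
by exists B => t tT; rewrite normrN; exact: hB.
Qed.

Lemma bmB f g : bm f -> bm g -> bm (fun t => f t - g t).
Proof. by move=> bf bg; apply: bmD => //; exact: bmN. Qed.

Lemma bm_norm f : bm f -> bm (fun t => `|f t|).
Proof.
move=> [mf [B hB]]; split; first exact: measurableT_comp.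
by exists B => t tT; rewrite normr_id; exact: hB.
Qed.

Lemma bm_sum (J : Type) (r : seq J) (F : J -> R -> R) :
  (forall i, bm (F i)) -> bm (fun t => \sum_(i <- r) F i t).
Proof.
move=> bF; elim: r => [|i r IH].
  by under eq_fun do rewrite big_nil; exact: bm_cst.
by under eq_fun do rewrite big_cons; exact: bmD.
Qed.

Lemma bm_ext f g : (forall t, 0 <= t <= T -> f t = g t) -> bm f -> bm g.
Proof.
move=> fg [mf [B hB]]; split.
  by apply: eq_measurable_fun mf => t; rewrite inE /= in_itv /=; exact: fg.
by exists B => t tT; rewrite -fg //; exact: hB.
Qed.

Lemma bm_cont f : {within `[0, T], continuous f} -> bm f.
Proof.
move=> cf; split; first exact: subspace_continuous_measurable_fun.
have : compact (f @` `[0, T]).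
  by apply: continuous_compact => //; exact: segment_compact.
move=> /compact_bounded[B [_ hB]]; exists (B + 1) => t tT.
by apply: (hB (B + 1)); [rewrite ltrDl | exists t => //=; rewrite in_itv].
Qed.

Lemma bm_if (P : pred R) f g : measurable_fun `[0, T] P ->
  bm f -> bm g -> bm (fun t => if P t then f t else g t).
Proof.
move=> mP [mf [B hB]] [mg [C hC]]; split.
  apply: measurable_fun_if => //.
  - exact: measurable_funS mf.
  - exact: measurable_funS mg.
exists (Num.max B C) => t tT; rewrite le_max.
by case: ifP => _; apply/orP; [left; exact: hB | right; exact: hC].
Qed.

Lemma bm_integrable f (i : interval R) : bm f ->
  [set` i] `<=` `[0, T] -> mu.-integrable [set` i] (EFin \o f).
Proof.
move=> [mf [B hB]] iT; apply: (@integrableS _ _ _ mu `[0, T]%classic [set` i]) => //.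
apply: measurable_bounded_integrable => //=.
  by rewrite lebesgue_measure_itv /=; case: ifP => // _; rewrite ltry.
exists B; split; first exact: num_real.
move=> M BM x /=; rewrite in_itv /= => /hB h.
exact: le_trans h (ltW BM).
Qed.

Lemma bm_integrable0 f t : bm f -> t <= T ->
  mu.-integrable `[0, t] (EFin \o f).
Proof.
move=> bf tT; apply: bm_integrable => // x /=.
by rewrite !in_itv /= => /andP[-> /le_trans]; exact.
Qed.

Lemma int0_0 f : int0 f 0 = 0.
Proof. by rewrite /int0 set_itv1 Rintegral_set1. Qed.

Lemma int0_ext f g t : (forall s, 0 <= s <= t -> f s = g s) ->
  int0 f t = int0 g t.
Proof.
by move=> fg; apply: eq_Rintegral => s; rewrite inE /= in_itv /=; exact: fg.
Qed.

Lemma int0D f g t : bm f -> bm g -> t <= T ->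
  int0 (fun s => f s + g s) t = int0 f t + int0 g t.
Proof. by move=> *; rewrite /int0 RintegralD //; exact: bm_integrable0. Qed.

Lemma int0B f g t : bm f -> bm g -> t <= T ->
  int0 (fun s => f s - g s) t = int0 f t - int0 g t.
Proof. by move=> *; rewrite /int0 RintegralB //; exact: bm_integrable0. Qed.

Lemma int0Z c f t : bm f -> t <= T ->
  int0 (fun s => c * f s) t = c * int0 f t.
Proof. by move=> *; rewrite /int0 RintegralZl //; exact: bm_integrable0. Qed.

Lemma int0_sum (J : Type) (r : seq J) (F : J -> R -> R) t :
  (forall i, bm (F i)) -> t <= T ->
  int0 (fun s => \sum_(i <- r) F i s) t = \sum_(i <- r) int0 (F i) t.
Proof.
move=> bF tT; elim: r => [|i r IH].
  rewrite big_nil -[RHS](mul0r (int0 (fun=> 1) t)) -int0Z //; last exact: bm_cst.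
  by apply: int0_ext => s _; rewrite big_nil mul0r.
rewrite big_cons -IH -int0D //; last exact: bm_sum.
by apply: int0_ext => s _; rewrite big_cons.
Qed.

Lemma int0_le f g t : bm f -> bm g -> t <= T ->
  (forall s, 0 <= s <= t -> f s <= g s) -> int0 f t <= int0 g t.
Proof.
move=> bf bg tT fg; apply: le_Rintegral => //; exact: bm_integrable0.
Qed.

Lemma int0_cst c t : 0 <= t -> int0 (fun=> c) t = c * t.
Proof.
move=> t0; rewrite /int0 Rintegral_cst //= lebesgue_measure_itv /= lte_fin.
move: t0; rewrite le_eqVlt => /predU1P[<-|t0]; first by rewrite ltxx.
by rewrite t0 /= subr0.
Qed.

Lemma int0_inc f s t : bm f -> 0 <= s <= t -> t <= T ->
  int0 f t - int0 f s = Rintegral mu `]s, t] f.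
Proof.
move=> bf /andP[s0 st] tT; apply: Rintegral_itvB; rewrite ?bnd_simp //.
exact: bm_integrable0.
Qed.

Lemma int0_inc_le f g s t : bm f -> bm g -> 0 <= s <= t -> t <= T ->
  (forall r, s <= r <= t -> f r <= g r) ->
  int0 f t - int0 f s <= int0 g t - int0 g s.
Proof.
move=> bf bg st tT fg; rewrite !int0_inc //.
have sub : `]s, t]%classic `<=` `[0, T].
  move=> x /=; rewrite !in_itv /= => /andP[sx xt].
  move: st => /andP[s0 _].
  by rewrite (le_trans s0 (ltW sx)) (le_trans xt tT).
apply: le_Rintegral => //; do ?exact: bm_integrable.
by move=> r /=; rewrite in_itv /= => /andP[sr rt]; rewrite fg // ltW.
Qed.

Lemma int0_inc_bound f B s t : bm f -> 0 <= s <= t -> t <= T ->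
  (forall r, s <= r <= t -> `|f r| <= B) ->
  `|int0 f t - int0 f s| <= B * (t - s).
Proof.
move=> bf st tT fB; have /andP[s0 st'] := st; have t0 := le_trans s0 st'.
have hl r : s <= r <= t -> - B <= f r.
  by move=> /fB; rewrite ler_norml => /andP[].
have hu r : s <= r <= t -> f r <= B.
  by move=> /fB; rewrite ler_norml => /andP[].
have := int0_inc_le (bm_cst _) bf st tT hl.
have := int0_inc_le bf (bm_cst _) st tT hu.
rewrite !int0_cst // ler_norml => h1 h2.
by apply/andP; split; lra.
Qed.

Lemma norm_int0_le f t : bm f -> t <= T ->
  `|int0 f t| <= int0 (fun s => `|f s|) t.
Proof.
move=> bf tT; apply: le_normr_Rintegral => //; exact: bm_integrable0.
Qed.

Lemma int0_ge0 f t : (forall s, 0 <= s <= t -> 0 <= f s) -> 0 <= int0 f t.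
Proof.
by move=> f0; apply: Rintegral_ge0 => s /=; rewrite in_itv /=; exact: f0.
Qed.

(** Cutting [0, t] into N equal pieces bounds the total increment by N C (t / N)^2 = C t^2 / N. This
    replaces the argument that a zero derivative makes a function constant, in a setting where
    derivatives exist only almost everywhere. *)
Lemma quad_const (F : R -> R) (C : R) : (forall s t, 0 <= s <= t -> t <= T ->
    `|F t - F s| <= C * (t - s) ^+ 2) ->
  forall t, 0 <= t <= T -> F t = F 0.
Proof.
move=> hF t /andP[t0 tT].
have C0 N : `|F t - F 0| <= C * t ^+ 2 / N.+1%:R.
  pose nd k := t * k%:R / N.+1%:R.
  have Np : 0 < N.+1%:R :> R by [].
  have ndle i j : (i <= j)%N -> nd i <= nd j.
    by move=> ij; rewrite /nd ler_pM2r ?invr_gt0 // ler_wpM2l // ler_nat.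
  have h n : (n <= N.+1)%N ->
      `|F (nd n) - F 0| <= C * (t / N.+1%:R) ^+ 2 * n%:R.
    elim: n => [_|n IH nN].
      by rewrite /nd mulr0 mul0r subrr normr0 mulr0.
    have -> : F (nd n.+1) - F 0 = (F (nd n.+1) - F (nd n)) + (F (nd n) - F 0).
      by rewrite addrA subrK.
    apply: le_trans (ler_normD _ _) _.
    rewrite -[n.+1]addn1 natrD mulrDr mulr1 addrC.
    apply: lerD; first exact/IH/ltnW.
    have -> : (t / N.+1%:R) = nd (n + 1)%N - nd n.
      by rewrite /nd natrD mulrDr mulr1 mulrDl addrC addKr.
    apply: hF.
      apply/andP; split; last by apply: ndle; rewrite addn1.
      by rewrite /nd divr_ge0 // mulr_ge0.
    apply: le_trans tT; rewrite /nd ler_pdivrMr // ler_wpM2l // ler_nat.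
    by rewrite addn1.
  have := h _ (leqnn _); rewrite /nd mulfK ?gt_eqF // => /le_trans; apply.
  rewrite expr_div_n -mulrA le_eqVlt; apply/orP; left; apply/eqP.
  by field; rewrite gt_eqF //; have := Np; lra.
apply/eqP; rewrite -subr_eq0 -normr_le0.
have [C0'|C0'] := leP (C * t ^+ 2) 0.
  by apply: le_trans (C0 0%N) _; rewrite divr1.
rewrite leNgt; apply/negP => Fp.
(* Fine enough that C t^2 / (N + 1) falls below the supposedly nonzero increment. *)
pose N := Num.truncn (C * t ^+ 2 / `|F t - F 0|).
have : C * t ^+ 2 / `|F t - F 0| < N.+1%:R.
  exact: truncnS_gt.
rewrite ltr_pdivrMr // => h.
have := C0 N; rewrite ler_pdivlMr // => h2.
by have := le_lt_trans h2 h; rewrite mulrC ltxx.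
Qed.

End BoundedMeasurable.

(** * Lipschitz functions given as primitives, and their product rule *)

Section AbsolutelyContinuous.
Variables (R : realType) (T : R).
Implicit Types (f g h : R -> R) (r s t B C : R).

(** [f'] is a derivative in the integrated sense only and may jump; its boundedness makes [f]
    Lipschitz. *)
Definition ac f f' : Prop :=
  bm T f' /\ forall t, 0 <= t <= T -> f t = f 0 + int0 f' t.

Lemma ac_inc f f' s t : ac f f' -> 0 <= s <= t -> t <= T ->
  f t - f s = int0 f' t - int0 f' s.
Proof.
move=> [_ hf] /andP[s0 st] tT; rewrite (hf t) ?(le_trans s0) // (hf s); first by lra.
by rewrite s0 (le_trans st).
Qed.

Lemma ac_lip f f' : ac f f' -> exists2 B, 0 < B &
  forall s t, 0 <= s <= t -> t <= T -> `|f t - f s| <= B * (t - s).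
Proof.
move=> acf; have [B B0 hB] := bm_bound acf.1; exists B => // s t st tT.
rewrite (ac_inc acf) //; apply: (int0_inc_bound acf.1 st tT).
move=> r /andP[sr rt]; move: st => /andP[s0 _].
by apply: hB; rewrite (le_trans s0 sr) (le_trans rt).
Qed.

Lemma lip_cont f B :
  (forall s t, 0 <= s <= t -> t <= T -> `|f t - f s| <= B * (t - s)) ->
  {within `[0, T], continuous f}.
Proof.
move=> hB; have hB' s t : 0 <= s <= T -> 0 <= t <= T ->
    `|f t - f s| <= `|B| * `|t - s|.
  wlog st : s t / s <= t => [H|] /andP[s0 sT] /andP[t0 tT].
    have [st|/ltW ts] := leP s t; first by apply: H => //; apply/andP.
    by rewrite distrC (distrC t); apply: H => //; apply/andP.
  apply: le_trans (hB s t _ _) _ => //; first by rewrite s0.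
  by rewrite (@ger0_norm _ (t - s)) ?subr_ge0 // ler_wpM2r ?subr_ge0 // ler_norm.
apply/subspace_continuousP => x /=; rewrite in_itv /= => xT.
have B1 : 0 < `|B| + 1 by rewrite ltr_pwDr.
apply/cvgrPdist_le => e e0; rewrite near_withinE.
near=> s; move=> /=; rewrite in_itv /= => sT.
apply: le_trans (hB' _ _ sT xT) _.
apply: (@le_trans _ _ ((`|B| + 1) * `|x - s|)).
  by rewrite ler_wpM2r // lerDl.
rewrite mulrC -ler_pdivlMr //.
near: s; exact: (@cvgr_dist_le _ _ _ _ _ id x cvg_id (e / (`|B| + 1)) (divr_gt0 e0 B1)).
Unshelve. all: by end_near. Qed.

Lemma ac_cont f f' : ac f f' -> {within `[0, T], continuous f}.
Proof. by move=> /ac_lip[B _]; exact: lip_cont. Qed.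

Lemma ac_bm f f' : ac f f' -> bm T f.
Proof. by move=> /ac_cont; exact: bm_cont. Qed.

Lemma ac_ext f g f' g' : (forall t, 0 <= t <= T -> f t = g t) ->
  (forall t, 0 <= t <= T -> f' t = g' t) -> ac f f' -> ac g g'.
Proof.
move=> fg fg' [bf hf]; split; first exact: bm_ext bf.
move=> t tT; have /andP[t0 tT'] := tT.
rewrite -fg // hf // fg ?lexx ?(le_trans t0) //; congr (_ + _).
by apply: int0_ext => s /andP[s0 st]; rewrite fg' // s0 (le_trans st).
Qed.

Lemma ac_int0 f : bm T f -> ac (int0 f) f.
Proof. by move=> bf; split=> // t _; rewrite int0_0 add0r. Qed.

Lemma ac_cst c : ac (fun=> c) (fun=> 0).
Proof.
split; first exact: bm_cst.
by move=> t /andP[t0 _]; rewrite int0_cst // mul0r addr0.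
Qed.

Lemma acD f g f' g' : ac f f' -> ac g g' ->
  ac (fun t => f t + g t) (fun t => f' t + g' t).
Proof.
move=> [bf hf] [bg hg]; split; first exact: bmD.
move=> t tT; have /andP[_ tT'] := tT.
by rewrite (int0D bf bg) // (hf t tT) (hg t tT); lra.
Qed.

(** The difference between the product and the claimed primitive has increments of second order in
    the step, so [quad_const] applies and differentiation almost everywhere is avoided. *)
Lemma acM f g f' g' : ac f f' -> ac g g' ->
  ac (fun t => f t * g t) (fun t => f' t * g t + f t * g' t).
Proof.
move=> acf acg; have bf := ac_bm acf; have bg := ac_bm acg.
have [bf' hf] := acf; have [bg' hg] := acg.
have bH : bm T (fun t => f' t * g t + f t * g' t).
  by apply: bmD; exact: bmM.
split=> // t tT.
have [B B0 hB] := bm_bound bf'; have [C C0 hC] := bm_bound bg'.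
have [Lf Lf0 lf] := ac_lip acf; have [Lg Lg0 lg] := ac_lip acg.
pose F t := f t * g t - int0 (fun t => f' t * g t + f t * g' t) t.
suff /(_ _ tT) : forall t, 0 <= t <= T -> F t = F 0 by rewrite /F int0_0; lra.
apply: (@quad_const _ _ _ (B * Lg + Lf * C)) => r s rs sT.
have /andP[r0 rs'] := rs.
(* With [g] compared to its value at [s] and [f] to its value at [r], both differences are O(s - r)
   on [r, s]; integrating them yields the second order. *)
have -> : F s - F r =
    int0 (fun x => f' x * (g s - g x) + (f r - f x) * g' x) s
    - int0 (fun x => f' x * (g s - g x) + (f r - f x) * g' x) r.
  have split_int x : x <= T ->
      int0 (fun x => f' x * (g s - g x) + (f r - f x) * g' x) x =
      g s * int0 f' x + f r * int0 g' x
      - int0 (fun t => f' t * g t + f t * g' t) x.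
    move=> xT; rewrite -(int0Z _ bf') // -(int0Z _ bg') //.
    rewrite -(int0D (bmM (bm_cst _ _) bf') (bmM (bm_cst _ _) bg')) //.
    rewrite -(int0B (bmD (bmM (bm_cst _ _) bf') (bmM (bm_cst _ _) bg')) bH) //.
    by apply: int0_ext => y _; ring.
  rewrite !split_int // ?(le_trans rs') // /F.
  have := ac_inc acf rs sT; have := ac_inc acg rs sT => h1 h2.
  rewrite [f s * g s](_ : _ = (f s - f r) * g s + f r * (g s - g r) + f r * g r);
    last by ring.
  by rewrite h1 h2; ring.
rewrite expr2 mulrA.
apply: (int0_inc_bound _ rs sT).
  exact: (bmD (bmM bf' (bmB (bm_cst _ _) bg)) (bmM (bmB (bm_cst _ _) bf) bg')).
move=> x /andP[rx xs]; have x0T : 0 <= x <= T.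
  by rewrite (le_trans r0 rx) (le_trans xs sT).
apply: le_trans (ler_normD _ _) _; rewrite [leRHS]mulrDl !normrM -!mulrA.
have xr : 0 <= x - r <= s - r by rewrite subr_ge0 rx lerB.
have sx : 0 <= s - x <= s - r by rewrite subr_ge0 xs lerB.
have /andP[x0 _] := x0T.
have h1 : `|g s - g x| <= Lg * (s - r).
  apply: le_trans (lg x s _ sT) _; first by rewrite x0.
  by apply: ler_wpM2l; [exact: ltW | case/andP: sx].
have h2 : `|f r - f x| <= Lf * (s - r).
  rewrite distrC; apply: le_trans (lf r x _ _) _; first by rewrite r0.
    by rewrite (le_trans xs).
  by apply: ler_wpM2l; [exact: ltW | case/andP: xr].
apply: lerD; first by apply: ler_pM => //; exact: hB.
by rewrite [leRHS]mulrA [leRHS]mulrAC; apply: ler_pM => //; exact: hC.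
Qed.

Lemma acZ c f f' : ac f f' -> ac (fun t => c * f t) (fun t => c * f' t).
Proof.
move=> /(acM (ac_cst c)); apply: ac_ext => // t _.
by rewrite mul0r add0r.
Qed.

Lemma acN f f' : ac f f' -> ac (fun t => - f t) (fun t => - f' t).
Proof.
by move=> /(acZ (-1)); apply: ac_ext => // t _; rewrite mulN1r.
Qed.

Lemma ac_sum (J : Type) (r : seq J) (F F' : J -> R -> R) :
  (forall i, ac (F i) (F' i)) ->
  ac (fun t => \sum_(i <- r) F i t) (fun t => \sum_(i <- r) F' i t).
Proof.
move=> h; elim: r => [|i r IH].
  under eq_fun do rewrite big_nil; under [X in ac _ X]eq_fun do rewrite big_nil.
  exact: ac_cst.
under eq_fun do rewrite big_cons.
under [X in ac _ X]eq_fun do rewrite big_cons.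
exact: acD.
Qed.

Lemma ac_of_derive f f' : 0 < T -> {within `[0, T], continuous f} ->
  {within `[0, T], continuous f'} ->
  (forall t, t \in `]0, T[ -> is_derive t (1 : R) f (f' t)) -> ac f f'.
Proof.
move=> T0 cf cf' df; split; first exact: bm_cont.
move=> t /andP[]; rewrite le_eqVlt => /predU1P[<- _|t0 tT].
  by rewrite int0_0 addr0.
have sub : `[0, t]%classic `<=` `[0, T].
  by move=> x /=; rewrite !in_itv /= => /andP[-> /le_trans]; exact.
have sub' x : x \in `]0, t[ -> x \in `]0, T[.
  by rewrite !in_itv /= => /andP[-> /lt_le_trans]; exact.
have cft := continuous_subspaceW sub cf.
have cft' := continuous_subspaceW sub cf'.
have [_ c0 ct] := (continuous_within_itvP f t0).1 cft.
have := @continuous_FTC2 _ f' f 0 t t0 cft'.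
rewrite /int0 /Rintegral => ->; first by rewrite /=; lra.
- split=> // x xt; by have [] := df _ (sub' _ xt).
- by move=> x xt; rewrite derive1E; have [] := df _ (sub' _ xt).
Qed.

Lemma unif_cont f : {within `[0, T], continuous f} -> forall e : R, 0 < e ->
  exists2 d, 0 < d & forall s t, 0 <= s <= T -> 0 <= t <= T ->
    `|t - s| < d -> `|f t - f s| <= e.
Proof.
move=> cf e e0.
have := (compact_near_coveringP _).1 (@segment_compact R 0 T) _ (0 : R)^'+
  (fun d x : R => 0 <= x <= T -> forall y : R, 0 <= y <= T ->
     `|y - x| < d -> `|f y - f x| <= e) _.
have e2 : 0 < e / 2 by exact: divr_gt0.
case=> [x /= |d /= d0 hd].
  rewrite in_itv /= => xT.
  move/subspace_continuousP : cf => /(_ x); rewrite /= in_itv /= => /(_ xT).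
  move=> /cvgrPdist_le /(_ _ e2); rewrite near_withinE => -[d /= d0 hd].
  have d2 : 0 < d / 2 by exact: divr_gt0.
  exists (ball x (d / 2), [set u | 0 < u < d / 2]) => /=.
    split; first exact: nbhsx_ballx.
    near=> u => /=; apply/andP; split; near: u; first exact: nbhs_right_gt.
    exact: nbhs_right_lt.
  move=> [z u] /= [xz /andP[u0 ud]] zT y yT yz.
  have hz : `|f x - f z| <= e / 2.
    apply: hd; last by rewrite /= in_itv.
    by apply: lt_le_trans xz _; rewrite ler_pdivrMr // ler_peMr ?ltW //; lra.
  have hy : `|f x - f y| <= e / 2.
    apply: hd; last by rewrite /= in_itv.
    rewrite /= (_ : x - y = (x - z) - (y - z)); last by ring.
    apply: le_lt_trans (ler_normB _ _) _.
    have : `|x - z| < d / 2 := xz.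
    by lra.
  rewrite (_ : f y - f z = (f x - f z) - (f x - f y)); last by ring.
  by apply: le_trans (ler_normB _ _) _; lra.
exists (d / 2); first by rewrite divr_gt0.
move=> s t sT tT std; apply: (hd (d / 2)) => //=; rewrite ?in_itv //.
  by rewrite sub0r normrN gtr0_norm ?divr_gt0 // ltr_pdivrMr // ltr_pMr // ltr1n.
by rewrite divr_gt0.
Unshelve. all: by end_near. Qed.

End AbsolutelyContinuous.

(** * Left-endpoint sums against a continuous path *)

Section StieltjesSums.
Variables (R : realType) (T : R).

(** [y] will be a Brownian path, of which only continuity is known. Summation by parts moves the
    increments onto the Lipschitz function [k], and uniform continuity of [y] controls the
    remainder. *)
Lemma riemann_stieltjes_cvg (k k' y : R -> R) (t : R) :
  ac T k k' -> {within `[0, T], continuous y} -> 0 <= t <= T ->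
  (\sum_(i < N) k (t * i%:R / N%:R) *
     (y (t * i.+1%:R / N%:R) - y (t * i%:R / N%:R))) @[N --> \oo]
  --> k t * y t - k 0 * y 0 - int0 (fun s => k' s * y s) t.
Proof.
move=> ack cy /andP[t0 tT].
have [bk' hk] := ack; have [B B0 hB] := bm_bound bk'.
have by_ := bm_cont cy; have bky := bmM bk' by_.
apply/cvgrPdist_le => e e0.
have T0 : 0 <= T := le_trans t0 tT.
(* The error per cell is at most B e' t / N, so the total is at most e; T + 1 keeps the denominator
   positive when T = 0. *)
pose e' := e / (B * (T + 1)).
have BT : 0 < B * (T + 1) by rewrite mulr_gt0 // ltr_pwDr.
have e'0 : 0 < e' by rewrite divr_gt0.
have [d d0 hd] := unif_cont cy e'0.
near=> N.
have N0 : (0 < N)%N by near: N; exact: nbhs_infty_gt.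
have Np : 0 < N%:R :> R by rewrite ltr0n.
have NtT : t / N%:R < d.
  rewrite ltr_pdivrMr // mulrC -ltr_pdivrMr //.
  near: N; exact: nbhs_infty_gtr.
pose nd i := t * i%:R / N%:R.
have ndle i j : (i <= j)%N -> nd i <= nd j.
  by move=> ij; rewrite /nd ler_pM2r ?invr_gt0 // ler_wpM2l // ler_nat.
have nd0 : nd 0%N = 0 by rewrite /nd mulr0 mul0r.
have ndN : nd N = t by rewrite /nd mulfK // gt_eqF.
have ndT i : (i <= N)%N -> 0 <= nd i <= T.
  move=> iN; rewrite -[0]nd0 ndle //=.
  by apply: le_trans (ndle _ _ iN) _; rewrite ndN.
pose H s := int0 (fun s => k' s * y s) s.
(* Abel summation: the boundary terms telescope, leaving on each cell the increment of [k] times a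
   right endpoint value of [y], minus the integral of k' y. *)
have -> : k t * y t - k 0 * y 0 - int0 (fun s => k' s * y s) t
   - \sum_(i < N) k (nd i) * (y (nd i.+1) - y (nd i)) =
   \sum_(i < N) ((k (nd i.+1) - k (nd i)) * y (nd i.+1) - (H (nd i.+1) - H (nd i))).
  have tel (f : R -> R) : f t - f 0 = \sum_(i < N) (f (nd i.+1) - f (nd i)).
    rewrite -(big_mkord xpredT (fun i => f (nd i.+1) - f (nd i))).
    by rewrite telescope_sumr // ndN nd0.
  have -> : int0 (fun s => k' s * y s) t = H t - H 0 by rewrite /H int0_0 subr0.
  rewrite (tel (fun s => k s * y s)) (tel H) -!sumrB.
  by apply: eq_bigr => i _; ring.
apply: le_trans (ler_norm_sum _ _ _) _.
have step (i : 'I_N) : `|(k (nd i.+1) - k (nd i)) * y (nd i.+1)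
    - (H (nd i.+1) - H (nd i))| <= e / N%:R.
  have iN : (i < N)%N by [].
  have rs : 0 <= nd i <= nd i.+1.
    by rewrite ndle // andbT; case/andP: (ndT i (ltnW iN)).
  have sT : nd i.+1 <= T by case/andP: (ndT _ iN).
  rewrite (ac_inc ack rs sT).
  have spl x : x <= T ->
      int0 (fun r => k' r * (y (nd i.+1) - y r)) x
      = int0 k' x * y (nd i.+1) - H x.
    move=> xT; rewrite mulrC /H -(int0Z _ bk' xT).
    rewrite -(int0B (bmM (bm_cst _ _) bk') bky xT).
    by apply: int0_ext => r _; ring.
  have -> : (int0 k' (nd i.+1) - int0 k' (nd i)) * y (nd i.+1)
      - (H (nd i.+1) - H (nd i)) =
      int0 (fun r => k' r * (y (nd i.+1) - y r)) (nd i.+1)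
      - int0 (fun r => k' r * (y (nd i.+1) - y r)) (nd i).
    have /andP[_ rT] := ndT _ (ltnW iN).
    by rewrite !spl //; ring.
  have dn : nd i.+1 - nd i = t / N%:R.
    by rewrite /nd -addn1 natrD; ring.
  apply: le_trans (@int0_inc_bound _ T _ (B * e') _ _ _ rs sT _) _.
  - exact: bmM bk' (bmB (bm_cst _ _) by_).
  - move=> r /andP[ir ri]; rewrite normrM.
    have rT : 0 <= r <= T.
      by case/andP: rs => h _; rewrite (le_trans h ir) (le_trans ri sT).
    apply: ler_pM => //; first exact: hB.
    apply: hd => //; first exact: ndT.
    rewrite ger0_norm ?subr_ge0 //; apply: le_lt_trans NtT.
    by rewrite -dn lerB.
  - rewrite dn mulrA ler_pM2r ?invr_gt0 // /e'.
    rewrite (_ : B * (e / (B * (T + 1))) * t = e * (t / (T + 1))).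
      rewrite ger_pMr // ler_pdivrMr ?mul1r; last by rewrite ltr_pwDr.
      by rewrite (le_trans tT) // lerDl.
    by field; rewrite !gt_eqF // ltr_pwDr.
apply: le_trans (ler_sum _ (fun i _ => step i)) _.
by rewrite sumr_const card_ord -(mulr_natr (e / N%:R)) divfK // gt_eqF.
Unshelve. all: by end_near. Qed.

End StieltjesSums.

(** * Uniqueness and existence for linear differential equations *)

Section Gronwall.
Variables (R : realType) (T : R).
Hypothesis T0 : 0 < T.

Lemma ac_expR (l : R) : ac T (fun t => expR (l * t)) (fun t => l * expR (l * t)).
Proof.
have c0 : continuous (fun t : R => expR (l * t)).
  move=> x; apply: (@continuous_comp _ _ _ ( *%R l) expR).
    exact: mulrl_continuous.
  exact: continuous_expR.
apply: ac_of_derive => //.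
- exact: continuous_subspaceT.
- apply: continuous_subspaceT => x; apply: cvgM; first exact: cvg_cst.
  exact: c0.
- move=> t _.
  have h1 : is_derive t (1 : R) ( *%R l) l.
    have := is_deriveZ l (is_derive_id t (1 : R)).
    by rewrite (_ : l *: (1 : R) = l) //; exact: mulr1.
  rewrite [l * _]mulrC.
  exact: (is_derive1_comp (is_derive_expR (l * t)) h1).
Qed.

Lemma int0_expR_le (l t : R) : 0 < l -> 0 <= t <= T ->
  int0 (fun s => expR (l * s)) t <= expR (l * t) / l.
Proof.
move=> l0 tT; have [_ /(_ _ tT)] := ac_expR l.
have bE : bm T (fun s => expR (l * s)) := ac_bm (ac_expR l).
case/andP: tT => _ tT.
rewrite (int0Z _ bE) // mulr0 expR0 ler_pdivlMr // => ->.
by rewrite mulrC lerDr.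
Qed.

Lemma le_expn2 (c x : R) : (forall n, x <= c / 2 ^+ n) -> x <= 0.
Proof.
move=> h; have cv : (c / 2 ^+ n) @[n --> \oo] --> (0 : R).
  have := @cvg_geometric R c 2^-1.
  rewrite ger0_norm ?invr_ge0 // invf_lt1 ?ltr1n // => /(_ isT).
  by rewrite (_ : geometric _ _ = fun n => c / 2 ^+ n) //; apply/funext => n /=; rewrite exprVn.
rewrite -(cvg_lim _ cv) //; apply: limr_ge; first by apply/cvg_ex; exists 0.
by near=> n; exact: h.
Unshelve. all: by end_near. Qed.

(** Iterating the inequality in the norm weighted by exp(l t): one integration gains the factor K /
    l, which is at most 1/2 for l = 2 K + 1, so g <= M 2^-n exp(l t) for every n. *)
Lemma gronwall0 (g : R -> R) (K : R) : bm T g -> 0 <= K ->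
  (forall t : R, 0 <= t <= T -> 0 <= g t <= K * int0 g t) ->
  forall t : R, 0 <= t <= T -> g t = 0.
Proof.
move=> bg K0 hg.
have [M M0 hM] := bm_bound bg.
pose l := 2 * K + 1.
have l0 : 0 < l by rewrite /l; lra.
have it n t : 0 <= t <= T -> g t <= M / 2 ^+ n * expR (l * t).
  elim: n t => [|n IH] t tT; have /andP[t0 t1] := tT.
    rewrite expr0 divr1; apply: le_trans (le_trans (ler_norm _) (hM t tT)) _.
    by rewrite ler_peMr ?(ltW M0) // -expR0 ler_expR mulr_ge0 // ltW.
  have /andP[_ h] := hg t tT; apply: le_trans h _.
  have bE : bm T (fun s => expR (l * s)) := ac_bm (ac_expR l).
  have h1 : int0 g t <= M / 2 ^+ n * (expR (l * t) / l).
    apply: (@le_trans _ _ (M / 2 ^+ n * int0 (fun s => expR (l * s)) t)).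
      rewrite -(int0Z _ bE t1); apply: (int0_le bg (bmM (bm_cst _ _) bE) t1).
      by move=> s /andP[s0 st]; apply: IH; rewrite s0 (le_trans st).
    by rewrite ler_wpM2l ?int0_expR_le // divr_ge0 ?exprn_ge0 // ltW.
  apply: le_trans (ler_wpM2l K0 h1) _.
  rewrite (_ : K * _ = K / l * (M / 2 ^+ n * expR (l * t))); last by ring.
  rewrite [leRHS](_ : _ = 2^-1 * (M / 2 ^+ n * expR (l * t))); last first.
    by rewrite exprS invfM; ring.
  apply: ler_wpM2r; first by rewrite !mulr_ge0 ?expR_ge0 ?invr_ge0 ?exprn_ge0 // ltW.
  by rewrite ler_pdivrMr // /l; lra.
move=> t tT; have /andP[g0 _] := hg t tT.
apply/eqP; rewrite eq_le g0 andbT; apply: (@le_expn2 (M * expR (l * t))) => n.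
by rewrite mulrAC; exact: it.
Qed.

Lemma linear_ode_uniq (J : finType) (F F' : J -> R -> R) (C : R) :
  (forall j, ac T (F j) (F' j)) -> (forall j, F j 0 = 0) ->
  (forall j (t : R), 0 <= t <= T -> `|F' j t| <= C * \sum_k `|F k t|) ->
  forall j (t : R), 0 <= t <= T -> F j t = 0.
Proof.
move=> acF F0 hF j t tT.
pose g t := \sum_k `|F k t|.
have bg : bm T g by apply: bm_sum => k; apply: bm_norm; exact: ac_bm (acF k).
have C0 : 0 <= `|C| by [].
have g0 s : 0 <= g s by apply: sumr_ge0.
suff : g t = 0.
  move=> /eqP; rewrite psumr_eq0 // => /allP /(_ j).
  by rewrite mem_index_enum => /(_ isT) /eqP/normr0_eq0.
apply: (@gronwall0 g (#|J|%:R * `|C|)) tT => //.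
move=> s sT; rewrite g0 /=; have /andP[s0 s1] := sT.
rewrite /g mulr_natl mulrnAl -sumr_const; apply: ler_sum => k _.
have [bF' ->] := acF k; rewrite // F0 add0r.
apply: le_trans (norm_int0_le bF' s1) _.
rewrite -(int0Z _ bg s1).
apply: (int0_le (bm_norm bF') (bmM (bm_cst _ _) bg) s1).
move=> r /andP[r0 rs]; apply: le_trans (hF k r _) _.
  by rewrite r0 (le_trans rs).
by apply: ler_wpM2r; [exact: g0 | exact: ler_norm].
Qed.

(** The sequences u n - 2 K / 2^n and u n + 2 K / 2^n are monotone and enclose the limit, which
    gives the explicit rate together with the limit. *)
Lemma geometric_cauchy (u : nat -> R) (K : R) : 0 <= K ->
  (forall n, `|u n.+1 - u n| <= K / 2 ^+ n) ->
  exists l, forall n, `|l - u n| <= 2 * K / 2 ^+ n.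
Proof.
move=> K0 hu.
have p n : 2 * K / 2 ^+ n.+1 = K / 2 ^+ n.
  by rewrite exprS invfM mulrA; field; rewrite expf_neq0.
pose w n := u n - 2 * K / 2 ^+ n.
pose v n := u n + 2 * K / 2 ^+ n.
have wS n : w n <= w n.+1.
  by rewrite /w p; have := hu n; rewrite ler_norml => /andP[]; lra.
have vS n : v n.+1 <= v n.
  by rewrite /v p; have := hu n; rewrite ler_norml => /andP[]; lra.
have wv n : w n <= v n.
  have : 0 <= 2 * K / 2 ^+ n by rewrite divr_ge0 ?exprn_ge0 // mulr_ge0.
  by rewrite /w /v; lra.
have wm n m : (n <= m)%N -> w n <= w m by apply: (homo_leq _ le_trans).
have vm n m : (n <= m)%N -> v m <= v n.
  by apply: (homo_leq (r := fun x y => y <= x)) => // x y z xy /le_trans; exact.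
have wvnm n m : w n <= v m.
  apply: le_trans (wm _ _ (leq_maxl n m)) _.
  exact: le_trans (wv _) (vm _ _ (leq_maxr n m)).
have hs : has_sup (range w).
  by split; [exists (w 0%N), 0%N | exists (v 0%N) => _ [n _ <-]].
exists (sup (range w)) => n.
have h1 : w n <= sup (range w) by apply: sup_upper_bound => //; exists n.
have h2 : sup (range w) <= v n.
  by apply: sup_le_ub; [case: hs | move=> _ [m _ <-]].
by move: h1 h2; rewrite /w /v ler_norml => ? ?; apply/andP; split; lra.
Qed.

(** Picard iteration for coefficients that are merely bounded and measurable. *)
Lemma linear_ode_exists (J : finType) (A : J -> J -> R -> R) (x0 : J -> R) :
  (forall j k, bm T (A j k)) ->
  exists F : J -> R -> R, (forall j, F j 0 = x0 j) /\
    forall j, ac T (F j) (fun t => \sum_k A j k t * F k t).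
Proof.
move=> bA.
have [B B0 hB] : exists2 B, 0 < B &
    forall j k t, 0 <= t <= T -> `|A j k t| <= B.
  have /choice[Bf hBf] : forall p : J * J, exists B, 0 < B /\
      forall t, 0 <= t <= T -> `|A p.1 p.2 t| <= B.
    by move=> [j k]; have [B ? ?] := bm_bound (bA j k); exists B.
  exists (1 + \sum_p Bf p).
    by rewrite ltr_pwDl // sumr_ge0 // => p _; have [/ltW] := hBf p.
  move=> j k t tT; have [_ /(_ _ tT) /= h] := hBf (j, k).
  apply: le_trans h _; rewrite (bigD1 (j, k)) //= addrCA lerDl addr_ge0 //.
  by rewrite sumr_ge0 // => p _; have [/ltW] := hBf p.
pose M := 1 + \sum_k `|x0 k|.
have M0 : 0 < M by rewrite ltr_pwDl // sumr_ge0.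
pose NB := #|J|%:R * B.
have NB0 : 0 <= NB by rewrite mulr_ge0 // ltW.
(* In the norm weighted by exp(l t) the Picard map contracts with ratio NB / l <= 1/2 on the whole
   of [0, T], so no subdivision of the interval is needed. *)
pose l := 2 * NB + 1.
have l0 : 0 < l by rewrite /l; lra.
pose s := fix s n := if n is m.+1 then
   fun j t => x0 j + int0 (fun r => \sum_k A j k r * s m k r) t
   else fun j (t : R) => x0 j.
have bs n j : bm T (s n j).
  elim: n j => [|n IH] j; first exact: bm_cst.
  apply: bmD; first exact: bm_cst.
  by apply: ac_bm; apply: ac_int0; apply: bm_sum => k; exact: bmM.
have bAs n j : bm T (fun r => \sum_k A j k r * s n k r).
  by apply: bm_sum => k; exact: bmM.
have bE : bm T (fun s => expR (l * s)) := ac_bm (ac_expR l).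
have E1 t : 0 <= t <= T -> 1 <= expR (l * t).
  by move=> /andP[t0 _]; rewrite -expR0 ler_expR mulr_ge0 // ltW.
have key (f : J -> R -> R) c j t : (forall k, bm T (f k)) -> 0 <= c ->
    (forall k r, 0 <= r <= T -> `|f k r| <= c * expR (l * r)) ->
    0 <= t <= T ->
    `|int0 (fun r => \sum_k A j k r * f k r) t| <= c / 2 * expR (l * t).
  move=> bf c0 hf tT; have /andP[t0 t1] := tT.
  have bAf : bm T (fun r => \sum_k A j k r * f k r).
    by apply: bm_sum => k; exact: bmM.
  apply: le_trans (norm_int0_le bAf t1) _.
  apply: (@le_trans _ _ (int0 (fun r => NB * c * expR (l * r)) t)).
    apply: (int0_le (bm_norm bAf) (bmM (bm_cst _ _) bE) t1) => r /andP[r0 rt].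
    have rT : 0 <= r <= T by rewrite r0 (le_trans rt).
    apply: le_trans (ler_norm_sum _ _ _) _.
    rewrite /NB -!mulrA mulr_natl -sumr_const; apply: ler_sum => k _.
    by rewrite normrM; apply: ler_pM => //; [exact: hB | exact: hf].
  rewrite (int0Z _ bE t1).
  apply: le_trans (ler_wpM2l (mulr_ge0 NB0 c0) (int0_expR_le l0 tT)) _.
  rewrite (_ : _ * (_ / l) = NB / l * (c * expR (l * t))); last by ring.
  rewrite (_ : c / 2 * _ = 2^-1 * (c * expR (l * t))); last by ring.
  apply: ler_wpM2r; first by rewrite mulr_ge0 ?expR_ge0.
  by rewrite ler_pdivrMr // /l; lra.
have inc n j t : 0 <= t <= T ->
    `|s n.+1 j t - s n j t| <= M * expR (l * t) / 2 ^+ n.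
  elim: n j t => [|n IH] j t tT; have /andP[t0 t1] := tT.
    rewrite /= addrC addKr expr0 divr1.
    apply: le_trans (key (fun k _ => x0 k) M j t _ (ltW M0) _ tT) _.
    - by move=> k; exact: bm_cst.
    - move=> k r rT; apply: (@le_trans _ _ M).
        rewrite /M (bigD1 k) //= addrCA lerDl addr_ge0 //.
        by rewrite sumr_ge0.
      by rewrite ler_peMr ?(ltW M0) // E1.
    - rewrite ler_wpM2r ?expR_ge0 // ler_pdivrMr // ler_peMr ?(ltW M0) //.
      by rewrite ler1n.
  rewrite [s n.+2]/s -/s [s n.+1 j t]/s -/s.
  rewrite (_ : _ - _ = int0 (fun r => \sum_k A j k r * (s n.+1 k r - s n k r)) t).
    rewrite (_ : M * expR (l * t) / 2 ^+ n.+1 = M / 2 ^+ n / 2 * expR (l * t)).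
      apply: key => //.
      - by move=> k; exact: bmB.
      - by rewrite divr_ge0 ?exprn_ge0 // ltW.
      - by move=> k r rT; rewrite mulrAC; exact: IH.
    by rewrite exprS invfM; ring.
  rewrite [X in _ = int0 X t](_ : _ = (fun r => \sum_k A j k r * s n.+1 k r
     - \sum_k A j k r * s n k r)); last first.
    by apply/funext => r; rewrite -sumrB; apply: eq_bigr => k _; rewrite mulrBr.
  by rewrite (int0B (bAs _ _) (bAs _ _) t1); ring.
(* The limit is chosen at each time separately. It is measurable as a pointwise limit, and the
   explicit rate bounds it and carries the integral equation to the limit. *)
have /choice[F hF] : forall p : J * R, exists L, 0 <= p.2 <= T ->
    forall n, `|L - s n p.1 p.2| <= 2 * (M * expR (l * p.2)) / 2 ^+ n.
  move=> [j t] /=; have [tT|tT] := boolP (0 <= t <= T); last by exists 0.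
  have [||L hL] := @geometric_cauchy (fun n => s n j t) (M * expR (l * t)).
  - by rewrite mulr_ge0 ?expR_ge0 // ltW.
  - by move=> n; exact: inc.
  by exists L.
have hF' j t n : 0 <= t <= T ->
    `|F (j, t) - s n j t| <= 2 * M / 2 ^+ n * expR (l * t).
  by move=> tT; have := hF (j, t) tT n; rewrite [2 * (M * _)]mulrA mulrAC.
have bF j : bm T (fun t => F (j, t)).
  split.
    apply: (measurable_fun_cvg (h := fun n t => s n j t)) => [n|t /=].
      by have [] := bs n j.
    rewrite in_itv /= => tT; apply/cvgrPdist_le => e e0.
    have := @cvg_geometric R (2 * M * expR (l * t)) 2^-1.
    rewrite ger0_norm ?invr_ge0 // invf_lt1 ?ltr1n // => /(_ isT).
    move=> /cvgrPdist_le /(_ _ e0); apply: filterS => n.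
    rewrite sub0r normrN => h; apply: le_trans (hF' j t n tT) _.
    by apply: le_trans h; rewrite /geometric /= exprVn mulrAC ler_norm.
  exists (`|x0 j| + 2 * M * expR (l * T)) => t tT.
  have := hF' j t 0%N tT; rewrite expr0 divr1 /= => h.
  rewrite -(subrK (x0 j) (F (j, t))) addrC.
  apply: le_trans (ler_normD _ _) _; apply: lerD => //.
  apply: le_trans h _; rewrite ler_wpM2l ?mulr_ge0 ?(ltW M0) // ler_expR.
  by rewrite ler_wpM2l ?(ltW l0) //; case/andP: tT.
have bAF j : bm T (fun r => \sum_k A j k r * F (k, r)).
  by apply: bm_sum => k; exact: bmM.
have eqF j t : 0 <= t <= T ->
    F (j, t) = x0 j + int0 (fun r => \sum_k A j k r * F (k, r)) t.
  move=> tT; have /andP[t0 t1] := tT.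
  apply/eqP; rewrite -subr_eq0 -normr_le0; apply: (@le_expn2 (4 * M * expR (l * t))).
  move=> n.
  have -> : F (j, t) - (x0 j + int0 (fun r => \sum_k A j k r * F (k, r)) t)
      = (F (j, t) - s n.+1 j t)
        - int0 (fun r => \sum_k A j k r * (F (k, r) - s n k r)) t.
    rewrite [X in _ - int0 X t](_ : _ = (fun r => \sum_k A j k r * F (k, r)
       - \sum_k A j k r * s n k r)); last first.
      by apply/funext => r; rewrite -sumrB; apply: eq_bigr => k _; rewrite mulrBr.
    by rewrite (int0B (bAF _) (bAs _ _) t1) [s n.+1 j t]/s -/s; ring.
  apply: le_trans (ler_normB _ _) _.
  rewrite (_ : 4 * M * expR (l * t) / 2 ^+ n =
     2 * M / 2 ^+ n * expR (l * t) + 2 * M / 2 ^+ n * expR (l * t)); last by ring.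
  have c0 : 0 <= 2 * M / 2 ^+ n by rewrite divr_ge0 ?exprn_ge0 // mulr_ge0 // ltW.
  apply: lerD.
    apply: le_trans (hF' j t n.+1 tT) _; rewrite ler_wpM2r ?expR_ge0 //.
    rewrite exprS invfM mulrA mulrAC ler_pdivrMr // ler_peMr //.
    by rewrite ler1n.
  apply: le_trans (@key (fun k r => F (k, r) - s n k r) _ j t _ c0 _ tT) _.
  - by move=> k; exact: bmB.
  - by move=> k r rT; exact: hF'.
  - by rewrite ler_wpM2r ?expR_ge0 // ler_pdivrMr // ler_peMr // ler1n.
exists (fun j t => F (j, t)); split.
  by move=> j; rewrite eqF ?int0_0 ?addr0 // lexx ltW.
move=> j; split => // t tT; rewrite {1}eqF // (@eqF j 0) ?int0_0 ?addr0 //.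
by rewrite lexx ltW.
Qed.

End Gronwall.

(** * Calculus of matrix-valued functions *)

Section MatrixCalculus.
Variables (R : realType) (T : R).
Implicit Types (r s t : R).

Definition bmm m n (F : R -> 'M[R]_(m, n)) : Prop :=
  forall i j, bm T (fun t => F t i j).

Definition acm m n (F F' : R -> 'M[R]_(m, n)) : Prop :=
  forall i j, ac T (fun t => F t i j) (fun t => F' t i j).

Lemma bmm_ext m n (F G : R -> 'M[R]_(m, n)) :
  (forall t, 0 <= t <= T -> F t = G t) -> bmm F -> bmm G.
Proof. by move=> FG bF i j; apply: bm_ext (bF i j) => t /FG ->. Qed.

Lemma bmm_cst m n (A : 'M[R]_(m, n)) : bmm (fun=> A).
Proof. by move=> i j; exact: bm_cst. Qed.

Lemma bmmD m n (F G : R -> 'M[R]_(m, n)) : bmm F -> bmm G ->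
  bmm (fun t => F t + G t).
Proof.
by move=> bF bG i j; apply: bm_ext (bmD (bF i j) (bG i j)) => t _; rewrite mxE.
Qed.

Lemma bmmN m n (F : R -> 'M[R]_(m, n)) : bmm F -> bmm (fun t => - F t).
Proof. by move=> bF i j; apply: bm_ext (bmN (bF i j)) => t _; rewrite mxE. Qed.

Lemma bmmB m n (F G : R -> 'M[R]_(m, n)) : bmm F -> bmm G ->
  bmm (fun t => F t - G t).
Proof. by move=> bF bG; apply: bmmD => //; exact: bmmN. Qed.

Lemma bmmM m n p (F : R -> 'M[R]_(m, n)) (G : R -> 'M[R]_(n, p)) :
  bmm F -> bmm G -> bmm (fun t => F t *m G t).
Proof.
move=> bF bG i j.
apply: (@bm_ext _ _ (fun t => \sum_k F t i k * G t k j)) => [t _|].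
  by rewrite mxE.
by apply: bm_sum => k; exact: bmM.
Qed.

Lemma bmm_tr m n (F : R -> 'M[R]_(m, n)) : bmm F -> bmm (fun t => (F t)^T).
Proof. by move=> bF i j; apply: bm_ext (bF j i) => t _; rewrite mxE. Qed.

Lemma bmmZ m n c (F : R -> 'M[R]_(m, n)) : bmm F -> bmm (fun t => c *: F t).
Proof.
move=> bF i j; apply: bm_ext (bmM (bm_cst _ c) (bF i j)) => t _.
by rewrite mxE.
Qed.

Lemma bmm_tail m n (F : R -> 'M[R]_(m, n)) T0 : bmm F ->
  bmm (fun t => if t < T0 then 0 else F t).
Proof.
move=> bF i j; apply: (@bm_ext _ _ (fun t => if t < T0 then 0 else F t i j)).
  by move=> t _; case: ifP => //; rewrite mxE.
apply: bm_if => //; last exact: bm_cst.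
exact: measurable_fun_ltr.
Qed.

Lemma bm_tr n (F : R -> 'M[R]_n) : bmm F -> bm T (fun t => \tr (F t)).
Proof. by move=> bF; rewrite /mxtrace; exact: bm_sum. Qed.

Lemma acm_bmm m n (F F' : R -> 'M[R]_(m, n)) : acm F F' -> bmm F.
Proof. by move=> h i j; exact: ac_bm (h i j). Qed.

Lemma acm_bmm' m n (F F' : R -> 'M[R]_(m, n)) : acm F F' -> bmm F'.
Proof. by move=> h i j; case: (h i j). Qed.

Lemma acm_ext m n (F G F' G' : R -> 'M[R]_(m, n)) :
  (forall t, 0 <= t <= T -> F t = G t) ->
  (forall t, 0 <= t <= T -> F' t = G' t) -> acm F F' -> acm G G'.
Proof.
by move=> FG FG' h i j; apply: ac_ext (h i j) => t tT; rewrite ?FG ?FG'.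
Qed.

Lemma acm_cst m n (A : 'M[R]_(m, n)) : acm (fun=> A) (fun=> 0).
Proof.
by move=> i j; apply: ac_ext (ac_cst _ (A i j)) => // t _; rewrite mxE.
Qed.

Lemma acmD m n (F G F' G' : R -> 'M[R]_(m, n)) : acm F F' -> acm G G' ->
  acm (fun t => F t + G t) (fun t => F' t + G' t).
Proof.
move=> hF hG i j; apply: ac_ext (acD (hF i j) (hG i j)) => t _; by rewrite mxE.
Qed.

Lemma acmN m n (F F' : R -> 'M[R]_(m, n)) : acm F F' ->
  acm (fun t => - F t) (fun t => - F' t).
Proof.
by move=> hF i j; apply: ac_ext (acN (hF i j)) => t _; rewrite mxE.
Qed.

Lemma acmB m n (F G F' G' : R -> 'M[R]_(m, n)) : acm F F' -> acm G G' ->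
  acm (fun t => F t - G t) (fun t => F' t - G' t).
Proof. by move=> hF hG; apply: acmD => //; exact: acmN. Qed.

Lemma acm_tr m n (F F' : R -> 'M[R]_(m, n)) : acm F F' ->
  acm (fun t => (F t)^T) (fun t => (F' t)^T).
Proof.
by move=> hF i j; apply: ac_ext (hF j i) => t _; rewrite mxE.
Qed.

Lemma acmM m n p (F F' : R -> 'M[R]_(m, n)) (G G' : R -> 'M[R]_(n, p)) :
  acm F F' -> acm G G' ->
  acm (fun t => F t *m G t) (fun t => F' t *m G t + F t *m G' t).
Proof.
move=> hF hG i j.
apply: ac_ext (ac_sum (index_enum 'I_n) (fun k => acM (hF i k) (hG k j))) => t _.
  by rewrite mxE.
by rewrite !mxE big_split.
Qed.

Lemma acmMl m n p (A : 'M[R]_(m, n)) (G G' : R -> 'M[R]_(n, p)) :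
  acm G G' -> acm (fun t => A *m G t) (fun t => A *m G' t).
Proof.
move=> hG; apply: acm_ext (acmM (acm_cst A) hG) => // t _.
by rewrite mul0mx add0r.
Qed.

Lemma acmMr m n p (A : 'M[R]_(n, p)) (G G' : R -> 'M[R]_(m, n)) :
  acm G G' -> acm (fun t => G t *m A) (fun t => G' t *m A).
Proof.
move=> hG; apply: acm_ext (acmM hG (acm_cst A)) => // t _.
by rewrite mulmx0 addr0.
Qed.

Lemma acmE m n (F F' : R -> 'M[R]_(m, n)) t : acm F F' -> 0 <= t <= T ->
  F t = F 0 + integral_mx 0 t F'.
Proof.
by move=> h tT; apply/matrixP => i j; rewrite !mxE; have [_ ->] := h i j.
Qed.

Lemma integral_mx0 m n (F : R -> 'M[R]_(m, n)) : integral_mx 0 0 F = 0.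
Proof. by apply/matrixP => i j; rewrite !mxE; exact: int0_0. Qed.

Lemma integral_mx_ext m n (F G : R -> 'M[R]_(m, n)) s t :
  (forall r, s <= r <= t -> F r = G r) -> integral_mx s t F = integral_mx s t G.
Proof.
move=> FG; apply/matrixP => i j; rewrite !mxE; apply: eq_Rintegral => r.
by rewrite inE /= in_itv /= => /FG ->.
Qed.

Lemma acm_integral m n (F : R -> 'M[R]_(m, n)) : bmm F ->
  acm (integral_mx 0 ^~ F) F.
Proof.
move=> bF i j; apply: ac_ext (ac_int0 (bF i j)) => // t _.
by rewrite mxE.
Qed.

Lemma acm_eq0 m n (F : R -> 'M[R]_(m, n)) : acm F (fun=> 0) ->
  forall t, 0 <= t <= T -> F t = F 0.
Proof.
move=> h t tT; apply/matrixP => i j; have [_ /(_ t tT) ->] := h i j.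
move/andP: tT => [t0 _].
rewrite (@int0_ext _ _ (fun=> 0)) ?int0_cst ?mul0r ?addr0 //.
by move=> s _; rewrite mxE.
Qed.

Lemma integral_mxMr m n p (F : R -> 'M[R]_(m, n)) (A : 'M[R]_(n, p)) t :
  bmm F -> 0 <= t <= T ->
  integral_mx 0 t (fun s => F s *m A) = integral_mx 0 t F *m A.
Proof.
move=> bF tT; have := acmE (acmMr A (acm_integral bF)) tT.
by rewrite integral_mx0 mul0mx add0r.
Qed.

Lemma integral_mxMl m n p (A : 'M[R]_(m, n)) (F : R -> 'M[R]_(n, p)) t :
  bmm F -> 0 <= t <= T ->
  integral_mx 0 t (fun s => A *m F s) = A *m integral_mx 0 t F.
Proof.
move=> bF tT; have := acmE (acmMl A (acm_integral bF)) tT.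
by rewrite integral_mx0 mulmx0 add0r.
Qed.

(** Right-hand sides such as A D + D B act on [D] from both sides and are not a matrix times a
    vector; a bound by the sum of the entries, uniform in time, is what Gronwall's lemma uses. *)
Definition lin_bdd m n p q (L : R -> 'M[R]_(m, n) -> 'M[R]_(p, q)) : Prop :=
  exists2 C, 0 <= C & forall t D i j, 0 <= t <= T ->
    `|L t D i j| <= C * \sum_(k : 'I_m * 'I_n) `|D k.1 k.2|.

Lemma lin_bddD m n p q (L1 L2 : R -> 'M[R]_(m, n) -> 'M[R]_(p, q)) :
  lin_bdd L1 -> lin_bdd L2 -> lin_bdd (fun t D => L1 t D + L2 t D).
Proof.
move=> [C C0 hC] [B B0 hB]; exists (C + B); first exact: addr_ge0.
move=> t D i j tT; rewrite mxE mulrDl; apply: le_trans (ler_normD _ _) _.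
by apply: lerD; [exact: hC | exact: hB].
Qed.

Lemma lin_bddN m n p q (L : R -> 'M[R]_(m, n) -> 'M[R]_(p, q)) :
  lin_bdd L -> lin_bdd (fun t D => - L t D).
Proof.
move=> [C C0 hC]; exists C => // t D i j tT; rewrite mxE normrN; exact: hC.
Qed.

Lemma lin_bddMl m n p q o (A : R -> 'M[R]_(o, p))
    (L : R -> 'M[R]_(m, n) -> 'M[R]_(p, q)) :
  bmm A -> lin_bdd L -> lin_bdd (fun t D => A t *m L t D).
Proof.
move=> bA [C C0 hC].
have /choice[B hB] : forall x : 'I_o * 'I_p, exists B : R, 0 < B /\
    forall t, 0 <= t <= T -> `|A t x.1 x.2| <= B.
  by move=> x; have [B ? ?] := bm_bound (bA x.1 x.2); exists B.
have B0 x : 0 <= B x by have [/ltW] := hB x.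
exists ((\sum_x B x) * C *+ #|'I_p|).
  by rewrite mulrn_wge0 // mulr_ge0 // sumr_ge0.
move=> t D i j tT; rewrite mxE; apply: le_trans (ler_norm_sum _ _ _) _.
rewrite mulrnAl -sumr_const; apply: ler_sum => k _.
rewrite normrM -mulrA; apply: ler_pM => //; last exact: hC.
have [_ /(_ _ tT) h] := hB (i, k); apply: le_trans h _.
by rewrite (bigD1 (i, k)) //= lerDl sumr_ge0.
Qed.

Lemma lin_bdd_tr m n p q (L : R -> 'M[R]_(m, n) -> 'M[R]_(p, q)) :
  lin_bdd L -> lin_bdd (fun t D => (L t D)^T).
Proof. by move=> [C C0 hC]; exists C => // t D i j tT; rewrite mxE; exact: hC. Qed.

Lemma lin_bddMr m n p q o (A : R -> 'M[R]_(q, o))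
    (L : R -> 'M[R]_(m, n) -> 'M[R]_(p, q)) :
  bmm A -> lin_bdd L -> lin_bdd (fun t D => L t D *m A t).
Proof.
move=> bA hL.
have [C C0 hC] := lin_bdd_tr (lin_bddMl (bmm_tr bA) (lin_bdd_tr hL)).
by exists C => // t D i j tT; have := hC t D i j tT; rewrite trmx_mul !trmxK.
Qed.

Lemma lin_bdd_id m n : lin_bdd (fun t (D : 'M[R]_(m, n)) => D).
Proof.
exists 1 => // t D i j _; rewrite mul1r (bigD1 (i, j)) //= lerDl.
by rewrite sumr_ge0.
Qed.

Lemma lin_bdd_lsub m n1 n2 : lin_bdd (fun t (D : 'M[R]_(m, n1 + n2)) => lsubmx D).
Proof.
exists 1 => // t D i j _; rewrite mul1r (bigD1 (i, lshift n2 j)) //= mxE lerDl.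
by rewrite sumr_ge0.
Qed.

Lemma lin_bdd_rsub m n1 n2 : lin_bdd (fun t (D : 'M[R]_(m, n1 + n2)) => rsubmx D).
Proof.
exists 1 => // t D i j _; rewrite mul1r (bigD1 (i, rshift n1 j)) //= mxE lerDl.
by rewrite sumr_ge0.
Qed.

Lemma lin_bdd_row m n p q1 q2 (L1 : R -> 'M[R]_(m, n) -> 'M[R]_(p, q1))
    (L2 : R -> 'M[R]_(m, n) -> 'M[R]_(p, q2)) :
  lin_bdd L1 -> lin_bdd L2 -> lin_bdd (fun t D => row_mx (L1 t D) (L2 t D)).
Proof.
move=> [C C0 hC] [B B0 hB]; exists (C + B); first exact: addr_ge0.
move=> t D i j tT; have S0 : 0 <= \sum_(k : 'I_m * 'I_n) `|D k.1 k.2|.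
  exact: sumr_ge0.
rewrite mulrDl mxE; case: fintype.split => k.
  by apply: le_trans (hC t D i k tT) _; rewrite lerDl mulr_ge0.
by apply: le_trans (hB t D i k tT) _; rewrite lerDr mulr_ge0.
Qed.

Lemma acm_row m n1 n2 (F F' : R -> 'M[R]_(m, n1)) (G G' : R -> 'M[R]_(m, n2)) :
  acm F F' -> acm G G' ->
  acm (fun t => row_mx (F t) (G t)) (fun t => row_mx (F' t) (G' t)).
Proof.
move=> hF hG i j.
case: (split_ordP j) => k ->.
  by apply: ac_ext (hF i k) => t _; rewrite row_mxEl.
by apply: ac_ext (hG i k) => t _; rewrite row_mxEr.
Qed.

Hypothesis T_gt0 : 0 < T.

Lemma linear_mx_uniq m n (D D' : R -> 'M[R]_(m, n)) L :
  acm D D' -> D 0 = 0 -> lin_bdd L ->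
  (forall t, 0 <= t <= T -> D' t = L t (D t)) ->
  forall t, 0 <= t <= T -> D t = 0.
Proof.
move=> acD D0 [C C0 hC] hD t tT; apply/matrixP => i j; rewrite mxE.
apply: (@linear_ode_uniq R T T_gt0 ('I_m * 'I_n)%type
  (fun k t => D t k.1 k.2) (fun k t => D' t k.1 k.2) C _ _ _ (i, j) t tT).
- by move=> k; exact: acD.
- by move=> k; rewrite D0 mxE.
- by move=> k s sT; rewrite hD //; exact: hC.
Qed.

Lemma linear_mx_exists m n (A : R -> 'M[R]_m) (X0 : 'M[R]_(m, n)) : bmm A ->
  exists2 X : R -> 'M[R]_(m, n), X 0 = X0 & acm X (fun t => A t *m X t).
Proof.
move=> bA.
have /choice[F hF] : forall j : 'I_n, exists F : 'I_m -> R -> R,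
    (forall i, F i 0 = X0 i j) /\
    forall i, ac T (F i) (fun t => \sum_k A t i k * F k t).
  move=> j; exact: (linear_ode_exists T_gt0 (A := fun i k t => A t i k)).
exists (fun t => \matrix_(i, j) F j i t).
  by apply/matrixP => i j; rewrite mxE; have [->] := hF j.
move=> i j; have [_ h] := hF j; apply: ac_ext (h i) => t _; first by rewrite mxE.
by rewrite [RHS]mxE; apply: eq_bigr => k _; rewrite mxE.
Qed.

(** The inverse is built as the transposed solution of the adjoint equation: Psi Phi then has zero
    derivative and starts at 1. *)
Lemma fundamental_matrix m (A : R -> 'M[R]_m) : bmm A ->
  exists Phi Psi : R -> 'M[R]_m,
   [/\ Phi 0 = 1%:M, Psi 0 = 1%:M, acm Phi (fun t => A t *m Phi t),
       acm Psi (fun t => - (Psi t *m A t)) &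
       forall t, 0 <= t <= T -> Phi t *m Psi t = 1%:M /\ Psi t *m Phi t = 1%:M].
Proof.
move=> bA; have [Phi Phi0 hPhi] := linear_mx_exists 1%:M bA.
have [Y Y0 hY] := linear_mx_exists 1%:M (bmmN (bmm_tr bA)).
have hPsi : acm (fun t => (Y t)^T) (fun t => - ((Y t)^T *m A t)).
  apply: acm_ext (acm_tr hY) => // t _.
  by rewrite trmx_mul linearN /= trmxK mulmxN.
exists Phi, (fun t => (Y t)^T); split => //; first by rewrite Y0 trmx1.
move=> t tT; suff h : (Y t)^T *m Phi t = 1%:M by split => //; exact: mulmx1C.
have := acm_eq0 (F := fun t => (Y t)^T *m Phi t) _ tT.
rewrite Y0 Phi0 trmx1 mulmx1; apply.
apply: acm_ext (acmM hPsi hPhi) => // s _.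
by rewrite mulNmx mulmxA addNr.
Qed.

Lemma continuous_mx_bmm m n (F : R -> 'M[R]_(m, n)) : continuous_mx T F -> bmm F.
Proof. by move=> cF i j; exact: bm_cont. Qed.

Lemma acm_continuous m n (F F' : R -> 'M[R]_(m, n)) : acm F F' -> continuous_mx T F.
Proof. by move=> h i j; exact: ac_cont (h i j). Qed.

Lemma continuous_mx_cst m n (A : 'M[R]_(m, n)) : continuous_mx T (fun=> A).
Proof. by move=> i j; apply: continuous_subspaceT => x; exact: cvg_cst. Qed.

Lemma continuous_mxD m n (F G : R -> 'M[R]_(m, n)) :
  continuous_mx T F -> continuous_mx T G -> continuous_mx T (fun t => F t + G t).
Proof.
move=> cF cG i j; rewrite (_ : (fun t => _) = (fun t => F t i j + G t i j)); last first.
  by apply/funext => t; rewrite mxE.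
by move=> x; apply: cvgD; [exact: cF | exact: cG].
Qed.

Lemma continuous_mxN m n (F : R -> 'M[R]_(m, n)) :
  continuous_mx T F -> continuous_mx T (fun t => - F t).
Proof.
move=> cF i j; rewrite (_ : (fun t => _) = (fun t => - F t i j)); last first.
  by apply/funext => t; rewrite mxE.
by move=> x; apply: cvgN; exact: cF.
Qed.

Lemma continuous_mx_tr m n (F : R -> 'M[R]_(m, n)) :
  continuous_mx T F -> continuous_mx T (fun t => (F t)^T).
Proof.
move=> cF i j; rewrite (_ : (fun t => _) = (fun t => F t j i)); first exact: cF.
by apply/funext => t; rewrite mxE.
Qed.

Lemma continuous_mxM m n p (F : R -> 'M[R]_(m, n)) (G : R -> 'M[R]_(n, p)) :
  continuous_mx T F -> continuous_mx T G -> continuous_mx T (fun t => F t *m G t).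
Proof.
move=> cF cG i j.
rewrite (_ : (fun t => _) = (fun t => \sum_k F t i k * G t k j)); last first.
  by apply/funext => t; rewrite mxE.
elim: (index_enum _) => [|k s IH].
  rewrite (_ : (fun t => _) = (fun=> 0)); last first.
    by apply/funext => t; rewrite big_nil.
  by apply: continuous_subspaceT => x; exact: cvg_cst.
rewrite (_ : (fun t => _) = (fun t => F t i k * G t k j +
  \sum_(k <- s) F t i k * G t k j)); last first.
  by apply/funext => t; rewrite big_cons.
move=> x; apply: cvgD; last exact: IH.
by apply: cvgM; [exact: cF | exact: cG].
Qed.

Lemma solves_ode_acm m n (rhs : 'M[R]_(m, n) -> 'M[R]_(m, n)) (F : R -> 'M[R]_(m, n)) :
  continuous_mx T (fun t => rhs (F t)) -> solves_ode T rhs F ->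
  acm F (fun t => rhs (F t)).
Proof.
move=> cr [cF dF] i j; apply: ac_of_derive => //.
by move=> t tT; exact: dF.
Qed.

End MatrixCalculus.

(** * Square-integrable random variables *)

Section SecondMoments.
Variables (R : realType).
Context (disp : measure_display) (Om : measurableType disp).
Variable Pr : probability Om R.
Implicit Types X Y Z : Om -> R.

Definition EE X : R := fine (\int[Pr]_w (X w)%:E).

Definition L1 X : Prop := Pr.-integrable setT (EFin \o X).

Definition L2 X : Prop := measurable_fun setT X /\ L1 (fun w => X w ^+ 2).

Lemma L1D X Y : L1 X -> L1 Y -> L1 (fun w => X w + Y w).
Proof. by move=> hX hY; exact: (integrableD measurableT hX hY). Qed.

Lemma L1Z c X : L1 X -> L1 (fun w => c * X w).
Proof. by move=> hX; exact: (integrableZl measurableT _ hX). Qed.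

Lemma L1_le X Y : measurable_fun setT X -> (forall w, `|X w| <= Y w) -> L1 Y -> L1 X.
Proof.
move=> mX XY hY; apply: (le_integrable _ _ _ hY) => //; first exact/measurable_EFinP.
by move=> w _ /=; rewrite lee_fin (le_trans (XY w)) // ler_norm.
Qed.

Lemma EED X Y : L1 X -> L1 Y -> EE (fun w => X w + Y w) = EE X + EE Y.
Proof. by move=> hX hY; rewrite /EE -[RHS]RintegralD. Qed.

Lemma EEZ c X : L1 X -> EE (fun w => c * X w) = c * EE X.
Proof. by move=> hX; rewrite /EE -[RHS]RintegralZl. Qed.

Lemma L1_cst c : L1 (fun=> c).
Proof. exact: finite_measure_integrable_cst. Qed.

Lemma EE_cst c : EE (fun=> c) = c.
Proof. by rewrite /EE integral_cst //= probability_setT mule1. Qed.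

Lemma EE_ge0 X : (forall w, 0 <= X w) -> 0 <= EE X.
Proof. by move=> X0; rewrite /EE fine_ge0 // integral_ge0 // => w _; rewrite lee_fin. Qed.

Lemma L2_cst c : L2 (fun=> c).
Proof. by split; [exact: measurable_cst | exact: L1_cst]. Qed.

Lemma L2D X Y : L2 X -> L2 Y -> L2 (fun w => X w + Y w).
Proof.
move=> [mX hX] [mY hY]; split; first exact: measurable_funD.
apply: (@L1_le _ (fun w => 2 * X w ^+ 2 + 2 * Y w ^+ 2)).
- by apply: measurable_funX; exact: measurable_funD.
- move=> w; rewrite ger0_norm ?sqr_ge0 //.
  have := sqr_ge0 (X w - Y w); rewrite !expr2; lra.
- by apply: L1D; exact: L1Z.
Qed.

Lemma L2Z c X : L2 X -> L2 (fun w => c * X w).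
Proof.
move=> [mX hX]; split; first exact: measurable_funM.
by under eq_fun do rewrite exprMn; exact: L1Z.
Qed.

Lemma L2_sum (J : Type) (r : seq J) (F : J -> Om -> R) :
  (forall i, L2 (F i)) -> L2 (fun w => \sum_(i <- r) F i w).
Proof.
move=> hF; elim: r => [|i r IH].
  by under eq_fun do rewrite big_nil; exact: L2_cst.
by under eq_fun do rewrite big_cons; exact: L2D.
Qed.

Lemma L2M_L1 X Y : L2 X -> L2 Y -> L1 (fun w => X w * Y w).
Proof.
move=> [mX hX] [mY hY].
apply: (@L1_le _ (fun w => X w ^+ 2 + Y w ^+ 2)).
- exact: measurable_funM.
- move=> w; have := sqr_ge0 (X w - Y w); have := sqr_ge0 (X w + Y w).
  have := sqr_ge0 (X w); have := sqr_ge0 (Y w).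
  by rewrite ler_norml !expr2 => ? ? ? ?; apply/andP; split; lra.
- exact: L1D.
Qed.

Lemma L2_L1 X : L2 X -> L1 X.
Proof.
move=> hX; have := L2M_L1 hX (L2_cst 1).
by under eq_fun do rewrite mulr1.
Qed.

Lemma EE_ae X Y : measurable_fun setT X -> measurable_fun setT Y ->
  {ae Pr, forall w, X w = Y w} -> EE X = EE Y.
Proof.
move=> mX mY XY; rewrite /EE; congr fine; apply: ae_eq_integral => //.
- exact/measurable_EFinP.
- exact/measurable_EFinP.
- by apply: filterS XY => w -> .
Qed.

Lemma L2_ae X Y : measurable_fun setT Y ->
  {ae Pr, forall w, X w = Y w} -> L2 X -> L2 Y.
Proof.
move=> mY XY [mX hX]; split => //.
have mY2 : measurable_fun setT (fun w => Y w ^+ 2) by exact: measurable_funX.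
apply/integrableP; split; first exact/measurable_EFinP.
have /integrableP[m2 h2] := hX; apply: le_lt_trans h2.
rewrite le_eqVlt; apply/orP; left; apply/eqP/ae_eq_integral => //.
- by apply: measurableT_comp => //; exact/measurable_EFinP.
- exact: measurableT_comp.
- by apply: filterS XY => w /= -> .
Qed.

Definition uncorr X Y := EE (fun w => X w * Y w) = 0.

Lemma EE_sumM (J : Type) (r : seq J) (F : J -> Om -> R) X :
  (forall i, L2 (F i)) -> L2 X ->
  EE (fun w => (\sum_(i <- r) F i w) * X w) = \sum_(i <- r) EE (fun w => F i w * X w).
Proof.
move=> hF hX; elim: r => [|i r IH].
  by rewrite big_nil; under eq_fun do rewrite big_nil mul0r; exact: EE_cst.
rewrite big_cons -IH -EED; last 2 first.
  exact: L2M_L1.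
  by apply: L2M_L1 => //; exact: L2_sum.
by under eq_fun do rewrite big_cons mulrDl.
Qed.

Lemma EE_sum (J : Type) (r : seq J) (F : J -> Om -> R) :
  (forall i, L2 (F i)) ->
  EE (fun w => \sum_(i <- r) F i w) = \sum_(i <- r) EE (F i).
Proof.
move=> hF; have := EE_sumM r hF (L2_cst 1).
under eq_fun do rewrite mulr1.
by move=> ->; apply: eq_bigr => i _; under eq_fun do rewrite mulr1.
Qed.

Lemma EE_sq_orthogonal (J : finType) (F : J -> Om -> R) :
  (forall i, L2 (F i)) -> (forall i j, i != j -> uncorr (F i) (F j)) ->
  EE (fun w => (\sum_i F i w) ^+ 2) = \sum_i EE (fun w => F i w ^+ 2).
Proof.
move=> hF hu; rewrite (_ : (fun w => _) =
    (fun w => (\sum_i F i w) * (\sum_i F i w))); last by apply/funext.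
rewrite EE_sumM //; last exact: L2_sum.
apply: eq_bigr => i _.
rewrite (_ : (fun w => _) = (fun w => (\sum_j F j w) * F i w)); last first.
  by apply/funext => w; rewrite mulrC.
rewrite EE_sumM // (bigD1 i) //= big1 ?addr0 // => j ji.
exact: hu.
Qed.

(** Convergence holds only almost everywhere, so Y^2 is first exchanged for the lower limit of the X
    n ^2, to which Fatou's lemma applies. *)
Lemma EE_fatou (X : nat -> Om -> R) Y (c : R) :
  (forall n, measurable_fun setT (X n)) -> measurable_fun setT Y ->
  {ae Pr, forall w, X n w @[n --> \oo] --> Y w} ->
  (forall n, L1 (fun w => X n w ^+ 2)) ->
  (forall n, EE (fun w => X n w ^+ 2) <= c) ->
  L1 (fun w => Y w ^+ 2) /\ EE (fun w => Y w ^+ 2) <= c.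
Proof.
move=> mX mY XY LX hX.
have mX2 n : measurable_fun setT (fun w => (X n w ^+ 2)%:E).
  by apply/measurable_EFinP; exact: measurable_funX.
have mY2 : measurable_fun setT (fun w => (Y w ^+ 2)%:E).
  by apply/measurable_EFinP; exact: measurable_funX.
have h : (\int[Pr]_w (Y w ^+ 2)%:E <= c%:E)%E.
  have -> : (\int[Pr]_w (Y w ^+ 2)%:E =
      \int[Pr]_w limn_einf (fun n => (X n w ^+ 2)%:E))%E.
    apply: ae_eq_integral => //.
      rewrite (_ : (fun w => _) =
        (fun w => - limn_esup (fun n => - (X n w ^+ 2)%:E))%E); last first.
        apply/funext => w; rewrite -[RHS]limn_einfN; congr limn_einf.
        by apply/funext => n /=; rewrite opprK.
      apply: measurableT_comp => //; apply: measurable_fun_limn_esup => n.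
      exact: measurableT_comp.
    apply: filterS XY => w hw _; apply/esym.
    have hw2 : (X n w ^+ 2)%:E @[n --> \oo] --> (Y w ^+ 2)%:E.
      by apply: cvg_EFin; [exact: nearW | exact: (cvgM hw hw)].
    by have [-> _] := cvg_limn_einf_sup hw2.
  apply: le_trans (fatou _ _ mX2 _) _ => //.
    by move=> n w _; rewrite lee_fin sqr_ge0.
  rewrite limn_einf_lim; apply: lime_le; first exact: is_cvg_einfs.
  apply: nearW => n; apply: le_trans (ereal_inf_lbound _) _.
    by exists n => /=.
  rewrite -(fineK (integrable_fin_num measurableT (LX n))) lee_fin.
  exact: hX.
have LY : L1 (fun w => Y w ^+ 2).
  apply/integrableP; split => //.
  under eq_integral do rewrite gee0_abs ?lee_fin ?sqr_ge0 //.
  by apply: le_lt_trans h _; rewrite ltry.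
split=> //; rewrite -lee_fin /EE fineK //.
exact: (integrable_fin_num measurableT LY).
Qed.

End SecondMoments.

Section L2Limit.
Variables (R : realType).
Context (disp : measure_display) (Om : measurableType disp).
Variable Pr : probability Om R.
Implicit Types X Y Z : Om -> R.
Local Notation EE := (EE Pr).
Local Notation L2 := (L2 Pr).

Lemma sqr_EE_le Z : L2 Z -> EE Z ^+ 2 <= EE (fun w => Z w ^+ 2).
Proof.
move=> hZ; pose c := EE Z; have lZ := L2_L1 hZ.
have := EE_ge0 Pr (fun w => sqr_ge0 (Z w - c)).
rewrite (_ : (fun w => _) = (fun w => Z w ^+ 2 + ((- 2 * c) * Z w + c ^+ 2))).
  rewrite EED; [|exact: hZ.2|]; last first.
    by apply: L1D; [exact: L1Z | exact: L1_cst].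
  rewrite EED; [|exact: L1Z|exact: L1_cst].
  by rewrite EEZ // EE_cst -/c !expr2; lra.
by apply/funext => w; ring.
Qed.

(** Young's inequality for the cross term: eta (X + s Z / eta)^2 has nonnegative expectation for s =
    1 and s = -1. *)
Lemma EE_sq_perturb X Z (eta : R) : L2 X -> L2 Z -> 0 < eta ->
  `|EE (fun w => (X w + Z w) ^+ 2) - EE (fun w => X w ^+ 2)|
    <= EE (fun w => Z w ^+ 2) + (eta * EE (fun w => X w ^+ 2)
       + EE (fun w => Z w ^+ 2) / eta).
Proof.
move=> hX hZ eta0.
have hXZ := L2M_L1 hX hZ.
have -> : EE (fun w => (X w + Z w) ^+ 2) =
    EE (fun w => X w ^+ 2) + (2 * EE (fun w => X w * Z w) + EE (fun w => Z w ^+ 2)).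
  rewrite -EEZ // -EED; [|exact: L1Z|exact: hZ.2].
  rewrite -EED; [|exact: hX.2|by apply: L1D; [exact: L1Z|exact: hZ.2]].
  by congr EE; apply/funext => w; ring.
rewrite addrAC subrr add0r.
have sq s : 0 <= eta * EE (fun w => X w ^+ 2) + s * 2 * EE (fun w => X w * Z w)
     + s ^+ 2 * (EE (fun w => Z w ^+ 2) / eta).
  have := EE_ge0 Pr (fun w => mulr_ge0 (ltW eta0) (sqr_ge0 (X w + s / eta * Z w))).
  rewrite (_ : (fun w => _) = (fun w => eta * X w ^+ 2 +
     (s * 2 * (X w * Z w) + s ^+ 2 / eta * Z w ^+ 2))); last first.
    by apply/funext => w; field; rewrite gt_eqF.
  rewrite EED; [|exact: L1Z hX.2|by apply: L1D; apply: L1Z; [|exact: hZ.2]].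
  rewrite EED; [|exact: L1Z|exact: L1Z hZ.2].
  rewrite !EEZ //; [|exact: hZ.2|exact: hX.2].
  by congr (_ <= _); ring.
have Z0 := EE_ge0 Pr (fun w => sqr_ge0 (Z w)).
have := sq 1; have := sq (-1); rewrite expr1n sqrrN expr1n ler_norml => h1 h2.
by apply/andP; split; lra.
Qed.

(** Almost sure convergence alone does not pass to second moments. At fixed n, Fatou's lemma applied
    to X (m + n) - X n turns the Cauchy bound into an L2 bound on Y - X n, and the moments of Y
    follow by perturbation. *)
Lemma EE_L2_limit (X : nat -> Om -> R) Y (eps : nat -> R) (s : R) :
  (forall n, L2 (X n)) -> (forall n, EE (X n) = 0) -> measurable_fun setT Y ->
  {ae Pr, forall w, X n w @[n --> \oo] --> Y w} ->
  (forall n m, EE (fun w => (X (m + n)%N w - X n w) ^+ 2) <= eps n) ->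
  eps n @[n --> \oo] --> (0 : R) ->
  EE (fun w => X n w ^+ 2) @[n --> \oo] --> s ->
  [/\ L2 Y, EE Y = 0 & EE (fun w => Y w ^+ 2) = s].
Proof.
move=> hX X0 mY XY hC eps0 hs.
have key n : L2 (fun w => Y w - X n w) /\ EE (fun w => (Y w - X n w) ^+ 2) <= eps n.
  have mD : measurable_fun setT (fun w => Y w - X n w).
    by apply: measurable_funB => //; case: (hX n).
  have hD m : L2 (fun w => X (m + n)%N w - X n w).
    have := L2D (hX (m + n)%N) (L2Z (-1) (hX n)).
    by under eq_fun do rewrite mulN1r.
  have [|||h1 h2] := @EE_fatou _ _ _ Pr (fun m w => X (m + n)%N w - X n w)
    (fun w => Y w - X n w) (eps n) _ mD _ _ (hC n).
  - by move=> m; case: (hD m).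
  - apply: filterS XY => w hw; apply: cvgB; last exact: cvg_cst.
    by move: hw; rewrite -(cvg_shiftn n).
  - by move=> m; case: (hD m).
  by [].
have YE n : Y = (fun w => X n w + (Y w - X n w)).
  by apply/funext => w; rewrite addrC subrK.
have LY : L2 Y by rewrite (YE 0%N); apply: L2D => //; exact: (key 0%N).1.
have small (x : R) : (forall e, 0 < e -> `|x| <= e) -> x = 0.
  move=> h; apply/eqP; rewrite -normr_le0 leNgt; apply/negP => x0.
  by have := h (`|x| / 2) (divr_gt0 x0 (ltr0Sn _ 1)); lra.
split => //.
- apply: small => e e0.
  have : \forall n \near \oo, `|0 - eps n| <= e ^+ 2.
    by move/cvgrPdist_le : eps0; apply; exact: exprn_gt0.
  move=> [n _ /(_ n (leqnn _))]; rewrite sub0r normrN => h.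
  have [LD hD] := key n.
  have : EE Y = EE (fun w => Y w - X n w).
    by rewrite {1}(YE n) EED ?X0 ?add0r //; exact: L2_L1.
  move=> ->; have := sqr_EE_le LD => h2.
  rewrite -(@ler_pXn2r _ 2%N) ?nnegrE ?(ltW e0) // real_normK ?num_real //.
  apply: le_trans h2 (le_trans hD (le_trans (ler_norm _) h)).
- apply/eqP; rewrite -subr_eq0; apply/eqP; apply: small => e e0.
  pose S := `|s| + 1.
  have S0 : 0 < S by rewrite ltr_pwDr.
  (* The error is split into four quarters of e: D, eta B, D / eta and the distance from B to s. S
     bounds B because B is within 1 of s. *)
  pose eta := e / 4 / S.
  have eta0 : 0 < eta by rewrite !divr_gt0.
  pose d := Num.min (e / 4) (e / 4 * eta).
  have d0 : 0 < d by rewrite lt_min !divr_gt0 // mulr_gt0 // divr_gt0.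
  have e4 : 0 < Num.min (e / 4) 1 by rewrite lt_min ltr01 divr_gt0.
  near \oo => n.
  have h1 : `|0 - eps n| <= d.
    by near: n; move/cvgrPdist_le : eps0; exact.
  have h2 : `|s - EE (fun w => X n w ^+ 2)| <= Num.min (e / 4) 1.
    by near: n; move/cvgrPdist_le : hs; exact.
  have [LD hD] := key n.
  have := EE_sq_perturb (hX n) LD eta0.
  rewrite -(_ : (fun w => Y w ^+ 2) = (fun w => (X n w + (Y w - X n w)) ^+ 2));
    last by apply/funext => w; rewrite addrC subrK.
  set A := EE (fun w => Y w ^+ 2); set B := EE (fun w => X n w ^+ 2) in h2 *.
  set D := EE (fun w => (Y w - X n w) ^+ 2) in hD *.
  have D0 : 0 <= D by apply: EE_ge0 => w; exact: sqr_ge0.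
  have De : D <= d.
    by apply: le_trans hD _; move: h1; rewrite sub0r normrN; exact: le_trans (ler_norm _).
  have D4 : D <= e / 4 by apply: le_trans De _; rewrite ge_min lexx.
  have Deta : D / eta <= e / 4.
    by rewrite ler_pdivrMr //; apply: le_trans De _; rewrite ge_min lexx orbT.
  have BS : B <= S.
    have : `|s - B| <= 1 by apply: le_trans h2 _; rewrite ge_min lexx orbT.
    by rewrite ler_norml /S => /andP[]; have := ler_norm s; lra.
  have etaB : eta * B <= e / 4.
    apply: (@le_trans _ _ (eta * S)); first by rewrite ler_pM2l.
    by rewrite /eta divfK // gt_eqF.
  have h3 : `|s - B| <= e / 4 by apply: le_trans h2 _; rewrite ge_min lexx.
  move: h3; rewrite !ler_norml => /andP[h3 h4] /andP[h5 h6].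
  by apply/andP; split; lra.
Unshelve. all: by end_near. Qed.

End L2Limit.

Section Independence.
Variables (R : realType).
Context (disp : measure_display) (Om : measurableType disp).
Variable Pr : probability Om R.

(** The law of the pair agrees with the product of the marginal laws on rectangles, hence
    everywhere, and Fubini's theorem factors the integral. *)
Lemma EE_indep (X Y : Om -> R) : L2 Pr X -> L2 Pr Y ->
  (forall A B : set R, measurable A -> measurable B ->
    Pr (X @^-1` A `&` Y @^-1` B) = (Pr (X @^-1` A) * Pr (Y @^-1` B))%E) ->
  EE Pr (fun w => X w * Y w) = EE Pr X * EE Pr Y.
Proof.
move=> hX hY hind; have [mX _] := hX; have [mY _] := hY.
pose X' : {mfun Om >-> R} := HB.pack X (isMeasurableFun.Build _ _ _ _ X mX).
pose Y' : {mfun Om >-> R} := HB.pack Y (isMeasurableFun.Build _ _ _ _ Y mY).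
pose XY w := (X w, Y w).
have mXY : measurable_fun setT XY by exact: measurable_fun_pair.
pose XY' : {mfun Om >-> (R * R)%type} := HB.pack XY (isMeasurableFun.Build _ _ _ _ XY mXY).
pose dX := distribution Pr X'; pose dY := distribution Pr Y'.
pose dXY := distribution Pr XY'.
have eqm (A : set (R * R)) : measurable A -> (dX \x dY)%E A = dXY A.
  apply: product_measure_unique => B C mB mC /=.
  rewrite /dXY /dX /dY /distribution /pushforward /= -hind //.
have mf : measurable_fun setT (fun z : R * R => (z.1 * z.2)%:E).
  by apply/measurable_EFinP; apply: measurable_funM.
have I1 : (\int[Pr]_w (X w * Y w)%:E = \int[dXY]_z (z.1 * z.2)%:E)%E.
  rewrite /dXY integral_distribution //; exact: (L2M_L1 hX hY).
have I2 : (\int[dXY]_z (z.1 * z.2)%:E = \int[dX \x dY]_z (z.1 * z.2)%:E)%E.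
  by apply: eq_measure_integral => A mA _; first [exact: eqm | exact/esym/eqm].
have intp : (dX \x dY)%E.-integrable setT (fun z => (z.1 * z.2)%:E).
  apply/integrableP; split => //.
  rewrite -(@eq_measure_integral _ _ _ _ (dX \x dY)%E dXY); last first.
    by move=> A mA _; first [exact: eqm | exact/esym/eqm].
  rewrite /dXY ge0_integral_distribution //; last exact: measurableT_comp.
  by have /integrableP[] := L2M_L1 hX hY.
have [iX iY] := (L2_L1 hX, L2_L1 hY).
rewrite /EE I1 I2 -integral12_prod_meas1 //=.
have eX : (\int[dX]_x x%:E = \int[Pr]_w (X w)%:E)%E.
  by rewrite /dX integral_distribution.
have eY : (\int[dY]_x x%:E = \int[Pr]_w (Y w)%:E)%E.
  by rewrite /dY integral_distribution.
have iY' : dY.-integrable setT (EFin \o id).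
  apply/integrableP; split; first exact/measurable_EFinP.
  rewrite /dY ge0_integral_distribution //.
    by have /integrableP[] := iY.
  by apply: measurableT_comp => //; exact/measurable_EFinP.
have iX' : dX.-integrable setT (EFin \o id).
  apply/integrableP; split; first exact/measurable_EFinP.
  rewrite /dX ge0_integral_distribution //.
    by have /integrableP[] := iX.
  by apply: measurableT_comp => //; exact/measurable_EFinP.
have fX : (\int[Pr]_w (X w)%:E)%E \is a fin_num := integrable_fin_num measurableT iX.
have fY : (\int[Pr]_w (Y w)%:E)%E \is a fin_num := integrable_fin_num measurableT iY.
rewrite -fineM // -eX -eY; congr fine.
under eq_integral => x _.
  rewrite /fubini_F; under eq_integral do rewrite EFinM /=.
  rewrite (integralZl measurableT iY') /= eY -(fineK fY).
  over.
rewrite (integralZr measurableT iX') /=; congr (_ * _)%E.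
by rewrite fineK // eY.
Qed.

End Independence.

(** * Second moments of the driving noise *)

Section StandardNormal.
Variable R : realType.
Local Notation mu := (@lebesgue_measure R).
Local Notation NP := (normal_prob (0 : R) (1 : R)).

Lemma integral_normal_prob (f : R -> \bar R) : NP.-integrable setT f ->
  (\int[NP]_x f x = \int[mu]_x (f x * (normal_pdf 0 1 x)%:E))%E.
Proof.
move=> intf; have mf := measurable_int _ intf.
have dom := normal_prob_dominates (0 : R) 1.
rewrite -(Radon_Nikodym_change_of_variables dom) //=.
apply: ae_eq_integral => //.
- by apply: emeasurable_funM => //; apply: (measurable_int mu); exact: Radon_Nikodym_integrable.
- apply: emeasurable_funM => //=; apply/measurableT_comp => //=.
  exact: measurable_normal_pdf.
- apply: ae_eqe_mul2l => /=.
  rewrite Radon_NikodymE //=.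
  case: cid => /= h [h1 h2 h3].
  apply: integral_ae_eq => //=.
  + by apply/measurableT_comp => //; exact: measurable_normal_pdf.
  + by move=> E _ mE; rewrite -h3.
Qed.

(** Since u <= exp u at u = x^2 / 4, one has x^2 exp(- x^2 / 2) <= 4 exp(- x^2 / 4), and the right
    side is proportional to the density of variance 2. *)
Lemma sqr_normal_pdf_le : exists2 c : R, 0 <= c &
  forall x, x ^+ 2 * normal_pdf 0 1 x <= c * normal_pdf 0 (Num.sqrt 2) x.
Proof.
have s2 : Num.sqrt 2 != 0 :> R by rewrite gt_eqF // sqrtr_gt0.
have p2gt := normal_peak_gt0 s2.
exists (4 * normal_peak 1 / normal_peak (Num.sqrt (2 : R))).
  by rewrite divr_ge0 ?mulr_ge0 ?normal_peak_ge0.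
move=> x; rewrite !normal_pdfE ?oner_eq0 // /normal_fun subr0.
rewrite sqr_sqrtr // expr1n.
set p1 := normal_peak 1; set p2 := normal_peak _; set a := x ^+ 2.
have p2n : p2 != 0 by rewrite gt_eqF.
have a0 : 0 <= a := sqr_ge0 x.
have -> : - a / (1 *+ 2) = - (a / 4) + - (a / 4) by field.
have -> : - a / (2 *+ 2) = - (a / 4) by field.
rewrite expRD; set E := expR _.
rewrite (_ : a * _ = p1 * (a * E * E)); last by ring.
rewrite (_ : 4 * p1 / p2 * _ = p1 * (4 * E)); last by field.
apply: ler_wpM2l; first exact: normal_peak_ge0.
apply: ler_wpM2r; first exact: expR_ge0.
have h : a / 4 <= expR (a / 4).
  by apply: le_trans (expR_ge1Dx _); lra.
by rewrite /E expRN ler_pdivrMr ?expR_gt0 //; lra.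
Qed.

(** [integral_normal_prob] presupposes integrability, so it is applied to the truncations min(|x|,
    n), whose squares have expectation at most [c]; Fatou's lemma then removes the truncation. *)
Lemma normal_sqr_L1 : L1 NP (fun x => x ^+ 2).
Proof.
have [c c0 hc] := sqr_normal_pdf_le.
pose X (n : nat) (x : R) := Num.min `|x| n%:R.
have mX n : measurable_fun setT (X n).
  by apply: measurable_minr => //; exact: measurableT_comp.
have LX n : L1 NP (fun x => X n x ^+ 2).
  apply: (@L1_le _ _ _ _ _ (fun=> n%:R ^+ 2)); last exact: L1_cst.
    exact: (measurable_funX 2 (mX n)).
  move=> x; rewrite ger0_norm ?sqr_ge0 // lerXn2r ?nnegrE // /X.
    by rewrite le_min ler0n normr_ge0.
  by rewrite ge_min lexx orbT.
have [|||h _] := @EE_fatou _ _ _ NP X (fun x => `|x|) c mX _ _ LX _.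
- exact: measurableT_comp.
- apply: nearW => x; apply/cvgrPdist_le => e e0.
  near=> n; rewrite /X min_l ?subrr ?normr0 ?(ltW e0) //.
  by near: n; exact: nbhs_infty_ger.
- move=> n; rewrite /EE integral_normal_prob; last exact: LX.
  have iP : mu.-integrable setT (fun x => (c * normal_pdf 0 (Num.sqrt 2) x)%:E).
    exact: (integrableZl measurableT c (integrable_normal_pdf 0 (Num.sqrt 2))).
  have -> : c = fine (\int[mu]_x (c * normal_pdf 0 (Num.sqrt 2) x)%:E).
    under eq_integral do rewrite EFinM.
    rewrite integralZl //; last exact: integrable_normal_pdf.
    by rewrite integral_normal_pdf mule1.
  have le_n x : X n x ^+ 2 * normal_pdf 0 1 x <= c * normal_pdf 0 (Num.sqrt 2) x.
    apply: le_trans (hc x); apply: ler_wpM2r; first exact: normal_pdf_ge0.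
    rewrite -[x ^+ 2]real_normK ?num_real // lerXn2r ?nnegrE //.
      by rewrite /X le_min ler0n normr_ge0.
    by rewrite /X ge_min lexx.
  have mXp : measurable_fun setT (fun x => (X n x ^+ 2)%:E * (normal_pdf 0 1 x)%:E)%E.
    apply/measurable_EFinP; apply: measurable_funM; last exact: measurable_normal_pdf.
    exact: (measurable_funX 2 (mX n)).
  have iX : mu.-integrable setT (fun x => (X n x ^+ 2)%:E * (normal_pdf 0 1 x)%:E)%E.
    apply: (le_integrable _ _ _ iP) => // x _ /=.
    rewrite lee_fin !ger0_norm //.
    - by rewrite mulr_ge0 ?normal_pdf_ge0.
    - by rewrite mulr_ge0 ?normal_pdf_ge0 ?sqr_ge0.
  rewrite fine_le //; [exact: integrable_fin_num|exact: integrable_fin_num|].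
  by apply: le_integral => // x _; rewrite -EFinM lee_fin.
by move: h; under eq_fun do rewrite real_normK ?num_real //.
Unshelve. all: by end_near. Qed.

(* Equal to 1, but only its positivity is used: every covariance below carries
   this factor, which saves computing the Gaussian integral. *)
Definition normal_var : R := EE NP (fun x => x ^+ 2).

(** Otherwise x = 0 almost surely, although a single point has no mass under a law with a
    density. *)
Lemma normal_var_gt0 : 0 < normal_var.
Proof.
rewrite lt_neqAle EE_ge0 ?andbT //; last by move=> x; exact: sqr_ge0.
apply/negP => /eqP h0.
have L := normal_sqr_L1.
have mf : measurable_fun setT (fun x : R => (x ^+ 2)%:E).
  exact: (measurable_int _ L).
have : (\int[NP]_x `|(x ^+ 2)%:E| = 0)%E.
  under eq_integral do rewrite gee0_abs ?lee_fin ?sqr_ge0 //.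
  rewrite -(fineK (integrable_fin_num measurableT L)).
  by congr EFin; exact: esym h0.
move/(ae_eq_integral_abs NP measurableT mf) => [N [mN N0 hN]].
have : (NP (N `|` [set 0%R]) = 1)%E.
  rewrite (_ : N `|` _ = setT) ?probability_setT //.
  apply/seteqP; split => // x _; have [->|x0] := eqVneq x 0; first by right.
  left; apply: hN => /= /(_ I) /eqP; rewrite /cst eqe expf_eq0 /=.
  by rewrite (negbTE x0).
have z : NP [set 0%R] = 0%E.
  by rewrite /normal_prob integral_set1.
move=> h1; have h : (NP (N `|` [set 0%R]) <= NP N + NP [set 0%R])%E.
  exact: (measureU2 NP mN (measurable_set1 0%R)).
have : (1 <= 0 :> \bar R)%E by rewrite -h1 (le_trans h) // z adde0 N0.
by rewrite lee_fin ler10.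
Qed.

End StandardNormal.

Section NoiseMoments.
Variables (R : realType) (d : nat).
Context (disp : measure_display) (Om : measurableType disp).
Variable Pr : probability Om R.
Local Notation EE := (EE Pr).
Local Notation L2 := (L2 Pr).
Local Notation uncorr := (uncorr Pr).
Local Notation kappa := (normal_var R).

Lemma uncorrC (X Y : Om -> R) : uncorr X Y -> uncorr Y X.
Proof. by rewrite /uncorr; under [in X in _ -> X]eq_fun do rewrite mulrC. Qed.

Lemma EE_sqD (X Y : Om -> R) : L2 X -> L2 Y -> uncorr X Y ->
  EE (fun w => (X w + Y w) ^+ 2) = EE (fun w => X w ^+ 2) + EE (fun w => Y w ^+ 2).
Proof.
move=> hX hY hu; have hXY := L2M_L1 hX hY.
rewrite (_ : (fun w => _) = (fun w => X w ^+ 2 + (2 * (X w * Y w) + Y w ^+ 2))).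
  rewrite EED; [|exact: hX.2|by apply: L1D; [exact: L1Z|exact: hY.2]].
  rewrite EED; [|exact: L1Z|exact: hY.2].
  by rewrite EEZ // hu mulr0 add0r.
by apply/funext => w; ring.
Qed.

Lemma uncorr_suml (J : Type) (r : seq J) (F : J -> Om -> R) X :
  (forall i, L2 (F i)) -> L2 X -> (forall i, uncorr (F i) X) ->
  uncorr (fun w => \sum_(i <- r) F i w) X.
Proof.
move=> hF hX hu; rewrite /uncorr EE_sumM //.
by rewrite big1 // => i _; exact: hu.
Qed.

Lemma uncorr_sumr (J : Type) (r : seq J) (F : J -> Om -> R) X :
  (forall i, L2 (F i)) -> L2 X -> (forall i, uncorr X (F i)) ->
  uncorr X (fun w => \sum_(i <- r) F i w).
Proof.
by move=> hF hX hu; apply/uncorrC/uncorr_suml => // i; exact/uncorrC.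
Qed.

Lemma uncorrZl c (X Y : Om -> R) : L2 X -> L2 Y -> uncorr X Y ->
  uncorr (fun w => c * X w) Y.
Proof.
move=> hX hY hu; rewrite /uncorr.
under eq_fun do rewrite -mulrA.
by rewrite EEZ ?hu ?mulr0 //; exact: L2M_L1.
Qed.

Lemma uncorrDl (X Y Z : Om -> R) : L2 X -> L2 Y -> L2 Z ->
  uncorr X Z -> uncorr Y Z -> uncorr (fun w => X w + Y w) Z.
Proof.
move=> hX hY hZ h1 h2; rewrite /uncorr; under eq_fun do rewrite mulrDl.
by rewrite EED ?h1 ?h2 ?addr0 //; exact: L2M_L1.
Qed.

Lemma uncorrBl (X Y Z : Om -> R) : L2 X -> L2 Y -> L2 Z ->
  uncorr X Z -> uncorr Y Z -> uncorr (fun w => X w - Y w) Z.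
Proof.
move=> hX hY hZ h1 h2.
have := @uncorrDl X (fun w => -1 * Y w) Z hX (L2Z _ hY) hZ h1 (uncorrZl _ hY hZ h2).
by under eq_fun do rewrite mulN1r.
Qed.

Definition lin (k : 'rV[R]_d) (X : Om -> 'cV[R]_d) (w : Om) : R := (k *m X w) 0 0.

Lemma linE k X w : lin k X w = \sum_j k 0 j * X w j 0.
Proof. by rewrite /lin mxE. Qed.

Definition L2v (X : Om -> 'cV[R]_d) := forall j, L2 (fun w => X w j 0).
Definition uncorrv (X Y : Om -> 'cV[R]_d) :=
  forall i j, uncorr (fun w => X w i 0) (fun w => Y w j 0).

Lemma lin_L2 k X : L2v X -> L2 (lin k X).
Proof.
move=> hX; rewrite (_ : lin k X = fun w => \sum_j k 0 j * X w j 0).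
  by apply: L2_sum => j; exact: L2Z.
by apply/funext => w; rewrite linE.
Qed.

Lemma lin_uncorr k l X Y : L2v X -> L2v Y -> uncorrv X Y ->
  uncorr (lin k X) (lin l Y).
Proof.
move=> hX hY hu.
rewrite (_ : lin k X = fun w => \sum_j k 0 j * X w j 0); last first.
  by apply/funext => w; rewrite linE.
rewrite (_ : lin l Y = fun w => \sum_j l 0 j * Y w j 0); last first.
  by apply/funext => w; rewrite linE.
apply: uncorr_suml => [i||i]; [exact: L2Z|by apply: L2_sum => j; exact: L2Z|].
apply: uncorr_sumr => [j||j]; [exact: L2Z|exact: L2Z|].
apply: uncorrZl => //; first exact: L2Z.
by apply/uncorrC/uncorrZl => //; exact/uncorrC.
Qed.

(** If the variance of the form is zero its law is a point mass at 0. Otherwise the form is rescaled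
    to variance 1, where its moments are those of the standard normal law. *)
Lemma gaussian_moments (C : 'M[R]_d) X (k : 'rV[R]_d) : sym_psd C ->
  gaussian_vector Pr C X ->
  [/\ L2 (lin k X), EE (lin k X) = 0 &
      EE (fun w => lin k X w ^+ 2) = kappa * (k *m C *m k^T) 0 0].
Proof.
move=> [_ psd] [mX hX].
have mlin (l : 'rV[R]_d) : measurable_fun setT (lin l X).
  rewrite (_ : lin l X = fun w => \sum_j l 0 j * X w j 0).
    by apply: measurable_sum => j; apply: measurable_funM => //; exact: mX.
  by apply/funext => w; rewrite linE.
have hv (l : 'rV[R]_d) (B : set R) : measurable B -> Pr (lin l X @^-1` B) =
    centered_normal ((l *m C *m l^T) 0 0) B.
  by move=> mB; have := hX l^T B mB; rewrite trmxK.
set s := (k *m C *m k^T) 0 0.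
have s0 : 0 <= s by have := psd k^T; rewrite trmxK.
have [sE|sn0] := eqVneq s 0.
  have ae0 : {ae Pr, forall w, 0 = lin k X w}.
    exists (lin k X @^-1` (~` [set 0])); split.
    - by rewrite -[X in measurable X]setTI; apply: mlin => //; exact: measurableC.
    - rewrite hv; last exact: measurableC.
      rewrite /centered_normal -/s sE eqxx diracE memNset //=.
    - by move=> w /= h h0; apply: h; rewrite h0.
  have L := L2_ae (mlin k) ae0 (L2_cst Pr 0).
  split=> //.
    by rewrite -(EE_ae (X := fun=> 0) _ _ ae0) ?EE_cst //; exact: mlin.
  rewrite sE mulr0 -(EE_ae (X := fun=> 0)) ?EE_cst //.
    by apply: measurable_funX; exact: mlin.
  by apply: filterS ae0 => w <-; rewrite expr0n.
have sp : 0 < s by rewrite lt_neqAle eq_sym sn0.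
pose sg := Num.sqrt s.
have sg0 : 0 < sg by rewrite sqrtr_gt0.
have sgs : sg ^+ 2 = s by rewrite sqr_sqrtr.
pose BR := g_sigma_algebraType R.-ocitv.-measurable.
have mlin' (l : 'rV[R]_d) : measurable_fun setT (lin l X : Om -> BR) by exact: mlin.
pose dist (l : 'rV[R]_d) : {mfun Om >-> BR} :=
  HB.pack (lin l X : Om -> BR) (isMeasurableFun.Build _ _ _ _ (lin l X : Om -> BR) (mlin' l)).
have unit_moments (l : 'rV[R]_d) : (l *m C *m l^T) 0 0 = 1 ->
    [/\ L2 (lin l X), EE (fun w => lin l X w ^+ 2) = kappa &
        EE (lin l X) = fine (\int[normal_prob 0 1]_x x%:E)].
  move=> l1.
  have eqm (A : set BR) : measurable A ->
      distribution Pr (dist l) A = normal_prob (0 : R) 1 A.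
    move=> mA; rewrite /distribution /pushforward /= hv // /centered_normal l1.
    by rewrite oner_eq0 sqrtr1.
  have mid : measurable_fun setT (fun x : BR => (x : R)%:E) by exact/measurable_EFinP.
  have msq : measurable_fun setT (fun x : BR => ((x : R) ^+ 2)%:E).
    by apply/measurable_EFinP; exact: measurable_funX.
  have sqE : (\int[Pr]_w (lin l X w ^+ 2)%:E = \int[normal_prob 0 1]_x (x ^+ 2)%:E)%E.
    transitivity (\int[distribution Pr (dist l)]_y (y ^+ 2)%:E)%E.
      by rewrite ge0_integral_distribution // => y; rewrite lee_fin sqr_ge0.
    by apply: eq_measure_integral => A mA _; exact: eqm.
  have L : L2 (lin l X).
    split=> //; apply/integrableP; split.
      by apply/measurable_EFinP; exact: measurable_funX.
    under eq_integral do rewrite gee0_abs ?lee_fin ?sqr_ge0 //.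
    rewrite sqE; have /integrableP[_] := normal_sqr_L1 R.
    by under eq_integral do rewrite gee0_abs ?lee_fin ?sqr_ge0 //.
  split=> //; first by rewrite /EE sqE.
  rewrite /EE; congr fine.
  transitivity (\int[distribution Pr (dist l)]_y y%:E)%E.
    by rewrite integral_distribution //; exact: (L2_L1 L).
  by apply: eq_measure_integral => A mA _; exact: eqm.
have linZ c (l : 'rV[R]_d) : lin (c *: l) X = fun w => c * lin l X w.
  by apply/funext => w; rewrite /lin -scalemxAl mxE.
have k1 : ((sg^-1 *: k) *m C *m (sg^-1 *: k)^T) 0 0 = 1.
  rewrite linearZ /= -!scalemxAl -scalemxAr scalerA mxE -/s -sgs.
  by field; rewrite gt_eqF.
have k2 : ((- sg^-1 *: k) *m C *m (- sg^-1 *: k)^T) 0 0 = 1.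
  by rewrite !scaleNr linearN /= !mulNmx mulmxN opprK.
have kE : lin k X = (fun w => sg * lin (sg^-1 *: k) X w).
  by apply/funext => w; rewrite linZ mulrA divff ?mul1r // gt_eqF.
have [L u1 u2] := unit_moments _ k1; have [_ _ u3] := unit_moments _ k2.
(* The normalised form and its opposite have the same law, so their common mean equals its own
   opposite. *)
have z : EE (lin (sg^-1 *: k) X) = 0.
  have : EE (lin (- sg^-1 *: k) X) = - EE (lin (sg^-1 *: k) X).
    rewrite -[RHS]mulN1r -EEZ; last exact: L2_L1.
    by rewrite -linZ scalerA mulN1r.
  by rewrite u2 u3; lra.
rewrite kE; split; first exact: L2Z.
  by rewrite EEZ ?z ?mulr0 //; exact: L2_L1.
under eq_fun do rewrite exprMn.
by rewrite EEZ; [rewrite u1 sgs mulrC | exact: L.2].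
Qed.

End NoiseMoments.

Section WienerMoments.
Variables (R : realType) (d : nat).
Context (disp : measure_display) (Om : measurableType disp).
Variable Pr : probability Om R.
Local Notation EE := (EE Pr).
Local Notation L2 := (L2 Pr).
Local Notation uncorr := (uncorr Pr).
Local Notation L2v := (L2v Pr).
Local Notation uncorrv := (uncorrv Pr).
Local Notation kappa := (normal_var R).

Lemma sigma_of_preimage (I : Type) (D : set I) (X : I -> Om -> 'cV[R]_d) t i (B : set R) :
  D t -> measurable B -> sigma_of D X ((fun w => X t w i 0) @^-1` B).
Proof. by move=> Dt mB; apply: sub_gen_smallest; exists t, i, B. Qed.

Lemma sym_psdZ (C : 'M[R]_d) (a : R) : 0 <= a -> sym_psd C -> sym_psd (a *: C).
Proof.
move=> a0 [symC psdC]; split; first by rewrite linearZ /= symC.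
by move=> v; rewrite -scalemxAr -scalemxAl mxE mulr_ge0.
Qed.

Lemma coord_lin (j : 'I_d) (X : Om -> 'cV[R]_d) :
  (fun w => X w j 0) = lin (delta_mx 0 j) X.
Proof.
apply/funext => w; rewrite /lin -rowE mxE.
by [].
Qed.

Lemma gaussian_L2v (C : 'M[R]_d) (X : Om -> 'cV[R]_d) : sym_psd C ->
  gaussian_vector Pr C X -> L2v X /\ forall j, EE (fun w => X w j 0) = 0.
Proof.
move=> psd hX; split=> j; rewrite coord_lin.
  by have [] := gaussian_moments (delta_mx 0 j) psd hX.
by have [] := gaussian_moments (delta_mx 0 j) psd hX.
Qed.

Section Wiener.
Variables (C : 'M[R]_d) (W : R -> Om -> 'cV[R]_d).
Hypotheses (psdC : sym_psd C) (wW : wiener Pr C W).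

Lemma wiener_inc_L2v s t : 0 <= s -> s <= t ->
  L2v (fun w => W t w - W s w) /\
  forall j, EE (fun w => (W t w - W s w) j 0) = 0.
Proof.
move=> s0 st; have [_ _ hg _] := wW.
apply: gaussian_L2v (hg s t s0 st); apply: sym_psdZ => //.
by rewrite subr_ge0.
Qed.

(** W 0 vanishes only almost surely, so the moments of W t are transferred from those of the
    increment W t - W 0. *)
Lemma wiener_L2v t : 0 <= t -> L2v (W t) /\ forall j, EE (fun w => W t w j 0) = 0.
Proof.
move=> t0; have [h1 h2] := wiener_inc_L2v (lexx 0) t0.
have [mW aeW _ _] := wW.
have ae j : {ae Pr, forall w, (W t w - W 0 w) j 0 = W t w j 0}.
  by apply: filterS aeW => w [-> _]; rewrite subr0.
have h j : L2 (fun w => W t w j 0) by apply: L2_ae (ae j) (h1 j); exact: mW.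
split=> // j; rewrite -(h2 j); apply/esym/EE_ae => //.
- by case: (h1 j).
- by case: (h j).
Qed.

Lemma wiener_inc_past r s t : 0 <= r -> r <= s -> s <= t ->
  uncorrv (W r) (fun w => W t w - W s w).
Proof.
move=> r0 rs st i j; have [_ _ _ hi] := wW.
have s0 := le_trans r0 rs.
have [h1 h2] := wiener_inc_L2v s0 st; have [h3 h4] := wiener_L2v r0.
rewrite /uncorr (EE_indep (h3 i) (h1 j)) ?h4 ?mul0r // => A B mA mB.
apply: (hi s t s0 st).
  by apply: (sigma_of_preimage (X := W)) => //=; rewrite in_itv /= r0.
exact: (sigma_of_preimage (D := [set: unit]) (X := fun _ w => W t w - W s w) (t := tt)).
Qed.

Lemma wiener_inc_orth r s t u : 0 <= r -> r <= s -> s <= t -> t <= u ->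
  uncorrv (fun w => W s w - W r w) (fun w => W u w - W t w).
Proof.
move=> r0 rs st tu i j.
have s0 := le_trans r0 rs; have t0 := le_trans s0 st.
have [h1 _] := wiener_inc_L2v t0 tu.
have [h2 _] := wiener_L2v s0; have [h3 _] := wiener_L2v r0.
rewrite (_ : (fun w => _) = (fun w => W s w i 0 - W r w i 0)).
  apply: uncorrBl => //; apply: wiener_inc_past => //.
  exact: le_trans rs st.
by apply/funext => w; rewrite !mxE.
Qed.

Lemma wiener_inc_var s t (k : 'rV[R]_d) : 0 <= s -> s <= t ->
  EE (fun w => lin k (fun w => W t w - W s w) w ^+ 2)
  = kappa * ((t - s) * (k *m C *m k^T) 0 0).
Proof.
move=> s0 st; have [_ _ hg _] := wW.
have ps : sym_psd ((t - s) *: C) by apply: sym_psdZ; rewrite ?subr_ge0.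
have [_ _ ->] := gaussian_moments k ps (hg s t s0 st).
by rewrite -scalemxAr -scalemxAl mxE.
Qed.

Definition winc (t : R) (M i : nat) (w : Om) : 'cV[R]_d :=
  W (t * i.+1%:R / M%:R) w - W (t * i%:R / M%:R) w.

Lemma node_le (t : R) (M i j : nat) : 0 <= t -> (i <= j)%N ->
  t * i%:R / M%:R <= t * j%:R / M%:R.
Proof.
by move=> t0 ij; rewrite ler_wpM2r ?invr_ge0 // ler_wpM2l // ler_nat.
Qed.

Lemma node_ge0 (t : R) (M i : nat) : 0 <= t -> 0 <= t * i%:R / M%:R.
Proof. by move=> t0; rewrite divr_ge0 // mulr_ge0. Qed.

Lemma winc_L2v t M i : 0 <= t -> L2v (winc t M i).
Proof.
by move=> t0; apply: (wiener_inc_L2v _ _).1; [exact: node_ge0 | exact: node_le].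
Qed.

Lemma winc_mean t M i j : 0 <= t -> EE (fun w => winc t M i w j 0) = 0.
Proof.
by move=> t0; apply: (wiener_inc_L2v _ _).2; [exact: node_ge0 | exact: node_le].
Qed.

Lemma EE_lin0 (k : 'rV[R]_d) (X : Om -> 'cV[R]_d) : L2v X ->
  (forall j, EE (fun w => X w j 0) = 0) -> EE (lin k X) = 0.
Proof.
move=> hX h0; rewrite (_ : lin k X = fun w => \sum_j k 0 j * X w j 0).
  rewrite EE_sum; last by move=> j; exact: L2Z.
  by rewrite big1 // => j _; rewrite EEZ ?h0 ?mulr0 //; exact: L2_L1.
by apply/funext => w; rewrite linE.
Qed.

(** The discrete isometry: increments over disjoint cells are uncorrelated, so only the diagonal
    terms survive. *)
Lemma winc_sum_var t M (a : 'I_M -> 'rV[R]_d) : 0 <= t ->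
  let X w := \sum_(i < M) lin (a i) (winc t M i) w in
  [/\ L2 X, EE X = 0 & EE (fun w => X w ^+ 2)
    = kappa * (t / M%:R * \sum_(i < M) (a i *m C *m (a i)^T) 0 0)].
Proof.
move=> t0 X.
have hL i : L2 (lin (a i) (winc t M i)) by apply: lin_L2; exact: winc_L2v.
split; first exact: L2_sum.
  rewrite EE_sum // big1 // => i _; apply: EE_lin0; first exact: winc_L2v.
  by move=> j; exact: winc_mean.
rewrite EE_sq_orthogonal //.
  rewrite !mulr_sumr; apply: eq_bigr => i _.
  rewrite wiener_inc_var; [|exact: node_ge0|exact: node_le].
  by congr (_ * (_ * _)); rewrite -addn1 natrD; ring.
have lt (i j : 'I_M) : (i < j)%N ->
    uncorr (lin (a i) (winc t M i)) (lin (a j) (winc t M j)).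
  move=> ij; apply: lin_uncorr; [exact: winc_L2v|exact: winc_L2v|].
  by apply: wiener_inc_orth; [exact: node_ge0|exact: node_le..].
move=> i j; rewrite -val_eqE neq_ltn => /orP[ij|ij]; first exact: lt.
exact/uncorrC/lt.
Qed.

End Wiener.

Section Noise.
Variables (SigV Sigq0 : 'M[R]_d) (W V : R -> Om -> 'cV[R]_d) (q0 : Om -> 'cV[R]_d).
Hypotheses (psdV : sym_psd SigV) (psdq : sym_psd Sigq0).
Hypothesis hn : noise Pr SigV Sigq0 W V q0.

Lemma sym_psd_SigW : sym_psd (@SigW R d).
Proof.
split; first by rewrite /SigW trmx1.
move=> v; rewrite /SigW mulmx1 mxE sumr_ge0 // => i _.
by rewrite mxE -expr2 sqr_ge0.
Qed.

Let wW : wiener Pr SigW W. Proof. by case: hn. Qed.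
Let wV : wiener Pr SigV V. Proof. by case: hn. Qed.
Let gq : gaussian_vector Pr Sigq0 q0. Proof. by case: hn. Qed.

Lemma noise_uncorr s t : 0 <= s -> 0 <= t ->
  [/\ uncorrv (W s) (V t), uncorrv q0 (W s) & uncorrv q0 (V t)].
Proof.
move=> s0 t0; have [_ _ _ hi] := hn.
have [hW W0] := wiener_L2v sym_psd_SigW wW s0.
have [hV V0] := wiener_L2v psdV wV t0.
have [hq q00] := gaussian_L2v psdq gq.
(* Pairwise independence is extracted from the threefold one by taking the whole space as the event
   of the third process. *)
have pT (f : Om -> R) : f @^-1` setT = setT by [].
have mq i (B : set R) : measurable B ->
    sigma_of_vector q0 ((fun w => q0 w i 0) @^-1` B).
  exact: (sigma_of_preimage (D := [set: unit]) (X := fun=> q0) (t := tt)).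
have mW i (B : set R) : measurable B ->
    sigma_of `[0, +oo[ W ((fun w => W s w i 0) @^-1` B).
  by apply: (sigma_of_preimage (X := W)) => /=; rewrite in_itv /= s0.
have mV i (B : set R) : measurable B ->
    sigma_of `[0, +oo[ V ((fun w => V t w i 0) @^-1` B).
  by apply: (sigma_of_preimage (X := V)) => /=; rewrite in_itv /= t0.
split=> i j.
- rewrite /uncorr (EE_indep (hW i) (hV j)) ?W0 ?mul0r // => A B mA mB.
  have := hi _ _ _ (mW i A mA) (mV j B mB) (mq i setT measurableT).
  by rewrite pT setIT probability_setT mule1.
- rewrite /uncorr (EE_indep (hq i) (hW j)) ?q00 ?mul0r // => A B mA mB.
  have := hi _ _ _ (mW j B mB) (mV i setT measurableT) (mq i A mA).
  by rewrite pT setIT probability_setT mule1 setIC muleC.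
- rewrite /uncorr (EE_indep (hq i) (hV j)) ?q00 ?mul0r // => A B mA mB.
  have := hi _ _ _ (mW i setT measurableT) (mV j B mB) (mq i A mA).
  by rewrite pT setTI probability_setT mul1e setIC muleC.
Qed.

Lemma uncorrvBr (X Y Z : Om -> 'cV[R]_d) : L2v X -> L2v Y -> L2v Z ->
  uncorrv Z X -> uncorrv Z Y -> uncorrv Z (fun w => X w - Y w).
Proof.
move=> hX hY hZ h1 h2 i j; apply: uncorrC.
rewrite (_ : (fun w => _) = (fun w => X w j 0 - Y w j 0)).
  by apply: uncorrBl => //; apply: uncorrC; [exact: h1|exact: h2].
by apply/funext => w; rewrite !mxE.
Qed.

Lemma uncorrvC (X Y : Om -> 'cV[R]_d) : uncorrv X Y -> uncorrv Y X.
Proof. by move=> h i j; exact/uncorrC/h. Qed.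

Lemma noise_sum_var t M (c : 'rV[R]_d) (a b : 'I_M -> 'rV[R]_d) : 0 <= t ->
  let X w := lin c q0 w + (\sum_(i < M) lin (a i) (winc W t M i) w
             + \sum_(i < M) lin (b i) (winc V t M i) w) in
  [/\ L2 X, EE X = 0 & EE (fun w => X w ^+ 2)
    = kappa * ((c *m Sigq0 *m c^T) 0 0 + t / M%:R *
       \sum_(i < M) ((a i *m (a i)^T) 0 0 + (b i *m SigV *m (b i)^T) 0 0))].
Proof.
move=> t0 X.
have [qL q00 qv] := gaussian_moments c psdq gq.
have [hq _] := gaussian_L2v psdq gq.
have [WL W0 Wv] := winc_sum_var sym_psd_SigW wW a t0.
have [VL V0 Vv] := winc_sum_var psdV wV b t0.
have wL i := winc_L2v sym_psd_SigW wW M i t0.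
have vL i := winc_L2v psdV wV M i t0.
have WsL s : 0 <= s -> L2v (W s) by move=> s0; have [] := wiener_L2v sym_psd_SigW wW s0.
have VsL s : 0 <= s -> L2v (V s) by move=> s0; have [] := wiener_L2v psdV wV s0.
have ng i := @node_ge0 t M i t0.
have uW (Z : Om -> 'cV[R]_d) i : L2v Z -> (forall s, 0 <= s -> uncorrv Z (W s)) ->
    uncorrv Z (winc W t M i).
  by move=> hZ hu; apply: uncorrvBr; [exact: WsL|exact: WsL|exact: hZ|exact: hu|exact: hu].
have uV (Z : Om -> 'cV[R]_d) i : L2v Z -> (forall s, 0 <= s -> uncorrv Z (V s)) ->
    uncorrv Z (winc V t M i).
  by move=> hZ hu; apply: uncorrvBr; [exact: VsL|exact: VsL|exact: hZ|exact: hu|exact: hu].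
have uWV : uncorr (fun w => \sum_(i < M) lin (a i) (winc W t M i) w)
                  (fun w => \sum_(i < M) lin (b i) (winc V t M i) w).
  apply: uncorr_suml => [i||i]; [exact: lin_L2|exact: VL|].
  apply: uncorr_sumr => [j||j]; [exact: lin_L2|exact: lin_L2|].
  apply: lin_uncorr => //; apply: uV => // s s0.
  apply: uncorrvC; apply: uW; first exact: VsL.
  by move=> r r0; apply: uncorrvC; have [] := noise_uncorr r0 s0.
have uqW : uncorr (lin c q0) (fun w => \sum_(i < M) lin (a i) (winc W t M i) w).
  apply: uncorr_sumr => [j||j]; [exact: lin_L2|exact: lin_L2|].
  apply: lin_uncorr => //; apply: uW => // s s0.
  by have [] := noise_uncorr s0 s0.
have uqV : uncorr (lin c q0) (fun w => \sum_(i < M) lin (b i) (winc V t M i) w).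
  apply: uncorr_sumr => [j||j]; [exact: lin_L2|exact: lin_L2|].
  apply: lin_uncorr => //; apply: uV => // s s0.
  by have [] := noise_uncorr s0 s0.
split.
- by apply: L2D => //; exact: L2D.
- rewrite /X EED ?q00 ?add0r; [|exact: L2_L1|by apply: L2_L1; exact: L2D].
  by rewrite EED ?W0 ?V0 ?addr0 //; exact: L2_L1.
- rewrite EE_sqD //; [|exact: L2D|]; last first.
    by apply: uncorrC; apply: uncorrDl => //; exact: uncorrC.
  rewrite EE_sqD // qv Wv Vv big_split /= !mulrDr; congr (_ + (_ + _)).
  by under eq_bigr do rewrite /SigW mulmx1.
Qed.

End Noise.

End WienerMoments.

(** * The isometry for Wiener integrals of Lipschitz kernels *)

Section WienerIntegral.
Variables (R : realType) (d : nat) (T : R).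

Lemma acm_lip m n (F F' : R -> 'M[R]_(m, n)) : acm T F F' ->
  exists2 B, 0 < B & forall s t i j, 0 <= s <= t -> t <= T ->
    `|F t i j - F s i j| <= B * (t - s).
Proof.
move=> hF.
have /choice[B hB] : forall x : 'I_m * 'I_n, exists B : R, 0 < B /\
    forall s t, 0 <= s <= t -> t <= T -> `|F t x.1 x.2 - F s x.1 x.2| <= B * (t - s).
  by move=> x; have [B ? ?] := ac_lip (hF x.1 x.2); exists B.
have B0 x : 0 <= B x by have [/ltW] := hB x.
exists (1 + \sum_x B x); first by rewrite ltr_pwDl // sumr_ge0.
move=> s t i j st tT; have [_ /(_ s t st tT) h] := hB (i, j).
apply: le_trans h _; apply: ler_wpM2r; first by rewrite subr_ge0; case/andP: st.
by rewrite (bigD1 (i, j)) //= addrCA lerDl addr_ge0 // sumr_ge0.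
Qed.

Lemma qf_bound n (C : 'M[R]_n) (a : 'rV[R]_n) (e : R) :
  (forall j, `|a 0 j| <= e) ->
  (a *m C *m a^T) 0 0 <= (\sum_(p : 'I_n * 'I_n) `|C p.1 p.2|) * e ^+ 2.
Proof.
move=> ha; rewrite mxE mulr_suml.
rewrite (eq_bigr (fun j => \sum_i a 0 i * C i j * a 0 j)); last first.
  by move=> j _; rewrite !mxE mulr_suml.
rewrite exchange_big /= pair_big /=; apply: ler_sum => p _.
apply: le_trans (ler_norm _) _; rewrite !normrM mulrAC mulrC expr2.
by rewrite ler_wpM2l // ler_pM.
Qed.

(** Cell j of the grid refined P times lies in cell j %/ P of the coarse grid, whose coefficient it
    inherits. Sums over nested grids can then be subtracted term by term. *)
Lemma sum_refine (U : zmodType) (f : nat -> U -> R) (y : nat -> U) N P :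
  (forall i, {morph f i : u v / u + v}) -> (0 < P)%N ->
  \sum_(i < N) f i (y (i.+1 * P)%N - y (i * P)%N) =
  \sum_(j < N * P) f (j %/ P)%N (y j.+1 - y j).
Proof.
move=> fD P0.
have f0 i : f i 0 = 0 by have := fD i 0 0; rewrite addr0; lra.
elim: N => [|N IH]; first by rewrite !big_ord0.
rewrite big_ord_recr /= IH -!(big_mkord xpredT (fun j => f (j %/ P)%N (y j.+1 - y j))).
rewrite mulSn addnC (@big_cat_nat _ _ _ (N * P)%N 0 (N * P + P)) ?leq_addr //=.
congr (_ + _).
have : forall n, (n <= P)%N -> f N (y (N * P + n)%N - y (N * P)%N) =
    \sum_(N * P <= j < N * P + n) f (j %/ P)%N (y j.+1 - y j).
  elim=> [_|n IHn nP]; first by rewrite addn0 subrr f0 big_geq.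
  rewrite addnS big_nat_recr ?leq_addr //= -IHn; last exact: ltnW.
  rewrite (_ : (N * P + n) %/ P = N)%N; last by rewrite divnMDl // divn_small // addn0.
  by rewrite -fD; congr (f N _); rewrite [RHS]addrC addrA subrK.
by move=> /(_ P (leqnn P)) <-; rewrite addnC.
Qed.

Lemma cvg_sumr (J : Type) (r : seq J) (f : J -> nat -> R) (l : J -> R) :
  (forall j, f j n @[n --> \oo] --> l j) ->
  \sum_(j <- r) f j n @[n --> \oo] --> \sum_(j <- r) l j.
Proof.
move=> h; elim: r => [|j r IH].
  by rewrite big_nil; under eq_fun do rewrite big_nil; exact: cvg_cst.
rewrite big_cons; under eq_fun do rewrite big_cons.
exact: cvgD.
Qed.

Lemma cvg_expn2 : (2 ^ n)%N @[n --> \oo] --> \oo.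
Proof.
move=> A [N _ hN]; exists N => // n /= Nn; apply: hN => /=.
by apply: leq_trans Nn _; rewrite ltnW // ltn_expl.
Qed.

(** The Stieltjes sums against the identity path, with the boundary term undone by the product
    rule. *)
Lemma riemann_sum_cvg (g g' : R -> R) t : ac T g g' -> 0 <= t <= T ->
  t / N%:R * (\sum_(i < N) g (t * i%:R / N%:R)) @[N --> \oo] --> int0 g t.
Proof.
move=> acg tT.
have cid : ac T (fun s => s) (fun=> 1).
  split; first exact: bm_cst.
  by move=> s /andP[s0 _]; rewrite int0_cst // mul1r add0r.
have := riemann_stieltjes_cvg acg (ac_cont cid) tT.
rewrite (_ : _ - int0 _ _ = int0 g t).
  apply: cvg_trans; apply: near_eq_cvg; near=> N.
  rewrite mulr_sumr; apply: eq_bigr => i _.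
  rewrite mulrC; congr (_ * _); rewrite -addn1 natrD.
  have N0 : N%:R != 0 :> R.
    by rewrite pnatr_eq0 -lt0n; near: N; exact: nbhs_infty_gt.
  by field.
have [_ /(_ _ tT)] := acM acg cid.
have bg := ac_bm acg; have [bg' _] := acg.
have [_ tT'] := andP tT.
rewrite (int0D (bmM bg' (ac_bm cid)) (bmM bg (bm_cst _ _)) tT') => ->.
rewrite [int0 (fun s => g s * 1) t](@int0_ext _ _ g); last by move=> *; rewrite mulr1.
by ring.
Unshelve. all: by end_near. Qed.

Context (disp : measure_display) (Om : measurableType disp).
Variable Pr : probability Om R.
Local Notation kappa := (normal_var R).
Variables (SigV Sigq0 : 'M[R]_d) (W V : R -> Om -> 'cV[R]_d) (q0 : Om -> 'cV[R]_d).
Hypotheses (psdV : sym_psd SigV) (psdq : sym_psd Sigq0).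
Hypothesis hn : noise Pr SigV Sigq0 W V q0.

Lemma stieltjes_row_cvg (k k' : R -> 'rV[R]_d) (y : R -> 'cV[R]_d) t :
  acm T k k' -> continuous_mx T y -> y 0 = 0 -> 0 <= t <= T ->
  (\sum_(i < N) (k (t * i%:R / N%:R) *m
     (y (t * i.+1%:R / N%:R) - y (t * i%:R / N%:R)))) 0 0 @[N --> \oo]
  --> (k t *m y t - integral_mx 0 t (fun s => k' s *m y s)) 0 0.
Proof.
move=> ack cy y0 tT; have [_ tT'] := andP tT.
rewrite (_ : (fun N => _) = (fun N => \sum_j \sum_(i < N) k (t * i%:R / N%:R) 0 j *
     (y (t * i.+1%:R / N%:R) j 0 - y (t * i%:R / N%:R) j 0))); last first.
  apply/funext => N; rewrite exchange_big /= summxE; apply: eq_bigr => i _.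
  by rewrite mxE; apply: eq_bigr => j _; rewrite !mxE.
rewrite (_ : (k t *m y t - _) 0 0 = \sum_j (k t 0 j * y t j 0 - k 0 0 j * y 0 j 0
    - int0 (fun s => k' s 0 j * y s j 0) t)); last first.
  rewrite !mxE; under [RHS]eq_bigr do rewrite y0 mxE mulr0 subr0.
  rewrite sumrB; congr (_ - _).
  rewrite -(@int0_sum _ T _ _ (fun j s => k' s 0 j * y s j 0)) //.
    by apply: int0_ext => s _; rewrite mxE.
  by move=> j; exact: (bmM (acm_bmm' ack 0 j) (bm_cont (cy j 0))).
apply: cvg_sumr => j; exact: (riemann_stieltjes_cvg (ack 0 j) (cy j 0) tT).
Qed.

(** k t W t minus the integral of k' W is the integral of k dW by parts, so each path is the limit
    of left-endpoint sums. Along dyadic grids, which are nested, these sums are Cauchy in L2 by the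
    discrete isometry, and their variances are Riemann sums. *)
Lemma noise_integral_moments (c : 'rV[R]_d) (k k' l l' : R -> 'rV[R]_d) t (X : Om -> R) :
  acm T k k' -> acm T l l' -> 0 <= t <= T -> measurable_fun setT X ->
  {ae Pr, forall w, X w = (c *m q0 w
     + (k t *m W t w - integral_mx 0 t (fun s => k' s *m W s w))
     + (l t *m V t w - integral_mx 0 t (fun s => l' s *m V s w))) 0 0} ->
  [/\ L2 Pr X, EE Pr X = 0 &
   EE Pr (fun w => X w ^+ 2) = kappa * (c *m Sigq0 *m c^T
     + integral_mx 0 t (fun s => k s *m (k s)^T + l s *m SigV *m (l s)^T)) 0 0].
Proof.
move=> ack acl tT mX aeX; have /andP[t0 tT'] := tT.
have [[_ aeW _ _] [_ aeV _ _] _ _] := hn.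
pose nd N i : R := t * i%:R / N%:R.
pose Xn n w := lin c q0 w + (\sum_(i < 2 ^ n) lin (k (nd (2 ^ n)%N i)) (winc W t (2 ^ n) i) w
   + \sum_(i < 2 ^ n) lin (l (nd (2 ^ n)%N i)) (winc V t (2 ^ n) i) w).
have Xn_mom n := noise_sum_var psdV psdq hn c (fun i : 'I_(2 ^ n) => k (nd (2 ^ n)%N i))
  (fun i => l (nd (2 ^ n)%N i)) t0.
have [B B0 kB] := acm_lip ack; have [D D0 lD] := acm_lip acl.
pose E := Num.max B D.
have E0 : 0 <= E by rewrite le_max (ltW B0).
pose K1 := \sum_(p : 'I_d * 'I_d) `|(1%:M : 'M[R]_d) p.1 p.2|.
pose K2 := \sum_(p : 'I_d * 'I_d) `|SigV p.1 p.2|.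
have K10 : 0 <= K1 by apply: sumr_ge0.
have K20 : 0 <= K2 by apply: sumr_ge0.
pose h n : R := t / (2 ^ n)%:R.
(* Within a coarse cell of width [h n] the kernels vary by at most [E * h n]; [K1] and [K2] bound
   the quadratic forms of the covariances 1 and [SigV]. *)
pose eps n := kappa * (t * ((K1 + K2) * (E * h n) ^+ 2)).
have kap0 := ltW (normal_var_gt0 R).
have refine n m : EE Pr (fun w => (Xn (m + n)%N w - Xn n w) ^+ 2) <= eps n.
  pose N := (2 ^ n)%N; pose P := (2 ^ m)%N; pose M := (N * P)%N.
  have P0 : (0 < P)%N by rewrite expn_gt0.
  have N0 : (0 < N)%N by rewrite expn_gt0.
  have NP : (2 ^ (m + n) = M)%N by rewrite expnD mulnC.
  have Pn : P%:R != 0 :> R by rewrite pnatr_eq0 -lt0n.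
  have Nn : N%:R != 0 :> R by rewrite pnatr_eq0 -lt0n.
  have ndE i : nd M (i * P)%N = nd N i.
    by rewrite /nd /M !natrM; field; rewrite ?Pn ?Nn.
  have coarse (a : R -> 'rV[R]_d) (Z : R -> Om -> 'cV[R]_d) w :
      \sum_(i < N) lin (a (nd N i)) (winc Z t N i) w =
      \sum_(j < M) lin (a (nd N (j %/ P)%N)) (winc Z t M j) w.
    rewrite -(@sum_refine _ (fun i u => (a (nd N i) *m u) 0 0) (fun j => Z (nd M j) w) N P) //.
      by apply: eq_bigr => i _; rewrite /lin /winc !ndE.
    by move=> i u v; rewrite mulmxDr mxE.
  (* On the finer grid the difference is again a noise sum, with coefficients kernel at the fine
     node minus kernel at the coarse node, and with zero weight on [q0]. *)
  have XE w : Xn (m + n)%N w - Xn n w = lin 0 q0 w +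
      (\sum_(j < M) lin (k (nd M j) - k (nd N (j %/ P)%N)) (winc W t M j) w
      + \sum_(j < M) lin (l (nd M j) - l (nd N (j %/ P)%N)) (winc V t M j) w).
    rewrite /Xn -/N NP !coarse.
    have sB (a b : nat -> 'rV[R]_d) Z : \sum_(j < M) lin (a j - b j) (winc Z t M j) w =
       \sum_(j < M) lin (a j) (winc Z t M j) w - \sum_(j < M) lin (b j) (winc Z t M j) w.
      rewrite -sumrB; apply: eq_bigr => j _.
      by rewrite /lin mulmxBl !mxE.
    rewrite (sB (fun j => k (nd M j)) (fun j => k (nd N (j %/ P)%N))).
    rewrite (sB (fun j => l (nd M j)) (fun j => l (nd N (j %/ P)%N))).
    rewrite [lin 0 q0 w]/lin mul0mx mxE; ring.
  have [_ _ v] := noise_sum_var psdV psdq hn 0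
    (fun j : 'I_M => k (nd M j) - k (nd N (j %/ P)%N))
    (fun j : 'I_M => l (nd M j) - l (nd N (j %/ P)%N)) t0.
  under eq_fun do rewrite XE.
  rewrite v !mul0mx mxE add0r /eps; apply: ler_wpM2l => //.
  rewrite -mulrA; apply: ler_wpM2l => //.
  have M0 : (0 < M)%N by rewrite muln_gt0 N0.
  rewrite ler_pdivrMl ?ltr0n // -[M in leRHS](card_ord M) mulr_natl -sumr_const.
  apply: ler_sum => j _.
  have jP : (j %/ P * P <= j)%N by exact: leq_divM.
  have st : 0 <= nd N (j %/ P)%N <= nd M j.
    by rewrite node_ge0 //= -ndE node_le.
  have jT : nd M j <= T.
    apply: le_trans tT'; rewrite /nd ler_pdivrMr ?ltr0n // ler_wpM2l // ler_nat.
    exact: ltnW.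
  have dh : nd M j - nd N (j %/ P)%N <= h n.
    rewrite lerBlDl (_ : _ + h n = nd M ((j %/ P).+1 * P)%N).
      by apply: node_le => //; rewrite ltnW // ltn_ceil.
    by rewrite ndE /nd /h -/N -addn1 natrD; ring.
  have bnd (a a' : R -> 'rV[R]_d) (G : R) :
      (forall s t i j, 0 <= s <= t -> t <= T -> `|a t i j - a s i j| <= G * (t - s)) ->
      0 <= G -> G <= E -> forall i, `|(a (nd M j) - a (nd N (j %/ P)%N)) 0 i| <= E * h n.
    move=> ha G0 GE i; rewrite !mxE; apply: le_trans (ha _ _ 0 i st jT) _.
    apply: ler_pM => //; by rewrite subr_ge0; case/andP: st.
  rewrite mulrDl; apply: lerD.
    rewrite -[X in X *m _](mulmx1 _); apply: qf_bound.
    by apply: (bnd k k' B) => //; [exact: ltW | rewrite le_max lexx].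
  apply: qf_bound.
  by apply: (bnd l l' D) => //; [exact: ltW | rewrite le_max lexx orbT].
have [|||||||L X0 v] := @EE_L2_limit _ _ _ Pr Xn X eps
  (kappa * (c *m Sigq0 *m c^T
     + integral_mx 0 t (fun s => k s *m (k s)^T + l s *m SigV *m (l s)^T)) 0 0).
- by move=> n; case: (Xn_mom n).
- by move=> n; case: (Xn_mom n).
- by [].
- apply: filterS2 aeX (filterI aeW aeV) => w Xw [[W0 cW] [V0 cV]].
  rewrite Xw.
  have cW2 := cvg_comp _ _ cvg_expn2 (stieltjes_row_cvg ack (cW T) W0 tT).
  have cV2 := cvg_comp _ _ cvg_expn2 (stieltjes_row_cvg acl (cV T) V0 tT).
  rewrite mxE [in X in _ --> X]mxE -addrA /Xn; apply: cvgD; first exact: cvg_cst.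
  apply: cvgD.
    move: cW2; apply: cvg_trans; apply: near_eq_cvg; apply: nearW => n /=.
    by rewrite summxE.
  move: cV2; apply: cvg_trans; apply: near_eq_cvg; apply: nearW => n /=.
  by rewrite summxE.
- exact: refine.
- have h0 : h n @[n --> \oo] --> (0 : R).
    rewrite (_ : h = fun n => t * 2^-1 ^+ n); last first.
      by apply/funext => n; rewrite /h natrX exprVn.
    rewrite -[X in _ --> X](mulr0 t); apply: cvgM; first exact: cvg_cst.
    by apply: cvg_expr; rewrite gtr0_norm ?invf_lt1 ?ltr1n.
  rewrite -[X in _ --> X](mulr0 kappa); apply: cvgM; first exact: cvg_cst.
  rewrite -[X in _ --> X](mulr0 t); apply: cvgM; first exact: cvg_cst.
  rewrite -[X in _ --> X](mulr0 (K1 + K2)); apply: cvgM; first exact: cvg_cst.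
  have Eh : E * h n @[n --> \oo] --> (0 : R).
    by rewrite -[X in _ --> X](mulr0 E); apply: cvgM => //; exact: cvg_cst.
  rewrite (_ : (fun n => _) = (fun n => (E * h n) * (E * h n))) //.
  rewrite -[X in _ --> X](mulr0 (0 : R)).
  by apply: cvgM.
- have acg : acm T (fun s => k s *m (k s)^T + l s *m SigV *m (l s)^T)
     (fun s => (k' s *m (k s)^T + k s *m (k' s)^T)
       + (l' s *m SigV *m (l s)^T + l s *m SigV *m (l' s)^T)).
    apply: acmD; first exact: acmM ack (acm_tr ack).
    exact: acmM (acmMr SigV acl) (acm_tr acl).
  have := cvg_comp _ _ cvg_expn2 (riemann_sum_cvg (acg 0 0) tT).
  move=> hr; rewrite (_ : (fun n => _) = (fun n => kappa * ((c *m Sigq0 *m c^T) 0 0 +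
      t / (2 ^ n)%:R * \sum_(i < 2 ^ n) ((k (nd (2 ^ n)%N i) *m (k (nd (2 ^ n)%N i))^T) 0 0
        + (l (nd (2 ^ n)%N i) *m SigV *m (l (nd (2 ^ n)%N i))^T) 0 0)))); last first.
    by apply/funext => n; have [_ _ ->] := Xn_mom n.
  apply: cvgM; first exact: cvg_cst.
  rewrite [X in _ --> X]mxE; apply: cvgD; first exact: cvg_cst.
  rewrite (_ : integral_mx _ _ _ _ _ = int0 (fun s =>
    (k s *m (k s)^T + l s *m SigV *m (l s)^T) 0 0) t); last by rewrite mxE.
  move: hr; apply: cvg_trans; apply: near_eq_cvg; apply: nearW => n /=.
  by congr (_ * _); apply: eq_bigr => i _; rewrite mxE.
by [].
Qed.

End WienerIntegral.

(** * Linear stochastic equations *)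

Section LinearSDE.
Variables (R : realType) (d m : nat) (T : R).
Hypothesis T_gt0 : 0 < T.
Context (disp : measure_display) (Om : measurableType disp).
Variable Pr : probability Om R.
Local Notation kappa := (normal_var R).
Variables (SigV Sigq0 : 'M[R]_d) (W V : R -> Om -> 'cV[R]_d) (q0 : Om -> 'cV[R]_d).
Hypotheses (psdV : sym_psd SigV) (psdq : sym_psd Sigq0).
Hypothesis hn : noise Pr SigV Sigq0 W V q0.

(* [dp = alpha dt + Kw dw + Kv dv] for deterministic absolutely continuous
   Kw, Kv, with the two stochastic integrals removed by integration by parts. *)
Definition sde n (w v : R -> 'cV[R]_d) (p alpha : R -> 'cV[R]_n)
    (Kw Kw' Kv Kv' : R -> 'M[R]_(n, d)) : Prop :=
  acm T (fun t => p t - Kw t *m w t - Kv t *m v t)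
        (fun t => alpha t - Kw' t *m w t - Kv' t *m v t).

(** The product rule has no Ito correction because [L] is absolutely continuous. *)
Lemma sdeM n n' w v (p alpha : R -> 'cV[R]_n) Kw Kw' Kv Kv'
    (L L' : R -> 'M[R]_(n', n)) :
  acm T L L' -> sde w v p alpha Kw Kw' Kv Kv' ->
  sde w v (fun t => L t *m p t) (fun t => L' t *m p t + L t *m alpha t)
    (fun t => L t *m Kw t) (fun t => L' t *m Kw t + L t *m Kw' t)
    (fun t => L t *m Kv t) (fun t => L' t *m Kv t + L t *m Kv' t).
Proof.
move=> hL hp; apply: acm_ext (acmM hL hp) => t _.
  by rewrite !mulmxBr !mulmxA.
rewrite !mulmxBr !mulmxDl !mulmxA.
rewrite [in RHS]opprD [in RHS]opprD.
move: (L' t *m p t) (L' t *m Kw t *m w t) (L' t *m Kv t *m v t)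
  (L t *m alpha t) (L t *m Kw' t *m w t) (L t *m Kv' t *m v t) => x1 x2 x3 x4 x5 x6.
by apply/matrixP => i j; rewrite !mxE; ring.
Qed.

Variables (A : R -> 'M[R]_m) (c : R -> 'cV[R]_m).
Variables (Gw Gw' Gv Gv' : R -> 'M[R]_(m, d)) (Z0 : 'M[R]_(m, d)) (zeta0 : 'cV[R]_m).
Hypotheses (bA : bmm T A) (bc : bmm T c).
Hypotheses (acGw : acm T Gw Gw') (acGv : acm T Gv Gv').
Variable z : R -> Om -> 'cV[R]_m.
Hypothesis mz : forall t i, 0 <= t <= T -> measurable_fun setT (fun w => z t w i 0).
Hypothesis hz : {ae Pr, forall w, z 0 w = zeta0 + Z0 *m q0 w /\
  sde (W ^~ w) (V ^~ w) (z ^~ w) (fun t => A t *m z t w + c t) Gw Gw' Gv Gv'}.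

(** Variation of constants: multiplying by the inverse fundamental matrix removes [A] and leaves a
    deterministic term plus Wiener integrals. Mean and covariance are returned through their
    differential equations, since later they are identified by uniqueness. *)
Theorem linear_sde_moments : exists (mu : R -> 'cV[R]_m) (C : R -> 'M[R]_m),
  [/\ mu 0 = zeta0 /\ acm T mu (fun t => A t *m mu t + c t),
      C 0 = kappa *: (Z0 *m Sigq0 *m Z0^T) /\
      acm T C (fun t => A t *m C t + C t *m (A t)^T +
        kappa *: (Gw t *m (Gw t)^T + Gv t *m SigV *m (Gv t)^T)) &
      forall t, 0 <= t <= T ->
        [/\ forall l : 'rV[R]_m, L2 Pr (fun w => (l *m z t w) 0 0),
            forall l : 'rV[R]_m, EE Pr (fun w => (l *m z t w) 0 0) = (l *m mu t) 0 0 &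
            forall l k : 'rV[R]_m,
              EE Pr (fun w => ((l *m z t w) 0 0 - (l *m mu t) 0 0)
                 * ((k *m z t w) 0 0 - (k *m mu t) 0 0)) = (l *m C t *m k^T) 0 0]].
Proof.
have [Phi [Psi [Phi0 Psi0 acPhi acPsi inv]]] := fundamental_matrix T_gt0 bA.
have bPhi := acm_bmm acPhi; have bPsi := acm_bmm acPsi.
pose mu t := Phi t *m (zeta0 + integral_mx 0 t (fun s => Psi s *m c s)).
pose G s := Gw s *m (Gw s)^T + Gv s *m SigV *m (Gv s)^T.
have bG : bmm T G.
  apply: bmmD; first exact: bmmM (acm_bmm acGw) (bmm_tr (acm_bmm acGw)).
  exact: bmmM (bmmM (acm_bmm acGv) (bmm_cst _ _)) (bmm_tr (acm_bmm acGv)).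
pose D t := Z0 *m Sigq0 *m Z0^T + integral_mx 0 t (fun s => Psi s *m G s *m (Psi s)^T).
pose C t := kappa *: (Phi t *m D t *m (Phi t)^T).
have bPG : bmm T (fun s => Psi s *m G s *m (Psi s)^T).
  by apply: bmmM; [exact: bmmM | exact: bmm_tr].
have acmu : acm T mu (fun t => A t *m mu t + c t).
  have h := acmD (acm_cst T zeta0) (acm_integral (bmmM bPsi bc)).
  apply: acm_ext (acmM acPhi h) => // t tT.
  by rewrite add0r [Phi t *m (Psi t *m c t)]mulmxA (inv t tT).1 mul1mx /mu mulmxA.
have acC : acm T C (fun t => A t *m C t + C t *m (A t)^T + kappa *: G t).
  have h := acmD (acm_cst T (Z0 *m Sigq0 *m Z0^T)) (acm_integral bPG).
  have h2 := acmMl kappa%:M (acmM (acmM acPhi h) (acm_tr acPhi)).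
  apply: acm_ext h2 => t tT; rewrite mul_scalar_mx //.
  have e1 : Phi t *m (0 + Psi t *m G t *m (Psi t)^T) *m (Phi t)^T = G t.
    rewrite add0r !mulmxA (inv t tT).1 mul1mx -mulmxA -trmx_mul (inv t tT).1.
    by rewrite trmx1 mulmx1.
  rewrite mulmxDl e1 trmx_mul /C -/(D t) -scalemxAr -scalemxAl !mulmxA !scalerDr.
  by rewrite addrAC.
have mu0 : mu 0 = zeta0 by rewrite /mu Phi0 integral_mx0 addr0 mul1mx.
have C0 : C 0 = kappa *: (Z0 *m Sigq0 *m Z0^T).
  by rewrite /C /D Phi0 integral_mx0 addr0 mul1mx trmx1 mulmx1.
exists mu, C; split=> // t tT.
have /andP[t0 tT'] := tT.
pose X (l : 'rV[R]_m) w := (l *m z t w) 0 0 - (l *m mu t) 0 0.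
have mlz (l : 'rV[R]_m) : measurable_fun setT (fun w => (l *m z t w) 0 0).
  rewrite (_ : (fun w => _) = fun w => \sum_j l 0 j * z t w j 0).
    by apply: measurable_sum => j; apply: measurable_funM => //; exact: mz.
  by apply/funext => w; rewrite mxE.
have Xmom (l : 'rV[R]_m) : [/\ L2 Pr (X l), EE Pr (X l) = 0 &
    EE Pr (fun w => X l w ^+ 2) = (l *m C t *m l^T) 0 0].
  (* The time t is frozen in [th], so that the kernels below depend on s alone. *)
  pose th := l *m Phi t.
  pose k s := th *m (Psi s *m Gw s).
  pose k' s := th *m (- (Psi s *m A s) *m Gw s + Psi s *m Gw' s).
  pose q s := th *m (Psi s *m Gv s).
  pose q' s := th *m (- (Psi s *m A s) *m Gv s + Psi s *m Gv' s).
  have ack : acm T k k' := acmMl th (acmM acPsi acGw).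
  have acq : acm T q q' := acmMl th (acmM acPsi acGv).
  have mX : measurable_fun setT (X l).
    by apply: measurable_funB => //; exact: measurable_cst.
  have [[_ aeW _ _] [_ aeV _ _] _ _] := hn.
  have aeX : {ae Pr, forall w, X l w = (th *m Z0 *m q0 w
     + (k t *m W t w - integral_mx 0 t (fun s => k' s *m W s w))
     + (q t *m V t w - integral_mx 0 t (fun s => q' s *m V s w))) 0 0}.
    apply: filterS2 hz (filterI aeW aeV) => w [z0 hs] [[W0 cW] [V0 cV]].
    have hp := acmMl th (sdeM acPsi hs).
    have bW : bmm T (W ^~ w) := continuous_mx_bmm (cW T).
    have bV : bmm T (V ^~ w) := continuous_mx_bmm (cV T).
    have h1 := acm_integral (bmmM (acm_bmm' ack) bW).
    have h2 := acm_integral (bmmM (acm_bmm' acq) bV).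
    have h3 := acmMl th (acm_integral (bmmM bPsi bc)).
    have h4 := acmB (acmD (acmD hp h1) h2) h3.
    (* This combination has zero derivative, so it keeps its initial value
       [th *m (zeta0 + Z0 *m q0 w)]. *)
    have h5 : acm T (fun s => th *m (Psi s *m z s w - Psi s *m Gw s *m W s w
        - Psi s *m Gv s *m V s w)
      + integral_mx 0 s (fun s => k' s *m W s w) + integral_mx 0 s (fun s => q' s *m V s w)
      - th *m integral_mx 0 s (fun s => Psi s *m c s)) (fun=> 0).
      apply: acm_ext h4 => // s _.
      rewrite /k' /q' -[th *m _ *m W s w]mulmxA -[th *m _ *m V s w]mulmxA.
      rewrite -!mulmxDr -mulmxBr -[RHS](mulmx0 _ th); congr (th *m _).
      rewrite mulmxDr mulNmx !mulmxA.
      by apply/matrixP => i j; rewrite !mxE; ring.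
    have := acm_eq0 h5 tT; rewrite !integral_mx0 mulmx0 subr0 !addr0.
    rewrite Psi0 !mul1mx W0 V0 !mulmx0 !subr0 z0 => h6.
    have zt : l *m z t w = th *m (Psi t *m z t w).
      by rewrite /th -mulmxA (mulmxA (Phi t)) (inv t tT).1 mul1mx.
    have mut : l *m mu t = th *m (zeta0 + integral_mx 0 t (fun s => Psi s *m c s)).
      by rewrite /mu /th mulmxA.
    rewrite /X zt mut /k /q.
    have -> : th *m (Psi t *m z t w) = th *m (zeta0 + Z0 *m q0 w) +
       th *m integral_mx 0 t (fun s => Psi s *m c s)
       - integral_mx 0 t (fun s => q' s *m V s w)
       - integral_mx 0 t (fun s => k' s *m W s w)
       + th *m (Psi t *m Gw t) *m W t w + th *m (Psi t *m Gv t) *m V t w.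
      rewrite -h6 !mulmxBr -!mulmxA.
      by apply/matrixP => i j; rewrite !mxE; ring.
    by rewrite !mulmxDr -!mulmxA !mxE; ring.
  have [h1 h2 h3] := noise_integral_moments psdV psdq hn ack acq tT mX aeX.
  split=> //; rewrite h3.
  have -> : th *m Z0 *m Sigq0 *m (th *m Z0)^T + integral_mx 0 t
      (fun s => k s *m (k s)^T + q s *m SigV *m (q s)^T) = th *m D t *m th^T.
    rewrite /D mulmxDr mulmxDl trmx_mul !mulmxA; congr (_ + _).
    rewrite -(integral_mxMl _ bPG tT) -(integral_mxMr _ (bmmM (bmm_cst _ _) bPG) tT).
    apply: integral_mx_ext => s _.
    rewrite /k /q /G !trmx_mul !mulmxDr !mulmxDl !mulmxA mulmxDr !mulmxDl.
    by rewrite !mulmxA.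
  by rewrite /C -scalemxAr -scalemxAl [RHS]mxE /th trmx_mul !mulmxA.
have XE (l : 'rV[R]_m) : (fun w => (l *m z t w) 0 0) = (fun w => X l w + (l *m mu t) 0 0).
  by apply/funext => w; rewrite /X subrK.
have L2z (l : 'rV[R]_m) : L2 Pr (fun w => (l *m z t w) 0 0).
  by rewrite XE; apply: L2D; [have [] := Xmom l | exact: L2_cst].
split=> //.
  move=> l; rewrite XE; have [h1 h2 _] := Xmom l.
  by rewrite EED ?h2 ?EE_cst ?add0r //; [exact: L2_L1 | exact: L1_cst].
(* Polarisation: the variance of the form l + k, expanded with the symmetry of [C t], gives the
   mixed moment. *)
move=> l k; rewrite -[LHS]/(EE Pr (fun w => X l w * X k w)).
have [hl _ vl] := Xmom l; have [hk _ vk] := Xmom k; have [_ _ vlk] := Xmom (l + k).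
have XD w : X (l + k) w = X l w + X k w by rewrite /X !mulmxDl !mxE; ring.
have symC : (C t)^T = C t.
  have symG s : (G s)^T = G s.
    by rewrite /G linearD /= !trmx_mul !trmxK !mulmxA (proj1 psdV).
  have symD : (D t)^T = D t.
    rewrite /D linearD /= !trmx_mul trmxK (proj1 psdq) mulmxA; congr (_ + _).
    apply/matrixP => i j; rewrite !mxE; apply: eq_Rintegral => s _.
    by rewrite -[in RHS](trmxK (_ *m _)) [in RHS]mxE !trmx_mul trmxK symG mulmxA.
  by rewrite /C linearZ /= !trmx_mul trmxK symD mulmxA.
have sw : (k *m C t *m l^T) 0 0 = (l *m C t *m k^T) 0 0.
  have -> : l *m C t *m k^T = (k *m C t *m l^T)^T.
    by rewrite !trmx_mul trmxK symC mulmxA.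
  by rewrite [RHS]mxE.
move: vlk; under eq_fun do rewrite XD.
rewrite (_ : (fun w => _) = (fun w => X l w ^+ 2 + (2 * (X l w * X k w) + X k w ^+ 2))).
  rewrite EED; [|exact: hl.2|by apply: L1D; [apply: L1Z; exact: L2M_L1|exact: hk.2]].
  rewrite EED; [|by apply: L1Z; exact: L2M_L1|exact: hk.2].
  rewrite EEZ; last exact: L2M_L1.
  have addE (M N : 'M[R]_1) : (M + N) 0 0 = M 0 0 + N 0 0 by rewrite mxE.
  by rewrite vl vk linearD /= !mulmxDl !mulmxDr !addE sw; lra.
by apply/funext => w; ring.
Qed.

End LinearSDE.

(** * The Riccati equations *)

Section RiccatiBlocks.
Variables (R : realType) (d : nat) (T : R).
Hypothesis T_gt0 : 0 < T.

Lemma acm_ulsub (F F' : R -> 'M[R]_(d + d)) : acm T F F' ->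
  acm T (fun t => ulsubmx (F t)) (fun t => ulsubmx (F' t)).
Proof. by move=> h i j; apply: ac_ext (h (lshift d i) (lshift d j)) => t _; rewrite !mxE. Qed.

Lemma acm_ursub (F F' : R -> 'M[R]_(d + d)) : acm T F F' ->
  acm T (fun t => ursubmx (F t)) (fun t => ursubmx (F' t)).
Proof. by move=> h i j; apply: ac_ext (h (lshift d i) (rshift d j)) => t _; rewrite !mxE. Qed.

Lemma acm_drsub (F F' : R -> 'M[R]_(d + d)) : acm T F F' ->
  acm T (fun t => drsubmx (F t)) (fun t => drsubmx (F' t)).
Proof. by move=> h i j; apply: ac_ext (h (rshift d i) (rshift d j)) => t _; rewrite !mxE. Qed.

Lemma sym_block (A : 'M[R]_(d + d)) : A^T = A ->
  [/\ (ulsubmx A)^T = ulsubmx A, (ursubmx A)^T = dlsubmx A & (drsubmx A)^T = drsubmx A].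
Proof.
by move=> h; rewrite trmx_ulsub trmx_ursub trmx_drsub h.
Qed.

Section Filter.
Variables (SigV Sigq0 Sig : 'M[R]_d) (P : R -> 'M[R]_(d + d)).
Hypothesis hP : filter_riccati T SigV Sigq0 Sig P.
Let J := invmx SigV.
Let P11 t : 'M[R]_d := ulsubmx (P t).
Let P12 t : 'M[R]_d := ursubmx (P t).
Let P22 t : 'M[R]_d := drsubmx (P t).

Lemma filter_blocks :
  [/\ forall t, 0 <= t <= T -> (P11 t)^T = P11 t /\ (P22 t)^T = P22 t,
      [/\ P11 0 = Sigq0, P12 0 = 0 & P22 0 = Sig],
      acm T P11 (fun t => (P12 t)^T + P12 t - P11 t *m J *m P11 t + 1%:M),
      acm T P12 (fun t => P22 t - P11 t *m J *m P12 t) &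
      acm T P22 (fun t => - ((P12 t)^T *m J *m P12 t))].
Proof.
have [symP P0 hode] := hP.
have cP : continuous_mx T P by case: hode.
have cr : continuous_mx T (fun t => Fmx R d *m P t + P t *m (Fmx R d)^T
     - P t *m (Hmx R d)^T *m invmx SigV *m Hmx R d *m P t + Gmx R d *m SigW *m (Gmx R d)^T).
  apply: continuous_mxD; last exact: continuous_mx_cst.
  apply: continuous_mxD; last apply: continuous_mxN.
    apply: continuous_mxD; apply: continuous_mxM => //; exact: continuous_mx_cst.
  apply: continuous_mxM => //; do 3 (apply: continuous_mxM; last exact: continuous_mx_cst).
  exact: cP.
have acP := solves_ode_acm T_gt0 cr hode.
have symb t : 0 <= t <= T -> [/\ (P11 t)^T = P11 t, (P12 t)^T = dlsubmx (P t) & (P22 t)^T = P22 t].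
  by move=> tT; apply: sym_block; apply: symP; rewrite in_itv.
have rhsE t : 0 <= t <= T -> Fmx R d *m P t + P t *m (Fmx R d)^T
     - P t *m (Hmx R d)^T *m invmx SigV *m Hmx R d *m P t + Gmx R d *m SigW *m (Gmx R d)^T
   = block_mx ((P12 t)^T + P12 t - P11 t *m J *m P11 t + 1%:M)
       (P22 t - P11 t *m J *m P12 t)
       ((P22 t)^T - (P12 t)^T *m J *m P11 t) (- ((P12 t)^T *m J *m P12 t)).
  move=> tT; have [_ s2 s3] := symb t tT.
  rewrite -{1 2 3 4}[P t]submxK -/(P11 t) -/(P12 t) -/(P22 t) -s2.
  rewrite /Fmx /Hmx /Gmx /Bmx tr_block_mx tr_row_mx tr_col_mx !trmx0 !trmx1.
  rewrite /SigW !(mulmx_block, mul_block_col) !(mul0mx, mulmx0, mul1mx, mulmx1, add0r, addr0).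
  rewrite mul_col_mx !mul_col_row !(mul0mx, mulmx0, mul1mx, mulmx1).
  rewrite mulmx_block !(mul0mx, mulmx0, mul1mx, mulmx1, add0r, addr0).
  by rewrite !add_block_mx opp_block_mx !add_block_mx !(add0r, addr0) s3.
split.
- by move=> t /symb[].
- by rewrite /P11 /P12 /P22 P0 block_mxKul block_mxKur block_mxKdr.
- apply: acm_ext (acm_ulsub acP) => // t tT; by rewrite rhsE // block_mxKul.
- apply: acm_ext (acm_ursub acP) => // t tT; by rewrite rhsE // block_mxKur.
- apply: acm_ext (acm_drsub acP) => // t tT; by rewrite rhsE // block_mxKdr.
Qed.

End Filter.

Section Control.
Variables (Q Rc : 'M[R]_d) (S : R -> 'M[R]_(d + d)).
Hypothesis hS : control_riccati T Q Rc S.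
Let Ri := invmx Rc.
Let S11 t : 'M[R]_d := ulsubmx (S t).
Let S12 t : 'M[R]_d := ursubmx (S t).
Let S22 t : 'M[R]_d := drsubmx (S t).

Lemma control_blocks :
  [/\ forall t, 0 <= t <= T -> (S11 t)^T = S11 t,
      [/\ S11 T = 0, S12 T = 0 & S22 T = 0],
      acm T S11 (fun t => S11 t *m Ri *m S11 t - Q),
      acm T S12 (fun t => S11 t *m Ri *m S12 t - S11 t) &
      acm T S22 (fun t => (S12 t)^T *m Ri *m S12 t - (S12 t)^T - S12 t)].
Proof.
have [symS ST hode] := hS.
have cS : continuous_mx T S by case: hode.
have cr : continuous_mx T (fun t => - (S t *m Fmx R d + (Fmx R d)^T *m S t + Qtilde Q
     - S t *m Bmx R d *m invmx Rc *m (Bmx R d)^T *m S t)).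
  apply: continuous_mxN; apply: continuous_mxD; last apply: continuous_mxN.
    apply: continuous_mxD; last exact: continuous_mx_cst.
    by apply: continuous_mxD; apply: continuous_mxM => //; exact: continuous_mx_cst.
  apply: continuous_mxM => //; do 3 (apply: continuous_mxM; last exact: continuous_mx_cst).
  exact: cS.
have acS := @solves_ode_acm _ _ T_gt0 _ _ (fun s => - (s *m Fmx R d + (Fmx R d)^T *m s
  + Qtilde Q - s *m Bmx R d *m invmx Rc *m (Bmx R d)^T *m s)) S cr hode.
have symb t : 0 <= t <= T -> [/\ (S11 t)^T = S11 t, (S12 t)^T = dlsubmx (S t) & (S22 t)^T = S22 t].
  by move=> tT; apply: sym_block; apply: symS; rewrite in_itv.
have rhsE t : 0 <= t <= T -> - (S t *m Fmx R d + (Fmx R d)^T *m S t + Qtilde Q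
     - S t *m Bmx R d *m invmx Rc *m (Bmx R d)^T *m S t)
   = block_mx (S11 t *m Ri *m S11 t - Q) (S11 t *m Ri *m S12 t - S11 t)
       ((S12 t)^T *m Ri *m S11 t - S11 t)
       ((S12 t)^T *m Ri *m S12 t - (S12 t)^T - S12 t).
  move=> tT; have [_ s2 s3] := symb t tT.
  rewrite -{1 2 3 4}[S t]submxK -/(S11 t) -/(S12 t) -/(S22 t) -s2.
  rewrite /Fmx /Bmx /Qtilde tr_block_mx tr_col_mx !trmx0 !trmx1.
  rewrite !(mulmx_block, mul_block_col) !(mul0mx, mulmx0, mul1mx, mulmx1, add0r, addr0).
  rewrite mul_col_mx !mul_col_row !(mul0mx, mulmx0, mul1mx, mulmx1).
  rewrite mulmx_block !(mul0mx, mulmx0, mul1mx, mulmx1, add0r, addr0).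
  rewrite !(add_block_mx, opp_block_mx) !(add0r, addr0, opprB, opprD, opprK).
  by congr block_mx; apply/matrixP => i j; rewrite !mxE; ring.
split.
- by move=> t /symb[].
- by rewrite /S11 /S12 /S22 ST; split; apply/matrixP => i j; rewrite !mxE.
- apply: acm_ext (acm_ulsub acS) => // t tT; by rewrite rhsE // block_mxKul.
- apply: acm_ext (acm_ursub acS) => // t tT; by rewrite rhsE // block_mxKur.
- apply: acm_ext (acm_drsub acS) => // t tT; by rewrite rhsE // block_mxKdr.
Qed.

End Control.

(** The equation is stated with p^T J p, which is symmetric for any [p]; hence p^T - p is constant
    and vanishes at 0. Only then does the equation take the form with p J p. *)
Lemma known_filter_acm (SigV Sigq0 : 'M[R]_d) (p : R -> 'M[R]_d) :
  SigV^T = SigV -> Sigq0^T = Sigq0 -> known_filter_riccati T SigV Sigq0 p ->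
  [/\ p 0 = Sigq0, forall t, 0 <= t <= T -> (p t)^T = p t &
      acm T p (fun t => 1%:M - p t *m invmx SigV *m p t)].
Proof.
move=> symV symq [p0 hode].
have cp : continuous_mx T p by case: hode.
have cr : continuous_mx T (fun t => - ((p t)^T *m invmx SigV *m p t) + SigW).
  apply: continuous_mxD; last exact: continuous_mx_cst.
  apply: continuous_mxN; apply: continuous_mxM => //.
  by apply: continuous_mxM; [exact: continuous_mx_tr | exact: continuous_mx_cst].
have acp := solves_ode_acm T_gt0 cr hode.
have symJ : (invmx SigV)^T = invmx SigV by rewrite trmx_inv symV.
have symp t : 0 <= t <= T -> (p t)^T = p t.
  move=> tT.
  have h : acm T (fun t => (p t)^T - p t) (fun=> 0).
    apply: acm_ext (acmB (acm_tr acp) acp) => // s _.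
    rewrite linearD linearN /= !trmx_mul trmxK symJ mulmxA /SigW trmx1.
    exact: subrr.
  by have := acm_eq0 h tT; rewrite p0 symq subrr => /eqP; rewrite subr_eq0 => /eqP.
split=> //; apply: acm_ext acp => // t tT.
by rewrite symp // /SigW addrC.
Qed.

End RiccatiBlocks.

Lemma mxDE (R : nzRingType) m n (A B : 'M[R]_(m, n)) i j : (A + B) i j = A i j + B i j.
Proof. by rewrite mxE. Qed.
Lemma mxNE (R : nzRingType) m n (A : 'M[R]_(m, n)) i j : (- A) i j = - A i j.
Proof. by rewrite mxE. Qed.
Lemma mxZE (R : nzRingType) m n c (A : 'M[R]_(m, n)) i j : (c *: A) i j = c * A i j.
Proof. by rewrite mxE. Qed.
Lemma mx0E (R : nzRingType) m n i j : (0 : 'M[R]_(m, n)) i j = 0.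
Proof. by rewrite mxE. Qed.

(* Noncommutative ring identities between matrix products: after distributing,
   the products are atoms of the commutative [ring]. *)
Ltac mx_ring :=
  rewrite ?(mulmxBl, mulmxBr, mulmxDl, mulmxDr, mul1mx, mulmx1, mulmxA, mulmxN, mulNmx,
            mul0mx, mulmx0, =^~ scalemxAl, =^~ scalemxAr);
  let i := fresh "i" in let j := fresh "j" in
  apply/matrixP => i j; rewrite ?(mxDE, mxNE, mxZE, mx0E); ring.

(** * The Bayesian filter in closed form *)

Section FilterStructure.
Variables (R : realType) (d : nat) (T : R).
Hypothesis T_gt0 : 0 < T.
Variables (J : 'M[R]_d) (p : R -> 'M[R]_d).
Hypothesis symJ : J^T = J.
Hypothesis acp : acm T p (fun t => 1%:M - p t *m J *m p t).

(* [U t] is the bias of the drift-free filter per unit of unmodelled drift; the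
   Bayesian gains are rational functions of [U], of the drift-aware filter [p] and
   of the Fisher information of the drift carried by the observations. *)
Lemma bias_exists : exists2 U : R -> 'M[R]_d,
  U 0 = 0 & acm T U (fun t => 1%:M - p t *m J *m U t).
Proof.
have bA : bmm T (fun t => - (p t *m J)).
  by apply: bmmN; apply: bmmM; [exact: acm_bmm acp | exact: bmm_cst].
have [Phi [Psi [Phi0 Psi0 acPhi acPsi inv]]] := fundamental_matrix T_gt0 bA.
exists (fun t => Phi t *m integral_mx 0 t Psi).
  by rewrite integral_mx0 mulmx0.
apply: acm_ext (acmM acPhi (acm_integral (acm_bmm acPsi))) => // t tT.
by rewrite (inv t tT).1 !mulNmx addrC !mulmxA.
Qed.

Variable U : R -> 'M[R]_d.
Hypothesis U0 : U 0 = 0.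
Hypothesis acU : acm T U (fun t => 1%:M - p t *m J *m U t).

Definition fisher (t : R) : 'M[R]_d := integral_mx 0 t (fun s => (U s)^T *m J *m U s).

Lemma bmm_info : bmm T (fun s => (U s)^T *m J *m U s).
Proof.
have bU := acm_bmm acU.
by apply: bmmM => //; apply: bmmM; [exact: bmm_tr | exact: bmm_cst].
Qed.

Lemma acm_fisher : acm T fisher (fun s => (U s)^T *m J *m U s).
Proof. exact: acm_integral bmm_info. Qed.

Section Bayes.
Variables (Sig : 'M[R]_d) (P11 P12 P22 : R -> 'M[R]_d).
Hypothesis symP22 : forall t, 0 <= t <= T -> (P22 t)^T = P22 t.
Hypotheses (P110 : P11 0 = p 0) (P120 : P12 0 = 0) (P220 : P22 0 = Sig).
Hypothesis acP11 : acm T P11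
  (fun t => (P12 t)^T + P12 t - P11 t *m J *m P11 t + 1%:M).
Hypothesis acP12 : acm T P12 (fun t => P22 t - P11 t *m J *m P12 t).
Hypothesis acP22 : acm T P22 (fun t => - ((P12 t)^T *m J *m P12 t)).
Hypothesis symP11 : forall t, 0 <= t <= T -> (P11 t)^T = P11 t.

(** The defects of the two identities satisfy a homogeneous linear system, with coefficients built
    from the given [P11], [P12] and [p], and start at zero. *)
Lemma filter_structure t : 0 <= t <= T ->
  P12 t = U t *m P22 t /\ P11 t = p t + U t *m P22 t *m (U t)^T.
Proof.
(* With P12^T in place of P22 U^T the quadratic terms combine into - D1 J P11 - p J D1, so the
   system is linear in D1 and D2; P12^T is replaced at the end, once D2 = 0 is known. *)
pose D1 t := P11 t - p t - U t *m (P12 t)^T.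
pose D2 t := P12 t - U t *m P22 t.
pose L1 s (D : 'M[R]_(d, d + d)) : 'M[R]_d :=
  rsubmx D - lsubmx D *m (J *m P11 s) - (p s *m J) *m lsubmx D.
pose L2 s (D : 'M[R]_(d, d + d)) : 'M[R]_d :=
  - (lsubmx D *m (J *m P12 s)) - (p s *m J) *m rsubmx D.
have acD1 : acm T D1 (fun s => L1 s (row_mx (D1 s) (D2 s))).
  apply: acm_ext (acmB (acmB acP11 acp) (acmM acU (acm_tr acP12))) => // s sT.
  rewrite /L1 row_mxKl row_mxKr /D1 /D2.
  rewrite [(P22 s - _)^T]linearB /= !trmx_mul symP22 // symJ symP11 //.
  by mx_ring.
have acD2 : acm T D2 (fun s => L2 s (row_mx (D1 s) (D2 s))).
  apply: acm_ext (acmB acP12 (acmM acU acP22)) => // s sT.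
  rewrite /L2 row_mxKl row_mxKr /D1 /D2.
  by mx_ring.
have bJ : bmm T (fun=> J) := bmm_cst T J.
have bL : lin_bdd T (fun s D => row_mx (L1 s D) (L2 s D)).
  have [[b1 b2] b3] := (acm_bmm acP11, acm_bmm acP12, acm_bmm acp).
  apply: (lin_bdd_row (L1 := L1) (L2 := L2)).
    apply: lin_bddD; last apply: lin_bddN.
      apply: lin_bddD; first exact: lin_bdd_rsub.
      apply: lin_bddN; apply: (lin_bddMr (A := fun s => J *m P11 s)); last exact: lin_bdd_lsub.
      exact: bmmM.
    apply: (lin_bddMl (A := fun s => p s *m J)); last exact: lin_bdd_lsub.
    exact: bmmM.
  apply: lin_bddD; apply: lin_bddN.
    apply: (lin_bddMr (A := fun s => J *m P12 s)); last exact: lin_bdd_lsub.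
    exact: bmmM.
  apply: (lin_bddMl (A := fun s => p s *m J)); last exact: lin_bdd_rsub.
  exact: bmmM.
move=> tT.
have := linear_mx_uniq T_gt0 (acm_row acD1 acD2) _ bL _ tT.
rewrite /D1 /D2 P110 P120 U0 !mul0mx !subrr ?subr0 row_mx0.
move=> /(_ erefl (fun s _ => erefl)) h.
have h1 : D1 t = 0.
  by rewrite -[D1 t](row_mxKl _ (D2 t)) h; apply/matrixP => i j; rewrite !mxE.
have h2 : D2 t = 0.
  by rewrite -[D2 t](row_mxKr (D1 t)) h; apply/matrixP => i j; rewrite !mxE.
move/eqP : h2; rewrite subr_eq0 => /eqP h2; split => //.
move/eqP : h1; rewrite subr_eq0 => /eqP h1.
by rewrite -(subrK (p t) (P11 t)) h1 h2 trmx_mul symP22 // mulmxA addrC.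
Qed.

Lemma acm_P22 : acm T P22 (fun t => - (P22 t *m ((U t)^T *m J *m U t) *m P22 t)).
Proof.
apply: acm_ext acP22 => // t tT; have [-> _] := filter_structure tT.
by rewrite trmx_mul symP22 // !mulmxA.
Qed.

End Bayes.

Section Gain.
Variables (r : R) (P22 : R -> 'M[R]_d).
Hypothesis r0 : r != 0.
Hypothesis P220 : P22 0 = r%:M.
Hypothesis acP22 : acm T P22 (fun t => - (P22 t *m ((U t)^T *m J *m U t) *m P22 t)).

(** With N the derivative of [fisher], the defect D of this identity satisfies D' = - P22 N D and D
    0 = 0. Invertibility of the information matrix comes with it, with no appeal to positivity. *)
Lemma gain_inverse t : 0 <= t <= T -> P22 t *m (r^-1%:M + fisher t) = 1%:M.
Proof.
move=> tT; apply/eqP; rewrite -subr_eq0; apply/eqP.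
have acL := acmD (acm_cst T (r^-1%:M : 'M[R]_d)) acm_fisher.
have acD := acmB (acmM acP22 acL) (acm_cst T (1%:M : 'M[R]_d)).
have bL : lin_bdd T (fun s (D : 'M[R]_d) => - ((P22 s *m ((U s)^T *m J *m U s)) *m D)).
  apply: lin_bddN; apply: (lin_bddMl (A := fun s => P22 s *m ((U s)^T *m J *m U s))).
    by apply: bmmM; [exact: acm_bmm acP22 | exact: bmm_info].
  exact: lin_bdd_id.
apply: (linear_mx_uniq T_gt0 acD _ bL _ tT).
  by rewrite P220 /fisher integral_mx0 addr0 -scalar_mxM divff // subrr.
move=> s sT; rewrite subr0 add0r mulNmx mulmxBr mulmx1 opprB addrC.
by rewrite !mulmxA.
Qed.

End Gain.

End FilterStructure.

(** * The closed loop *)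

Section Selectors.
Variables (R : realType) (d : nat).

Definition sel1 : 'M[R]_(d, d + (d + d)) := row_mx 1%:M 0.
Definition sel2 : 'M[R]_(d, d + (d + d)) := row_mx 0 (row_mx 1%:M 0).
Definition sel3 : 'M[R]_(d, d + (d + d)) := row_mx 0 (row_mx 0 1%:M).

Lemma selE : (sel1 *m sel1^T = 1%:M) * (sel1 *m sel2^T = 0) * (sel1 *m sel3^T = 0)
  * (sel2 *m sel1^T = 0) * (sel2 *m sel2^T = 1%:M) * (sel2 *m sel3^T = 0)
  * (sel3 *m sel1^T = 0) * (sel3 *m sel2^T = 0) * (sel3 *m sel3^T = 1%:M).
Proof.
by rewrite /sel1 /sel2 /sel3 !(tr_row_mx, trmx0, trmx1, mul_row_col, mul0mx, mulmx0,
  mul1mx, add0r, addr0).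
Qed.

End Selectors.

Section Core.
Variables (R : realType) (d : nat) (T : R).
Hypothesis T_gt0 : 0 < T.
Context (disp : measure_display) (Om : measurableType disp).
Variable Pr : probability Om R.
Local Notation kappa := (normal_var R).
Variables (SigV Sigq0 : 'M[R]_d) (W V : R -> Om -> 'cV[R]_d) (q0 : Om -> 'cV[R]_d).
Hypotheses (psdV : sym_psd SigV) (psdq : sym_psd Sigq0).
Hypothesis hn : noise Pr SigV Sigq0 W V q0.
Variable J : 'M[R]_d.
Hypotheses (symJ : J^T = J) (JV : J *m SigV = 1%:M).
Variables (p U P2 : R -> 'M[R]_d).
Hypotheses (p0 : p 0 = Sigq0) (symp : forall t, 0 <= t <= T -> (p t)^T = p t).
Hypothesis acp : acm T p (fun t => 1%:M - p t *m J *m p t).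
Variables (U' P2' : R -> 'M[R]_d).
Hypotheses (acU : acm T U U') (acP2 : acm T P2 P2').
Hypothesis symP2 : forall t, 0 <= t <= T -> (P2 t)^T = P2 t.
Variables (HS HB : R -> 'M[R]_d) (c3 : R -> 'cV[R]_d) (b0 : 'cV[R]_d).
Hypotheses (bHS : bmm T HS) (bHB : bmm T HB) (bc3 : bmm T c3).
Let K t := p t *m J.
Let K2 t := P2 t *m (U t)^T *m J.
Let K' t := (1%:M - p t *m J *m p t) *m J.
Let K2' t := (P2' t *m (U t)^T + P2 t *m (U' t)^T) *m J.
Variables (e b x : R -> Om -> 'cV[R]_d).
Hypothesis me : forall t i, 0 <= t <= T -> measurable_fun setT (fun w => e t w i 0).
Hypothesis mb : forall t i, 0 <= t <= T -> measurable_fun setT (fun w => b t w i 0).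
Hypothesis mx : forall t i, 0 <= t <= T -> measurable_fun setT (fun w => x t w i 0).

(* The closed loop decouples in these coordinates: [e] is the estimation error of
   the filter that knows the drift, [b] the error on the drift, and [x] the sum of
   the state estimate and [U *m b]; [e] is uncorrelated with [b] and [x]. *)
Definition core_path (w v e b x : R -> 'cV[R]_d) (q : 'cV[R]_d) : Prop :=
  [/\ [/\ e 0 = q, b 0 = b0 & x 0 = 0],
      sde T w v e (fun t => - (K t *m e t)) (fun=> 1%:M) (fun=> 0)
        (fun t => - K t) (fun t => - K' t),
      sde T w v b (fun t => - (K2 t *m e t) - K2 t *m U t *m b t) (fun=> 0) (fun=> 0)
        (fun t => - K2 t) (fun t => - K2' t) &
      sde T w v x (fun t => K t *m e t + HB t *m b t - HS t *m x t + c3 t)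
        (fun=> 0) (fun=> 0) K K'].

Hypothesis hcore : {ae Pr, forall w,
  core_path (W ^~ w) (V ^~ w) (e ^~ w) (b ^~ w) (x ^~ w) (q0 w)}.

Local Notation s1 := (sel1 R d).
Local Notation s2 := (sel2 R d).
Local Notation s3 := (sel3 R d).

Definition stack t w : 'cV[R]_(d + (d + d)) :=
  s1^T *m e t w + s2^T *m b t w + s3^T *m x t w.

(** The covariance equation of the stacked vector is projected on its blocks. The Riccati equation
    of [p] is also the covariance equation of [e], up to the factor [kappa], and the cross blocks
    with [e] vanish; in the equations for [b] and [x] the error [e] then enters only through [p]. *)
Theorem core_moments :
  exists (mu : R -> 'cV[R]_(d + (d + d))) (C : R -> 'M[R]_(d + (d + d))),
  [/\ forall t, 0 <= t <= T -> s1 *m mu t = 0,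
      s2 *m mu 0 = b0 /\
      acm T (fun t => s2 *m mu t) (fun t => - (K2 t *m U t *m (s2 *m mu t))),
      s3 *m mu 0 = 0 /\
      acm T (fun t => s3 *m mu t)
        (fun t => HB t *m (s2 *m mu t) - HS t *m (s3 *m mu t) + c3 t),
      bmm T C &
  [/\ forall t, 0 <= t <= T -> s1 *m C t *m s1^T = kappa *: p t /\
        [/\ s1 *m C t *m s2^T = 0, s1 *m C t *m s3^T = 0,
            s2 *m C t *m s1^T = 0, s3 *m C t *m s1^T = 0 & (C t)^T = C t],
      s2 *m C 0 *m s2^T = 0 /\
      acm T (fun t => s2 *m C t *m s2^T)
       (fun t => - (K2 t *m U t *m (s2 *m C t *m s2^T))
                 - s2 *m C t *m s2^T *m (K2 t *m U t)^T + kappa *: (K2 t *m U t *m P2 t)),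
      s3 *m C 0 *m s3^T = 0 /\
      acm T (fun t => s3 *m C t *m s3^T)
       (fun t => HB t *m (s2 *m C t *m s3^T) - HS t *m (s3 *m C t *m s3^T)
         + s3 *m C t *m s2^T *m (HB t)^T - s3 *m C t *m s3^T *m (HS t)^T
         + kappa *: (p t *m J *m p t)) &
      forall t, 0 <= t <= T ->
        [/\ forall l : 'rV[R]__, L2 Pr (fun w => (l *m stack t w) 0 0),
            forall l : 'rV[R]__, EE Pr (fun w => (l *m stack t w) 0 0) = (l *m mu t) 0 0 &
            forall l k : 'rV[R]__,
              EE Pr (fun w => ((l *m stack t w) 0 0 - (l *m mu t) 0 0)
                 * ((k *m stack t w) 0 0 - (k *m mu t) 0 0)) = (l *m C t *m k^T) 0 0]]].
Proof.
pose A t := s1^T *m (- K t) *m s1 + s2^T *m (- K2 t *m s1 - K2 t *m U t *m s2)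
  + s3^T *m (K t *m s1 + HB t *m s2 - HS t *m s3).
pose Gv t := s1^T *m (- K t) + s2^T *m (- K2 t) + s3^T *m K t.
pose Gv' t := s1^T *m (- K' t) + s2^T *m (- K2' t) + s3^T *m K' t.
have acK : acm T K K' := acmMr J acp.
have acK2 : acm T K2 K2'.
  exact: (acmMr J (acmM acP2 (acm_tr acU))).
have bK := acm_bmm acK; have bK2 := acm_bmm acK2; have bU := acm_bmm acU.
have bK2U : bmm T (fun t => K2 t *m U t) := bmmM bK2 bU.
have bA : bmm T A.
  apply: bmmD; [apply: bmmD|].
  - by apply: bmmM; [apply: bmmM; [exact: bmm_cst|exact: bmmN]|exact: bmm_cst].
  - apply: bmmM; first exact: bmm_cst.
    by apply: bmmB; apply: bmmM; try exact: bmm_cst; [exact: bmmN|].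
  - apply: bmmM; first exact: bmm_cst.
    by apply: bmmB; [apply: bmmD|]; apply: bmmM => //; exact: bmm_cst.
have acGv : acm T Gv Gv'.
  apply: acmD; [apply: acmD|]; apply: acmMl => //; exact: acmN.
have acGw : acm T (fun=> s1^T) (fun=> 0 : 'M[R]_(d + (d + d), d)) := acm_cst T s1^T.
have bc : bmm T (fun t => s3^T *m c3 t) by apply: bmmM => //; exact: bmm_cst.
have mz t i : 0 <= t <= T -> measurable_fun setT (fun w => stack t w i 0).
  move=> tT; rewrite (_ : (fun w => _) = (fun w => \sum_j s1^T i j * e t w j 0
    + \sum_j s2^T i j * b t w j 0 + \sum_j s3^T i j * x t w j 0)).
    by apply: measurable_funD; [apply: measurable_funD|]; apply: measurable_sum => j;
      apply: measurable_funM => //; [exact: me|exact: mb|exact: mx].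
  by apply/funext => w; rewrite /stack mxE [X in X + _]mxE !mxE.
have hz : {ae Pr, forall w, stack 0 w = s2^T *m b0 + s1^T *m q0 w /\
  sde T (W ^~ w) (V ^~ w) (stack ^~ w) (fun t => A t *m stack t w + s3^T *m c3 t)
    (fun=> s1^T) (fun=> 0) Gv Gv'}.
  apply: filterS hcore => w [[e0 b00 x0] he hb hx]; split.
    by rewrite /stack e0 b00 x0 mulmx0 addr0 addrC.
  apply: acm_ext (acmD (acmD (acmMl s1^T he) (acmMl s2^T hb)) (acmMl s3^T hx)) => t tT.
    rewrite /stack /Gv; mx_ring.
  have -> : A t *m stack t w = s1^T *m (- (K t *m e t w))
     + s2^T *m (- (K2 t *m e t w) - K2 t *m U t *m b t w)
     + s3^T *m (K t *m e t w + HB t *m b t w - HS t *m x t w).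
    have h1 : s1 *m stack t w = e t w.
      by rewrite /stack !mulmxDr !mulmxA !selE !(mul0mx, mul1mx, add0r, addr0).
    have h2 : s2 *m stack t w = b t w.
      by rewrite /stack !mulmxDr !mulmxA !selE !(mul0mx, mul1mx, add0r, addr0).
    have h3 : s3 *m stack t w = x t w.
      by rewrite /stack !mulmxDr !mulmxA !selE !(mul0mx, mul1mx, add0r, addr0).
    rewrite /A !mulmxDl -!mulmxA !mulmxBl !mulmxDl -!mulmxA h1 h2 h3.
    by rewrite !mulNmx -!mulmxA ?h1.
  rewrite /Gv'; mx_ring.
have [mu [C [[mu0 acmu] [C0 acC] mom]]] :=
  linear_sde_moments T_gt0 psdV psdq hn bA bc acGw acGv mz hz.
have bC := acm_bmm acC.
have sA1 t : s1 *m A t = - (K t *m s1).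
  by rewrite /A !mulmxDr !mulmxA !selE !(mul0mx, mul1mx, addr0) mulNmx.
have sA2 t : s2 *m A t = - (K2 t *m s1) - K2 t *m U t *m s2.
  by rewrite /A !mulmxDr !mulmxA !selE !(mul0mx, mul1mx, addr0, add0r) !mulNmx.
have sA3 t : s3 *m A t = K t *m s1 + HB t *m s2 - HS t *m s3.
  by rewrite /A !mulmxDr !mulmxA !selE !(mul0mx, mul1mx, addr0, add0r).
have sG1 t : s1 *m Gv t = - K t.
  by rewrite /Gv !mulmxDr !mulmxA !selE !(mul0mx, mul1mx, addr0, add0r).
have sG2 t : s2 *m Gv t = - K2 t.
  by rewrite /Gv !mulmxDr !mulmxA !selE !(mul0mx, mul1mx, addr0, add0r).
have sG3 t : s3 *m Gv t = K t.
  by rewrite /Gv !mulmxDr !mulmxA !selE !(mul0mx, mul1mx, addr0, add0r).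
clearbody A Gv Gv'.
have acij (si sj : 'M[R]_(d, d + (d + d))) : acm T (fun t => si *m C t *m sj^T)
    (fun t => (si *m A t) *m C t *m sj^T + si *m C t *m (sj *m A t)^T
      + kappa *: ((si *m s1^T) *m (sj *m s1^T)^T
      + (si *m Gv t) *m SigV *m (sj *m Gv t)^T)).
  apply: acm_ext (acmMr sj^T (acmMl si acC)) => // t _.
  rewrite !mulmxDr !mulmxDl -scalemxAr -scalemxAl !trmx_mul !trmxK.
  by rewrite mulmxDr mulmxDl !mulmxA.
have Cij0 (si sj : 'M[R]_(d, d + (d + d))) : si *m C 0 *m sj^T =
    kappa *: ((si *m s1^T) *m Sigq0 *m (sj *m s1^T)^T).
  by rewrite C0 -scalemxAr -scalemxAl !trmx_mul !trmxK !mulmxA.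
have KT t : 0 <= t <= T -> (K t)^T = J *m p t.
  by move=> tT; rewrite /K trmx_mul symJ symp.
have K2T t : 0 <= t <= T -> (K2 t)^T = J *m U t *m P2 t.
  by move=> tT; rewrite /K2 !trmx_mul symJ trmxK symP2 // mulmxA.
have trB (M N : 'M[R]_(d, d + (d + d))) : (M - N)^T = M^T - N^T by rewrite linearB.
have trN (n : nat) (M : 'M[R]_(d, n)) : (- M)^T = - M^T by rewrite linearN.
have NK s : 0 <= s <= T -> (- K s)^T = - (J *m p s) by move=> sT; rewrite trN KT.
have NK2 s : 0 <= s <= T -> (- K2 s)^T = - (J *m (U s *m P2 s)).
  by move=> sT; rewrite trN K2T // mulmxA.
have sA1T s : 0 <= s <= T -> (s1 *m A s)^T = - (s1^T *m (J *m p s)).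
  by move=> sT; rewrite sA1 trN trmx_mul KT.
have sA2T s : 0 <= s <= T -> (s2 *m A s)^T =
    - (s1^T *m (J *m (U s *m P2 s))) - s2^T *m (K2 s *m U s)^T.
  by move=> sT; rewrite sA2 trB trN !(trmx_mul _ s1) !(trmx_mul _ s2) K2T // -(mulmxA J).
have sA3T s : 0 <= s <= T -> (s3 *m A s)^T =
    s1^T *m (J *m p s) + s2^T *m (HB s)^T - s3^T *m (HS s)^T.
  by move=> sT; rewrite sA3 trB linearD /= (trmx_mul _ s1) (trmx_mul _ s2) (trmx_mul _ s3) KT.
have KVK s (M : 'M[R]_d) : K s *m SigV *m (J *m M) = K s *m M.
  by rewrite /K -(mulmxA (p s) J SigV) JV mulmx1 !mulmxA.
have K2VK s (M : 'M[R]_d) : K2 s *m SigV *m (J *m M) = K2 s *m M.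
  by rewrite /K2 -(mulmxA _ J SigV) JV mulmx1 !mulmxA.
have C11 t : 0 <= t <= T -> s1 *m C t *m s1^T = kappa *: p t.
  move=> tT; apply/eqP; rewrite -subr_eq0; apply/eqP.
  have ac := acmB (acij s1 s1) (acmMl kappa%:M acp).
  have bL : lin_bdd T (fun t (D : 'M[R]_d) => - (K t *m D) - D *m (J *m p t)).
    apply: lin_bddD; apply: lin_bddN.
      by apply: (lin_bddMl (A := K)) => //; exact: lin_bdd_id.
    apply: (lin_bddMr (A := fun t => J *m p t)); last exact: lin_bdd_id.
    by apply: bmmM; [exact: bmm_cst | exact: acm_bmm acp].
  rewrite -mul_scalar_mx; apply: (linear_mx_uniq T_gt0 ac _ bL _ tT).
    by rewrite Cij0 !selE mul1mx trmx1 mulmx1 p0 mul_scalar_mx subrr.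
  move=> s sT; rewrite !mul_scalar_mx sA1T // sA1 sG1 NK // !selE trmx1 mulmx1.
  rewrite !(mulNmx, mulmxN, opprK) KVK /K; mx_ring.
(* Orthogonality of the filtering error: the source terms - C11 K2^T and kappa K SigV K2^T cancel
   because C11 = kappa p and J SigV = 1. The block with [x] is treated in the same way. *)
have C12 t : 0 <= t <= T -> s1 *m C t *m s2^T = 0.
  move=> tT; have bL : lin_bdd T (fun t (D : 'M[R]_d) => - (K t *m D) - D *m (K2 t *m U t)^T).
    apply: lin_bddD; apply: lin_bddN.
      by apply: (lin_bddMl (A := K)) => //; exact: lin_bdd_id.
    apply: (lin_bddMr (A := fun t => (K2 t *m U t)^T)); last exact: lin_bdd_id.
    exact: bmm_tr.
  apply: (linear_mx_uniq T_gt0 (acij s1 s2) _ bL _ tT).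
    by rewrite Cij0 !selE trmx0 mulmx0 scaler0.
  move=> s sT; rewrite sA2T // sA1 sG1 sG2 NK2 // !selE trmx0 mulmx0 add0r.
  rewrite !(mulmxBr, mulmxN, mulNmx, opprK) KVK !mulmxA C11 // /K.
  mx_ring.
have C13 t : 0 <= t <= T -> s1 *m C t *m s3^T = 0.
  move=> tT; have bL : lin_bdd T (fun t (D : 'M[R]_d) => - (K t *m D) - D *m (HS t)^T).
    apply: lin_bddD; apply: lin_bddN.
      by apply: (lin_bddMl (A := K)) => //; exact: lin_bdd_id.
    apply: (lin_bddMr (A := fun t => (HS t)^T)); last exact: lin_bdd_id.
    exact: bmm_tr.
  apply: (linear_mx_uniq T_gt0 (acij s1 s3) _ bL _ tT).
    by rewrite Cij0 !selE trmx0 mulmx0 scaler0.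
  move=> s sT; rewrite sA3T // sA1 sG1 sG3 KT // !selE trmx0 mulmx0 add0r.
  rewrite !(mulmxBr, mulmxDr, mulmxN, mulNmx, opprK) KVK !mulmxA C11 // C12 // mul0mx /K.
  mx_ring.
(* Read off from the moments, whose formula is symmetric in the two linear forms. *)
have symC t : 0 <= t <= T -> (C t)^T = C t.
  move=> tT; have [_ _ cov] := mom t tT.
  have ent i j : C t i j = ((delta_mx 0 i : 'rV_(d + (d + d))) *m C t *m (delta_mx 0 j : 'rV_(d + (d + d)))^T) 0 0.
    by rewrite -rowE trmx_delta -colE !mxE.
  apply/matrixP => i j; rewrite mxE !ent -!cov.
  by congr (EE Pr _); apply/funext => w; rewrite mulrC.
have trC t (si sj : 'M[R]_(d, d + (d + d))) : 0 <= t <= T ->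
    si *m C t *m sj^T = (sj *m C t *m si^T)^T.
  by move=> tT; rewrite !trmx_mul trmxK symC // mulmxA.
have mu1 t : 0 <= t <= T -> s1 *m mu t = 0.
  move=> tT; have bL : lin_bdd T (fun t (D : 'M[R]_(d, 1)) => - K t *m D).
    by apply: (lin_bddMl (A := fun t => - K t)); [exact: bmmN | exact: lin_bdd_id].
  apply: (linear_mx_uniq T_gt0 (acmMl s1 acmu) _ bL _ tT).
    by rewrite mu0 mulmxA selE mul0mx.
  by move=> s sT; rewrite mulmxDr !mulmxA selE mul0mx addr0 sA1 !mulNmx.
exists mu, C; split; first exact: mu1.
- split; first by rewrite mu0 mulmxA selE mul1mx.
  apply: acm_ext (acmMl s2 acmu) => // t tT.
  rewrite mulmxDr !mulmxA selE mul0mx addr0 sA2 mulmxBl mulNmx -!mulmxA mu1 //.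
  by rewrite !mulmx0 oppr0 add0r.
- split; first by rewrite mu0 mulmxA selE mul0mx.
  apply: acm_ext (acmMl s3 acmu) => // t tT.
  rewrite mulmxDr !mulmxA selE mul1mx sA3 mulmxBl mulmxDl -!mulmxA mu1 //.
  by rewrite !mulmx0 add0r.
- exact: bC.
- split.
  + move=> t tT; split; first exact: C11.
    split; [exact: C12 | exact: C13 | | | exact: symC].
      by rewrite trC // C12 // trmx0.
    by rewrite trC // C13 // trmx0.
  + split; first by rewrite Cij0 !selE mul0mx mul0mx scaler0.
    apply: acm_ext (acij s2 s2) => // t tT.
    have C12' := C12 t tT; have C21' : s2 *m C t *m s1^T = 0 by rewrite trC // C12' trmx0.
    rewrite sA2T // sA2 sG2 NK2 // !selE trmx0 mulmx0 add0r.
    rewrite !(mulmxBr, mulmxBl, mulmxN, mulNmx, opprK) K2VK.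
    rewrite [s2 *m C t *m (s1^T *m _)]mulmxA C21' mul0mx oppr0 sub0r.
    rewrite -!(mulmxA (K2 t)) C12' !mulmx0 oppr0 sub0r.
    mx_ring.
  + split; first by rewrite Cij0 !selE mul0mx mul0mx scaler0.
    apply: acm_ext (acij s3 s3) => // t tT.
    have C13' := C13 t tT; have C31' : s3 *m C t *m s1^T = 0 by rewrite trC // C13' trmx0.
    rewrite sA3T // sA3 sG3 KT // !selE trmx0 mulmx0 add0r KVK.
    rewrite !(mulmxBr, mulmxDr, mulmxDl, mulmxBl).
    rewrite [s3 *m C t *m (s1^T *m _)]mulmxA C31' mul0mx add0r.
    rewrite -!(mulmxA (K t)) C13' !mulmx0 add0r /K.
    mx_ring.
  + exact: mom.
Qed.

End Core.

(** * Paths of the closed loop in decoupled coordinates *)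

Section Paths.
Variables (R : realType) (d : nat) (T : R).
Hypothesis T_gt0 : 0 < T.

Lemma acm_row_of m n (i : 'I_m) (F F' : R -> 'M[R]_(m, n)) : acm T F F' ->
  acm T (fun t => row i (F t)) (fun t => row i (F' t)).
Proof. by move=> h i0 j; apply: ac_ext (h i j) => t _; rewrite mxE. Qed.

Lemma acm_of_integral m n (F G : R -> 'M[R]_(m, n)) (F0 : 'M[R]_(m, n)) : bmm T G ->
  (forall t, 0 <= t <= T -> F t = F0 + integral_mx 0 t G) -> acm T F G.
Proof.
move=> bG h; apply: acm_ext (acmD (acm_cst T F0) (acm_integral bG)) => t tT.
  by rewrite h.
by rewrite add0r.
Qed.

Lemma integral_mxD m n (F G : R -> 'M[R]_(m, n)) t : bmm T F -> bmm T G -> 0 <= t <= T ->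
  integral_mx 0 t (fun s => F s + G s) = integral_mx 0 t F + integral_mx 0 t G.
Proof.
move=> bF bG tT; have h := acmD (acm_integral bF) (acm_integral bG).
by rewrite -[RHS]subr0 (acmE h tT) !integral_mx0 subr0 !add0r.
Qed.

Lemma integral_mxN m n (F : R -> 'M[R]_(m, n)) t : bmm T F -> 0 <= t <= T ->
  integral_mx 0 t (fun s => - F s) = - integral_mx 0 t F.
Proof.
move=> bF tT; have h := acmN (acm_integral bF).
by rewrite (acmE h tT) !integral_mx0 oppr0 add0r.
Qed.

(** The gain is absolutely continuous, so the left-endpoint sums converge along each continuous path
    to the expression by parts. The product rule applied to K times the integral of [q] then
    separates the signal from the noise. *)
Lemma ito_integralE n (K K' : R -> 'M[R]_(n, d)) (q v y : R -> 'cV[R]_d) t :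
  acm T K K' -> continuous_mx T q -> continuous_mx T v -> v 0 = 0 ->
  (forall s, 0 <= s <= T -> y s = integral_mx 0 s q + v s) -> 0 <= t <= T ->
  ito_integral K y t = integral_mx 0 t (fun s => K s *m q s)
    + (K t *m v t - integral_mx 0 t (fun s => K' s *m v s)).
Proof.
move=> acK cq cv v0 hy tT; have /andP[t0 tT'] := tT.
have bq := continuous_mx_bmm cq; have bv := continuous_mx_bmm cv.
have bK := acm_bmm acK; have bK' := acm_bmm' acK.
(* The formula for [y] is available on [0, T] only; the convergence result is applied to this
   explicit path, and the sums agree because all nodes lie in [0, T]. *)
pose y2 s := integral_mx 0 s q + v s.
have y20 : y2 0 = 0 by rewrite /y2 integral_mx0 v0 addr0.
have acQ := acm_integral bq.
have cy2 : continuous_mx T y2 := continuous_mxD (acm_continuous acQ) cv.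
have -> : ito_integral K y t = K t *m y2 t - integral_mx 0 t (fun s => K' s *m y2 s).
  apply/matrixP => i j; rewrite ord1 mxE.
  have := stieltjes_row_cvg (acm_row_of i acK) cy2 y20 tT.
  rewrite (_ : (row i (K t) *m y2 t - _) 0 0 =
    (K t *m y2 t - integral_mx 0 t (fun s => K' s *m y2 s)) i 0).
    move=> h; apply: cvg_lim => //; apply: cvg_trans h.
    apply: near_eq_cvg; apply: nearW => N /=.
    rewrite !summxE; apply: eq_bigr => k _.
    have nT (l : nat) : (l <= N)%N -> 0 <= t * l%:R / N%:R <= T.
      move=> lN; rewrite node_ge0 //=; apply: le_trans tT'.
      (* For N = 0 the node is 0, since the inverse of 0 is 0. *)
      have [->|N0] := posnP N; first by rewrite invr0 mulr0.
      by rewrite ler_pdivrMr ?ltr0n // ler_wpM2l // ler_nat.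
    rewrite !hy ?nT // -/(y2 _) -/(y2 _); last exact: ltnW.
    by rewrite -row_mul [LHS]mxE.
  rewrite -row_mul !mxE; congr (_ - _); apply: eq_Rintegral => s _.
  by rewrite -row_mul mxE.
have acKQ := acmM acK acQ.
have bK'Q : bmm T (fun s => K' s *m integral_mx 0 s q) := bmmM bK' (acm_bmm acQ).
have h := acmE acKQ tT; rewrite integral_mx0 mulmx0 add0r in h.
rewrite (integral_mxD bK'Q (bmmM bK bq) tT) in h.
rewrite /y2 mulmxDr h.
have -> : integral_mx 0 t (fun s => K' s *m (integral_mx 0 s q + v s)) =
   integral_mx 0 t (fun s => K' s *m integral_mx 0 s q)
   + integral_mx 0 t (fun s => K' s *m v s).
  rewrite -(integral_mxD bK'Q (bmmM bK' bv) tT).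
  by apply: integral_mx_ext => s _; rewrite mulmxDr.
by apply/matrixP => i j; rewrite !mxE; ring.
Qed.

Lemma filtered_acm n (K K' : R -> 'M[R]_(n, d)) (q v y : R -> 'cV[R]_d)
    (f g : R -> 'cV[R]_n) :
  acm T K K' -> continuous_mx T q -> continuous_mx T v -> v 0 = 0 ->
  (forall s, 0 <= s <= T -> y s = integral_mx 0 s q + v s) -> bmm T g ->
  (forall t, 0 <= t <= T -> f t = integral_mx 0 t g + ito_integral K y t) ->
  f 0 = 0 /\
  acm T (fun t => f t - K t *m v t) (fun t => g t + K t *m q t - K' t *m v t).
Proof.
move=> acK cq cv v0 hy bg hf.
have bq := continuous_mx_bmm cq; have bv := continuous_mx_bmm cv.
have bKq : bmm T (fun s => K s *m q s) := bmmM (acm_bmm acK) bq.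
have bK'v : bmm T (fun s => K' s *m v s) := bmmM (acm_bmm' acK) bv.
have z0 : 0 <= (0 : R) <= T by rewrite lexx ltW.
split.
  by rewrite hf // (ito_integralE acK cq cv v0 hy z0) !integral_mx0 v0 mulmx0 subrr !addr0.
apply: (@acm_of_integral _ _ _ _ 0).
  by apply: bmmB => //; exact: bmmD.
move=> t tT; rewrite hf // (ito_integralE acK cq cv v0 hy tT).
rewrite (integral_mxD (bmmD bg bKq) (bmmN bK'v) tT) (integral_mxD bg bKq tT).
rewrite (integral_mxN bK'v tT).
by apply/matrixP => i j; rewrite !mxE; ring.
Qed.

End Paths.

Section ClosedLoop.
Variables (R : realType) (d : nat) (T T0 : R).
Hypothesis T_gt0 : 0 < T.
Variables (Rc SigV : 'M[R]_d) (S : R -> 'M[R]_(d + d)).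
Let J := invmx SigV.
Let Ri := invmx Rc.
Let S11 t : 'M[R]_d := ulsubmx (S t).
Let S12 t : 'M[R]_d := ursubmx (S t).
Hypotheses (bS11 : bmm T S11) (bS12 : bmm T S12).
Variables (p U : R -> 'M[R]_d).
Hypothesis acp : acm T p (fun t => 1%:M - p t *m J *m p t).
Hypothesis U0 : U 0 = 0.
Hypothesis acU : acm T U (fun t => 1%:M - p t *m J *m U t).
Let beta t := S11 t *m U t + S12 t.

(** The three coefficients come from substituting qh = x - U b and ah = a - b in the feedback law:
    S11 qh + S12 ah = S11 x - (S11 U + S12) b + S12 a. *)
Definition loop_state t : 'M[R]_d := if t < T0 then 0 else Ri *m S11 t.
Definition loop_bias t : 'M[R]_d := if t < T0 then 0 else Ri *m beta t.
Definition loop_drift (a : 'cV[R]_d) t : 'cV[R]_d :=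
  a + (if t < T0 then 0 else - (Ri *m (S12 t *m a))).

Lemma bmm_loop a : [/\ bmm T loop_state, bmm T loop_bias & bmm T (loop_drift a)].
Proof.
have bR : bmm T (fun=> Ri) := bmm_cst T Ri.
split.
- by apply: bmm_tail; exact: bmmM.
- apply: bmm_tail; apply: bmmM => //; apply: bmmD => //.
  by apply: bmmM => //; exact: acm_bmm acU.
- apply: bmmD; first exact: bmm_cst.
  apply: bmm_tail; apply: bmmN; apply: bmmM => //.
  by apply: bmmM => //; exact: bmm_cst.
Qed.

Lemma bmm_control (f g : R -> 'cV[R]_d) : bmm T f -> bmm T g ->
  bmm T (control Rc S T0 f g).
Proof.
move=> bf bg; apply: bmm_tail; apply: bmmN; apply: bmmM; first exact: bmm_cst.
by apply: bmmD; exact: bmmM.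
Qed.

Lemma control_loop (a : 'cV[R]_d) (f g : R -> 'cV[R]_d) t :
  a + control Rc S T0 f g t = loop_bias t *m (a - g t)
    - loop_state t *m (f t + U t *m (a - g t)) + loop_drift a t.
Proof.
rewrite /control /loop_bias /loop_state /loop_drift -/Ri; case: ifP => _.
  by rewrite !mul0mx subrr add0r.
rewrite -/(S11 t) -/(S12 t) /beta; mx_ring.
Qed.

Section Bayes.
Variables (P : R -> 'M[R]_(d + d)) (P2' : R -> 'M[R]_d).
Let P11 t : 'M[R]_d := ulsubmx (P t).
Let P12 t : 'M[R]_d := ursubmx (P t).
Let P2 t : 'M[R]_d := drsubmx (P t).
Hypothesis acP2 : acm T P2 P2'.
Hypothesis symP2 : forall t, 0 <= t <= T -> (P2 t)^T = P2 t.
Hypothesis Pstruct : forall t, 0 <= t <= T ->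
  P12 t = U t *m P2 t /\ P11 t = p t + U t *m P2 t *m (U t)^T.

(** By the structure of [P] the gain on the state is K + U K2. In e = q - qh - U b the parts in K2
    cancel, so [e] obeys the error equation of the filter that knows the drift. *)
Lemma bayes_path_core (a x0 : 'cV[R]_d) (w v q y qh ah : R -> 'cV[R]_d) :
  continuous_mx T w -> continuous_mx T v -> w 0 = 0 -> v 0 = 0 ->
  bayes_path T Rc SigV S P T0 a x0 w v q y qh ah ->
  core_path T J p U P2 (fun t => 1%:M - p t *m J *m U t) P2' loop_state loop_bias
    (loop_drift a) a w v
    (fun t => q t - qh t - U t *m (a - ah t)) (fun t => a - ah t)
    (fun t => qh t + U t *m (a - ah t)) x0.
Proof.
move=> cw cv w0 v0 [cq cqh cah hpath].
have bq := continuous_mx_bmm cq; have bqh := continuous_mx_bmm cqh.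
have bah := continuous_mx_bmm cah.
pose u := control Rc S T0 qh ah.
have bu : bmm T u := bmm_control bqh bah.
pose K t := p t *m J; pose K' t := (1%:M - p t *m J *m p t) *m J.
pose K2 t := P2 t *m (U t)^T *m J.
pose K2' t := (P2' t *m (U t)^T + P2 t *m (1%:M - p t *m J *m U t)^T) *m J.
have acK : acm T K K' := acmMr J acp.
have acK2 : acm T K2 K2' := acmMr J (acmM acP2 (acm_tr acU)).
pose K1 t := K t + U t *m K2 t.
pose K1' t := K' t + ((1%:M - p t *m J *m U t) *m K2 t + U t *m K2' t).
have acK1 : acm T K1 K1' := acmD acK (acmM acU acK2).
pose K1P t := P11 t *m J; pose K2P t := (P12 t)^T *m J.
have K2E t : 0 <= t <= T -> K2P t = K2 t.
  by move=> tT; rewrite /K2P (Pstruct tT).1 trmx_mul symP2.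
have K1E t : 0 <= t <= T -> K1P t = K t + U t *m K2 t.
  by move=> tT; rewrite /K1P (Pstruct tT).2 /K /K2 mulmxDl !mulmxA.
have acK1P : acm T K1P K1' by apply: acm_ext acK1 => // t tT; rewrite K1E.
have acK2P : acm T K2P K2' by apply: acm_ext acK2 => // t tT; rewrite K2E.
have hy t : 0 <= t <= T -> y t = integral_mx 0 t q + v t.
  by move=> tT; have [] := hpath t tT.
pose g1 t := ah t + u t - K1P t *m qh t; pose g2 t := - (K2P t *m qh t).
have bg1 : bmm T g1.
  apply: bmmB; first exact: bmmD.
  by apply: bmmM => //; exact: acm_bmm acK1P.
have bg2 : bmm T g2.
  by apply: bmmN; apply: bmmM => //; exact: acm_bmm acK2P.
have [|qh0 acqh] := filtered_acm T_gt0 acK1P cq cv v0 hy bg1 (f := qh).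
  by move=> t tT; have [] := hpath t tT.
have [|ah0 acah] := filtered_acm T_gt0 acK2P cq cv v0 hy bg2 (f := ah).
  by move=> t tT; have [] := hpath t tT.
have z0 : 0 <= (0 : R) <= T by rewrite lexx ltW.
have q0 : q 0 = x0 by have [-> _ _ _] := hpath 0 z0; rewrite integral_mx0 addr0 w0 addr0.
have bau : bmm T (fun s => a + u s) by apply: bmmD => //; exact: bmm_cst.
have acq : acm T (fun t => q t - w t) (fun t => a + u t).
  apply: (acm_of_integral (F0 := x0)) => // t tT.
  by have [-> _ _ _] := hpath t tT; rewrite addrK.
have acb := acmB (acm_cst T a) acah.
have acUb := acmM acU acb.
split.
- by rewrite q0 qh0 ah0 U0 mul0mx !subr0 add0r.
- apply: acm_ext (acmB (acmB acq acqh) acUb) => t tT.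
    by rewrite K1E // K2E //; mx_ring.
  rewrite /g1 /g2 K1E // K2E // /K1' -/(K t) -/(K' t) -/(K2 t); mx_ring.
- apply: acm_ext acb => t tT.
    by rewrite K2E // -/(K2 t); mx_ring.
  by rewrite /g2 K2E // -/(K2 t) -/(K2' t); mx_ring.
- apply: acm_ext (acmD acqh acUb) => t tT.
    by rewrite K1E // K2E // -/(K t); mx_ring.
  transitivity (K t *m (q t - qh t - U t *m (a - ah t)) + (a + u t) - K' t *m v t);
    last by rewrite (control_loop a qh ah t) /K /K'; mx_ring.
  rewrite /g1 /g2 K1E // K2E // /K1' -/(K t) -/(K' t); mx_ring.
Qed.

End Bayes.

(** Knowing the drift is the case b = 0, P2 = 0 of the same system, so [core_moments] serves both
    strategies. *)
Lemma known_path_core (a x0 : 'cV[R]_d) (w v q y qh : R -> 'cV[R]_d) :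
  continuous_mx T w -> continuous_mx T v -> w 0 = 0 -> v 0 = 0 ->
  known_path T Rc SigV S p T0 a x0 w v q y qh ->
  core_path T J p U (fun=> 0) (fun t => 1%:M - p t *m J *m U t) (fun=> 0)
    loop_state (fun=> 0) (loop_drift a) 0 w v
    (fun t => q t - qh t) (fun=> 0) qh x0.
Proof.
move=> cw cv w0 v0 [cq cqh hpath].
have bq := continuous_mx_bmm cq; have bqh := continuous_mx_bmm cqh.
pose u := control Rc S T0 qh (fun=> a).
have bu : bmm T u by apply: bmm_control => //; exact: bmm_cst.
pose K t := p t *m J; pose K' t := (1%:M - p t *m J *m p t) *m J.
have acK : acm T K K' := acmMr J acp.
have hy t : 0 <= t <= T -> y t = integral_mx 0 t q + v t.
  by move=> tT; have [] := hpath t tT.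
pose g1 t := a + u t - K t *m qh t.
have bau : bmm T (fun s => a + u s) by apply: bmmD => //; exact: bmm_cst.
have bg1 : bmm T g1.
  by apply: bmmB => //; apply: bmmM => //; exact: acm_bmm acK.
have [|qh0 acqh] := filtered_acm T_gt0 acK cq cv v0 hy bg1 (f := qh).
  by move=> t tT; have [] := hpath t tT.
have z0 : 0 <= (0 : R) <= T by rewrite lexx ltW.
have q0 : q 0 = x0 by have [-> _ _] := hpath 0 z0; rewrite integral_mx0 addr0 w0 addr0.
have acq : acm T (fun t => q t - w t) (fun t => a + u t).
  apply: (acm_of_integral (F0 := x0)) => // t tT.
  by have [-> _ _] := hpath t tT; rewrite addrK.
split.
- by rewrite q0 qh0 subr0.
- apply: acm_ext (acmB acq acqh) => t tT; first by rewrite -/(K t); mx_ring.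
  by rewrite /g1 -/(K t) -/(K' t); mx_ring.
- apply: acm_ext (acm_cst T (0 : 'cV[R]_d)) => t tT; first by mx_ring.
  by mx_ring.
- apply: acm_ext acqh => t tT; first by rewrite -/(K t); mx_ring.
  transitivity (K t *m (q t - qh t) + (a + u t) - K' t *m v t);
    last by rewrite (control_loop a qh (fun=> a) t) /K /K'; mx_ring.
  by rewrite /g1 -/(K t) -/(K' t); mx_ring.
Qed.

End ClosedLoop.

(** * The costs *)

Section Tails.
Variables (R : realType) (T T0 : R).
Hypotheses (T0_ge0 : 0 <= T0) (T0T : T0 <= T).
Local Notation mu := (@lebesgue_measure R).

Definition tail_int (f : R -> R) : R := Rintegral mu `[T0, T] f.

Lemma tail_intE f : bm T f -> tail_int f = int0 f T - int0 f T0.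
Proof.
move=> bf; rewrite (int0_inc bf) ?T0_ge0 ?T0T //.
rewrite /tail_int -Rintegral_itv_obnd_cbnd //.
apply: bm_integrable bf _ => x /=; rewrite !in_itv /= => /andP[h ->].
by rewrite (le_trans T0_ge0 (ltW h)).
Qed.

Lemma tail_int_ext f g : (forall t, T0 <= t <= T -> f t = g t) -> tail_int f = tail_int g.
Proof.
by move=> fg; apply: eq_Rintegral => t; rewrite inE /= in_itv /=; exact: fg.
Qed.

Lemma tail_intD f g : bm T f -> bm T g ->
  tail_int (fun t => f t + g t) = tail_int f + tail_int g.
Proof.
move=> bf bg; rewrite !tail_intE //; last exact: bmD.
by rewrite !(int0D bf bg) //; lra.
Qed.

Lemma tail_intB f g : bm T f -> bm T g ->
  tail_int (fun t => f t - g t) = tail_int f - tail_int g.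
Proof.
move=> bf bg; rewrite !tail_intE //; last exact: bmB.
by rewrite !(int0B bf bg) //; lra.
Qed.

Lemma tail_int_ac f f' : ac T f f' -> tail_int f' = f T - f T0.
Proof.
move=> acf; have [bf _] := acf; rewrite tail_intE // (ac_inc acf) //.
by rewrite T0_ge0.
Qed.

(** The interval is half-open because the loop gains jump at [T0]; the endpoint has measure zero. *)
Lemma int0_ext_co f g : bm T f -> bm T g -> (forall s, 0 <= s < T0 -> f s = g s) ->
  int0 f T0 = int0 g T0.
Proof.
move=> bf bg fg.
have sub : `[0, T0[%classic `<=` `[0, T].
  by move=> x /=; rewrite !in_itv /= => /andP[-> /ltW/le_trans]; exact.
rewrite /int0 -!Rintegral_itv_bndo_bndc; [|exact: bm_integrable bg sub|exact: bm_integrable bf sub].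
by apply: eq_Rintegral => s; rewrite inE /= in_itv /=; exact: fg.
Qed.

Lemma acm_initial m n (F F' G : R -> 'M[R]_(m, n)) : acm T F F' -> bmm T G ->
  (forall s, 0 <= s < T0 -> F' s = G s) -> F T0 = F 0 + integral_mx 0 T0 G.
Proof.
move=> acF bG FG; apply/matrixP => i j; have [bF' h] := acF i j.
rewrite h ?T0_ge0 // !mxE; congr (_ + _).
by apply: int0_ext_co => // s sT; rewrite FG.
Qed.

Lemma integral_mx_tail m n (F : R -> 'M[R]_(m, n)) : bmm T F ->
  integral_mx T0 T F = integral_mx 0 T F - integral_mx 0 T0 F.
Proof.
by move=> bF; apply/matrixP => i j; rewrite !mxE; exact: tail_intE.
Qed.

Lemma quad_integral_tail n (F : R -> 'M[R]_n) (a : 'cV[R]_n) : bmm T F ->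
  (a^T *m integral_mx T0 T F *m a) 0 0 = tail_int (fun t => (a^T *m F t *m a) 0 0).
Proof.
move=> bF; have TT : 0 <= T <= T by rewrite lexx (le_trans T0_ge0).
have T00 : 0 <= T0 <= T by rewrite T0_ge0.
have baF : bmm T (fun t => a^T *m F t) by apply: bmmM => //; exact: bmm_cst.
have baFa : bmm T (fun t => a^T *m F t *m a) by apply: bmmM => //; exact: bmm_cst.
rewrite integral_mx_tail // mulmxBr mulmxBl.
rewrite -!(integral_mxMl _ bF) // -!(integral_mxMr _ baF) //.
by rewrite !mxE (tail_intE (baFa 0 0)).
Qed.

Lemma acm_mxtrace n (F F' : R -> 'M[R]_n) : acm T F F' ->
  ac T (fun t => \tr (F t)) (fun t => \tr (F' t)).
Proof. by move=> acF; apply: ac_sum => i; exact: acF. Qed.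

Section Costs.
Variables (d : nat) (Q Ri J : 'M[R]_d) (S11 S12 S22 p : R -> 'M[R]_d) (k : R).
Hypothesis symRi : Ri^T = Ri.
Hypothesis symS11 : forall t, 0 <= t <= T -> (S11 t)^T = S11 t.
Hypotheses (S11T : S11 T = 0) (S12T : S12 T = 0) (S22T : S22 T = 0).
Hypothesis acS11 : acm T S11 (fun t => S11 t *m Ri *m S11 t - Q).
Hypothesis acS12 : acm T S12 (fun t => S11 t *m Ri *m S12 t - S11 t).
Hypothesis acS22 : acm T S22 (fun t => (S12 t)^T *m Ri *m S12 t - (S12 t)^T - S12 t).
Hypothesis bp : bmm T p.
Variable beta : R -> 'M[R]_d.
Hypothesis bbeta : bmm T beta.
Let HS t : 'M[R]_d := if t < T0 then 0 else Ri *m S11 t.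
Let HB t : 'M[R]_d := if t < T0 then 0 else Ri *m beta t.

Let T0_le t : T0 <= t <= T -> 0 <= t <= T.
Proof. by move=> /andP[h ->]; rewrite (le_trans T0_ge0 h). Qed.

Section Variance.
Variables Cx Cb Cxb : R -> 'M[R]_d.
Hypotheses (bCb : bmm T Cb) (bCxb : bmm T Cxb).
Hypothesis Cx0 : Cx 0 = 0.
Hypothesis acCx : acm T Cx (fun t => HB t *m (Cxb t)^T - HS t *m Cx t
  + Cxb t *m (HB t)^T - Cx t *m (HS t)^T + k *: (p t *m J *m p t)).

(** The part of the variance cost common to both strategies: [beta], [Cb] and [Cxb] do not occur in
    it. *)
Definition base_variance : R :=
  tail_int (fun t => k * \tr (Q *m p t)) + tail_int (fun t => k * \tr (S11 t *m (p t *m J *m p t)))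
  + \tr (S11 T0 *m integral_mx 0 T0 (fun t => k *: (p t *m J *m p t))).

(* Completing the square: the derivative of [\tr (S11 *m Cx)] absorbs every term
   that depends on [Cx] or [Cxb]. *)
Lemma variance_cost :
  tail_int (fun t => \tr (Q *m (k *: p t + Cx t) + Ri *m
    (S11 t *m Cx t *m S11 t - S11 t *m Cxb t *m (beta t)^T
     - beta t *m (Cxb t)^T *m S11 t + beta t *m Cb t *m (beta t)^T)))
  = base_variance + tail_int (fun t => \tr (Ri *m (beta t *m Cb t *m (beta t)^T))).
Proof.
have bS11 := acm_bmm acS11; have bCx := acm_bmm acCx.
have bJ : bmm T (fun=> J) := bmm_cst T J.
have bQ : bmm T (fun=> Q) := bmm_cst T Q.
have bR : bmm T (fun=> Ri) := bmm_cst T Ri.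
have bG : bmm T (fun t => p t *m J *m p t) by apply: bmmM => //; exact: bmmM.
have b1 : bm T (fun t => k * \tr (Q *m p t)).
  by apply: bmM (bm_cst _ _) (bm_tr _); exact: bmmM.
have b2 : bm T (fun t => k * \tr (S11 t *m (p t *m J *m p t))).
  by apply: bmM (bm_cst _ _) (bm_tr _); exact: bmmM.
have b3 : bm T (fun t => \tr (Ri *m (beta t *m Cb t *m (beta t)^T))).
  by apply: bm_tr; apply: bmmM => //; apply: bmmM (bmmM _ _) (bmm_tr _).
have acPhi := acm_mxtrace (acmM acS11 acCx).
have b4 : bm T _ := proj1 acPhi.
(* Before [T0] the loop gains are zero and only the source term acts, so this value does not depend
   on the strategy. *)
have CxT0 : Cx T0 = integral_mx 0 T0 (fun t => k *: (p t *m J *m p t)).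
  rewrite -[RHS]add0r -Cx0; apply: (acm_initial acCx); first exact: bmmZ.
  by move=> s /andP[_ sT0]; rewrite /HS /HB sT0 !(mul0mx, trmx0, mulmx0) subrr addr0 subrr add0r.
have tailPhi := tail_int_ac acPhi.
rewrite S11T mul0mx mxtrace0 sub0r in tailPhi.
rewrite /base_variance -CxT0 -[\tr (S11 T0 *m Cx T0)]opprK -tailPhi.
rewrite -(tail_intD b1 b2) -(tail_intB (bmD b1 b2) b4) -(tail_intD (bmB (bmD b1 b2) b4) b3).
apply: tail_int_ext => t tT; have tT' := T0_le tT.
have -> : HS t = Ri *m S11 t by rewrite /HS; case/andP: tT => h _; rewrite ltNge h.
have -> : HB t = Ri *m beta t by rewrite /HB; case/andP: tT => h _; rewrite ltNge h.
have c1 (A B C D : 'M[R]_d) : \tr (A *m B *m C *m D) = \tr (D *m A *m B *m C).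
  by rewrite mxtrace_mulC !mulmxA.
rewrite !trmx_mul symRi symS11 //.
rewrite !(mulmxDr, mulmxDl, mulmxBr, mulmxBl) -?scalemxAr -?scalemxAl !mulmxA.
have trN (A : 'M[R]_d) : \tr (- A) = - \tr A by rewrite raddfN.
rewrite !(mulmxN, mulNmx) !(mxtraceD, mxtraceZ, trN) !mulmxA (c1 (S11 t) (Cxb t)) (c1 (S11 t) (Cx t) (S11 t) Ri).
rewrite [\tr (_ *m _ *m (Cxb t)^T *m _)]c1 ?mulmxA.
ring.
Qed.

End Variance.

Section Mean.
Variables (m mb : R -> 'cV[R]_d) (a : 'cV[R]_d).
Hypotheses (m0 : m 0 = 0) (bmb : bmm T mb).
Hypothesis acm_m : acm T m (fun t => HB t *m mb t - HS t *m m t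
  + (a + (if t < T0 then 0 else - (Ri *m (S12 t *m a))))).

(** The quadratic form of [S t] at the vector (x, a): the cost to go of the noiseless control
    problem with known drift. *)
Definition mean_form (x : 'cV[R]_d) t : 'M[R]_1 :=
  x^T *m S11 t *m x + x^T *m S12 t *m a + a^T *m (S12 t)^T *m x + a^T *m S22 t *m a.

(** Without control the mean state at [T0] is the integral of the drift. *)
Definition base_mean : R := mean_form (integral_mx 0 T0 (fun=> a)) T0 0 0.

(** The derivative of [mean_form] along [m], added to the running cost, leaves the square of the
    term that the error [mb] adds to the optimal feedback. *)
Lemma mean_cost :
  tail_int (fun t => ((m t)^T *m Q *m m t
    + (S11 t *m m t + S12 t *m a - beta t *m mb t)^T *m Ri
      *m (S11 t *m m t + S12 t *m a - beta t *m mb t)) 0 0)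
  = base_mean + tail_int (fun t => ((beta t *m mb t)^T *m Ri *m (beta t *m mb t)) 0 0).
Proof.
have bR : bmm T (fun=> Ri) := bmm_cst T Ri.
have ba : bmm T (fun=> a) := bmm_cst T a.
pose g t := beta t *m mb t; have bg : bmm T g := bmmM bbeta bmb.
have mT0 : m T0 = integral_mx 0 T0 (fun=> a).
  rewrite -[RHS]add0r -m0; apply: (acm_initial acm_m) => //.
  by move=> s /andP[_ sT0]; rewrite /HS /HB sT0 !mul0mx subr0 add0r addr0.
have acPhi := acmD (acmD (acmD (acmM (acmM (acm_tr acm_m) acS11) acm_m)
   (acmMr a (acmM (acm_tr acm_m) acS12)))
   (acmM (acmMl a^T (acm_tr acS12)) acm_m)) (acmMr a (acmMl a^T acS22)).
have bPhi : bm T _ := proj1 (acPhi 0 0).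
have tailPhi := tail_int_ac (acPhi 0 0).
have b3 : bm T (fun t => ((g t)^T *m Ri *m g t) 0 0).
  exact: (bmmM (bmmM (bmm_tr bg) bR) bg) 0 0.
rewrite /base_mean -mT0.
have -> : mean_form (m T0) T0 0 0 = - (0 - mean_form (m T0) T0 0 0) by rewrite sub0r opprK.
rewrite S11T S12T S22T !(trmx0, mulmx0, mul0mx) !addr0 [X in X - _]mxE in tailPhi.
rewrite -tailPhi addrC -(tail_intB b3 bPhi).
apply: tail_int_ext => t tT; have tT' := T0_le tT.
have -> : HS t = Ri *m S11 t by rewrite /HS; case/andP: tT => h _; rewrite ltNge h.
have -> : HB t = Ri *m beta t by rewrite /HB; case/andP: tT => h _; rewrite ltNge h.
have -> : t < T0 = false by case/andP: tT => h _; rewrite ltNge h.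
have -> : Ri *m beta t *m mb t = Ri *m g t by rewrite mulmxA.
rewrite -/(g t).
have sub00 (A B C : 'M[R]_1) : A = B - C -> A 0 0 = B 0 0 - C 0 0.
  by move=> ->; rewrite mxE [(- C) 0 0]mxE.

apply: sub00.

have trB m1 n1 (A B : 'M[R]_(m1, n1)) : (A - B)^T = A^T - B^T by rewrite linearB.
have trD m1 n1 (A B : 'M[R]_(m1, n1)) : (A + B)^T = A^T + B^T by rewrite linearD.
have trN m1 n1 (A : 'M[R]_(m1, n1)) : (- A)^T = - A^T by rewrite linearN.
rewrite !(trB, trD, trN).

rewrite !trmx_mul.

rewrite symRi symS11 //.

mx_ring.
Qed.

End Mean.

End Costs.

End Tails.

Section MeanCov.
Variables (R : realType) (d N : nat).
Context (disp : measure_display) (Om : measurableType disp).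
Variable Pr : probability Om R.
Variables (z : Om -> 'cV[R]_N) (mu : 'cV[R]_N) (C : 'M[R]_N).
Hypothesis zL2 : forall l : 'rV[R]_N, L2 Pr (fun w => (l *m z w) 0 0).
Hypothesis zmu : forall l : 'rV[R]_N, EE Pr (fun w => (l *m z w) 0 0) = (l *m mu) 0 0.
Hypothesis zC : forall l k : 'rV[R]_N,
  EE Pr (fun w => ((l *m z w) 0 0 - (l *m mu) 0 0) * ((k *m z w) 0 0 - (k *m mu) 0 0))
  = (l *m C *m k^T) 0 0.

Lemma affine_entry (A : 'M[R]_(d, N)) (c : 'cV[R]_d) x i :
  (A *m x + c) i 0 = (row i A *m x) 0 0 + c i 0.
Proof. by rewrite mxE -row_mul [X in _ = X + _]mxE. Qed.

Lemma EE_affine (A : 'M[R]_(d, N)) (c : 'cV[R]_d) i :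
  EE Pr (fun w => (A *m z w + c) i 0) = (A *m mu + c) i 0.
Proof.
rewrite affine_entry -zmu -[c i 0 in RHS](EE_cst Pr) -EED; last exact: L1_cst.
  by congr EE; apply/funext => w; rewrite affine_entry.
exact: L2_L1.
Qed.

Lemma mean_affine (A : 'M[R]_(d, N)) c X : (forall w, X w = A *m z w + c) ->
  mean Pr X = A *m mu + c.
Proof.
move=> /funext ->; apply/matrixP => i j; rewrite ord1 [LHS]mxE unlock.
exact: EE_affine.
Qed.

Lemma cov_affine (A B : 'M[R]_(d, N)) a b X Y :
  (forall w, X w = A *m z w + a) -> (forall w, Y w = B *m z w + b) ->
  cov Pr X Y = A *m C *m B^T.
Proof.
move=> /funext -> /funext ->; apply/matrixP => i j; rewrite [LHS]mxE.
rewrite !unlock.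
transitivity ((row i A *m C *m (row j B)^T) 0 0).
  rewrite -zC; congr EE; apply/funext => w /=.
  rewrite -[fine _]/(EE Pr _) -[fine (\int[Pr]_w (((B *m z w + b) j 0)%:E))]/(EE Pr _).
  rewrite !EE_affine.
  transitivity (((A *m z w + a) i 0 - (A *m mu + a) i 0)
    * ((B *m z w + b) j 0 - (B *m mu + b) j 0)) => //.
  by rewrite !affine_entry; congr (_ * _); rewrite opprD addrACA subrr addr0.
rewrite -row_mul [LHS]mxE [RHS]mxE; apply: eq_bigr => k _.
by rewrite [row _ _ _ _]mxE [(row j B)^T _ _]mxE [row j B _ _]mxE [B^T _ _]mxE.
Qed.

End MeanCov.

Lemma sel_stack (R : realType) (d : nat) (disp : measure_display) (Om : measurableType disp)
  (e b x : R -> Om -> 'cV[R]_d) t w :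
  [/\ sel1 R d *m stack e b x t w = e t w, sel2 R d *m stack e b x t w = b t w &
      sel3 R d *m stack e b x t w = x t w].
Proof.
by rewrite /stack !mulmxDr !mulmxA !selE !(mul0mx, mul1mx, add0r, addr0).
Qed.

Section Processes.
Variables (R : realType) (d : nat) (T T0 : R).
Hypothesis T_gt0 : 0 < T.
Context (disp : measure_display) (Om : measurableType disp).
Variable Pr : probability Om R.
Local Notation kappa := (normal_var R).
Variables (Rc SigV Sigq0 : 'M[R]_d) (W V : R -> Om -> 'cV[R]_d) (q0 : Om -> 'cV[R]_d).
Hypotheses (psdV : sym_psd SigV) (psdq : sym_psd Sigq0).
Hypothesis hn : noise Pr SigV Sigq0 W V q0.
Variable S : R -> 'M[R]_(d + d).
Let J := invmx SigV.
Let S11 t : 'M[R]_d := ulsubmx (S t).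
Let S12 t : 'M[R]_d := ursubmx (S t).
Hypotheses (symJ : J^T = J) (JV : J *m SigV = 1%:M).
Hypotheses (bS11 : bmm T S11) (bS12 : bmm T S12).
Variables (p U : R -> 'M[R]_d).
Hypotheses (p0 : p 0 = Sigq0) (symp : forall t, 0 <= t <= T -> (p t)^T = p t).
Hypothesis acp : acm T p (fun t => 1%:M - p t *m J *m p t).
Hypothesis U0 : U 0 = 0.
Hypothesis acU : acm T U (fun t => 1%:M - p t *m J *m U t).
Local Notation s1 := (sel1 R d).
Local Notation s2 := (sel2 R d).
Local Notation s3 := (sel3 R d).
Local Notation HS := (loop_state T0 Rc S).
Local Notation HB := (loop_bias T0 Rc S U).
Local Notation c3 := (loop_drift T0 Rc S).

Lemma measurable_coord n (A : 'M[R]_(n, d)) (X : Om -> 'cV[R]_d) i :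
  random_vector X -> measurable_fun setT (fun w => (A *m X w) i 0).
Proof.
move=> mX; rewrite (_ : (fun w => _) = fun w => \sum_j A i j * X w j 0).
  by apply: measurable_sum => j; apply: measurable_funM => //; exact: mX.
by apply/funext => w; rewrite mxE.
Qed.

Lemma noise_paths : {ae Pr, forall w, [/\ continuous_mx T (W ^~ w), continuous_mx T (V ^~ w),
  W 0 w = 0 & V 0 w = 0]}.
Proof.
have [[_ aeW _ _] [_ aeV _ _] _ _] := hn.
by apply: filterS2 aeW aeV => w [W0 cW] [V0 cV]; split.
Qed.

Theorem bayes_moments (P : R -> 'M[R]_(d + d)) (P2' : R -> 'M[R]_d) a q y qh ah :
  acm T (fun t => drsubmx (P t)) P2' ->
  (forall t, 0 <= t <= T -> (drsubmx (P t))^T = drsubmx (P t)) ->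
  (forall t, 0 <= t <= T -> ursubmx (P t) = U t *m drsubmx (P t) /\
    ulsubmx (P t) = p t + U t *m drsubmx (P t) *m (U t)^T) ->
  bayes_process T Rc SigV Pr W V q0 S P T0 a q y qh ah ->
  exists (mb mx : R -> 'cV[R]_d) (Cb Cx Cxb : R -> 'M[R]_d),
  let G t := drsubmx (P t) *m ((U t)^T *m J *m U t) in
  [/\ mb 0 = a /\ acm T mb (fun t => - (G t *m mb t)),
      mx 0 = 0 /\ acm T mx (fun t => HB t *m mb t - HS t *m mx t + c3 a t),
      Cb 0 = 0 /\ acm T Cb (fun t => - (G t *m Cb t) - Cb t *m (G t)^T
        + kappa *: (G t *m drsubmx (P t))),
      [/\ Cx 0 = 0, bmm T Cxb &
        acm T Cx (fun t => HB t *m (Cxb t)^T - HS t *m Cx t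
          + Cxb t *m (HB t)^T - Cx t *m (HS t)^T + kappa *: (p t *m J *m p t))] &
      forall t, 0 <= t <= T ->
      [/\ mean Pr (q t) = mx t, mean Pr (qh t) = mx t - U t *m mb t &
          mean Pr (ah t) = a - mb t] /\
      [/\ cov Pr (q t) (q t) = kappa *: p t + Cx t,
          cov Pr (qh t) (qh t) = Cx t - Cxb t *m (U t)^T - U t *m (Cxb t)^T
            + U t *m Cb t *m (U t)^T,
          cov Pr (qh t) (ah t) = U t *m Cb t - Cxb t &
          cov Pr (ah t) (ah t) = Cb t]].
Proof.
move=> acP2 symP2 Pstruct [rv hpath].
have [bHS bHB bc3] := bmm_loop T0 Rc bS11 bS12 acU a.
pose e t w := q t w - qh t w - U t *m (a - ah t w).
pose b t w := a - ah t w.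
pose x t w := qh t w + U t *m (a - ah t w).
have rvt t : 0 <= t <= T -> [/\ random_vector (q t), random_vector (qh t) & random_vector (ah t)].
  by move=> tT; have := rv t; rewrite in_itv /= => /(_ tT)[].
have mb t : 0 <= t <= T -> random_vector (b t).
  move=> tT i; have [_ _ h] := rvt t tT.
  rewrite (_ : (fun w => _) = fun w => a i 0 - ah t w i 0); last by apply/funext => w; rewrite !mxE.
  by apply: measurable_funB; [exact: measurable_cst | exact: h].
have me t i : 0 <= t <= T -> measurable_fun setT (fun w => e t w i 0).
  move=> tT; have [h1 h2 _] := rvt t tT.
  rewrite (_ : (fun w => _) = fun w => q t w i 0 - qh t w i 0 - (U t *m b t w) i 0).
    apply: measurable_funB; last exact: measurable_coord (mb t tT).
    by apply: measurable_funB; [exact: h1 | exact: h2].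
  by apply/funext => w; rewrite mxDE mxNE mxDE mxNE.
have mx t i : 0 <= t <= T -> measurable_fun setT (fun w => x t w i 0).
  move=> tT; have [_ h2 _] := rvt t tT.
  rewrite (_ : (fun w => _) = fun w => qh t w i 0 + (U t *m b t w) i 0).
    by apply: measurable_funD; [exact: h2 | exact: measurable_coord (mb t tT)].
  by apply/funext => w; rewrite mxDE.
have hcore : {ae Pr, forall w, core_path T J p U (fun t => drsubmx (P t))
   (fun t => 1%:M - p t *m J *m U t) P2' HS HB (c3 a) a
   (W ^~ w) (V ^~ w) (e ^~ w) (b ^~ w) (x ^~ w) (q0 w)}.
  apply: filterS2 hpath noise_paths => w hp [cW cV W0 V0].
  exact: (bayes_path_core T_gt0 bS11 bS12 acp U0 acU acP2 symP2 Pstruct cW cV W0 V0 hp).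
have [mu [C [mu1 [mub0 acmub] [mux0 acmux] bC [C1 [Cb0 acCb] [Cx0 acCx] mom]]]] :=
  core_moments T_gt0 psdV psdq hn symJ JV p0 symp acp acU acP2 symP2 bHS bHB bc3 me (fun t i tT => mb t tT i) mx hcore.
exists (fun t => s2 *m mu t), (fun t => s3 *m mu t), (fun t => s2 *m C t *m s2^T),
  (fun t => s3 *m C t *m s3^T), (fun t => s3 *m C t *m s2^T).
have trC t : 0 <= t <= T -> (s3 *m C t *m s2^T)^T = s2 *m C t *m s3^T.
  by move=> tT; have [_ [_ _ _ _ h]] := C1 t tT; rewrite !trmx_mul trmxK h mulmxA.
move=> G; have GE t : drsubmx (P t) *m (U t)^T *m J *m U t = G t by rewrite /G !mulmxA.
split.
- by split; [exact: mub0 | apply: acm_ext acmub => // t _; rewrite GE].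
- by split; [exact: mux0 | exact: acmux].
- by split; [exact: Cb0 | apply: acm_ext acCb => [//|t _]; rewrite GE].
- split; first exact: Cx0.
  + by apply: bmmM; [apply: bmmM => //|]; exact: bmm_cst.
  + by apply: acm_ext acCx => // t tT; rewrite trC.
- move=> t tT; have [C11 [C12 C13 C21 C31 symC]] := C1 t tT.
  have [m1 m2 m3] := mom t tT.
  have z1 w : s1 *m stack e b x t w = e t w.
    by have [] := sel_stack e b x t w.
  have z2 w : s2 *m stack e b x t w = b t w.
    by have [] := sel_stack e b x t w.
  have z3 w : s3 *m stack e b x t w = x t w.
    by have [] := sel_stack e b x t w.
  (* Back to the original processes: q = e + x, qh = x - U b and ah = a - b are affine in the
     stacked vector. *)
  have qE w : q t w = (s1 + s3) *m stack e b x t w + 0.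
    by rewrite addr0 mulmxDl z1 z3 /e /x; mx_ring.
  have qhE w : qh t w = (s3 - U t *m s2) *m stack e b x t w + 0.
    by rewrite addr0 mulmxBl -mulmxA z2 z3 /b /x; mx_ring.
  have ahE w : ah t w = (- s2) *m stack e b x t w + a.
    by rewrite mulNmx z2 /b; mx_ring.
  rewrite (mean_affine m1 m2 qE) (mean_affine m1 m2 qhE) (mean_affine m1 m2 ahE).
  rewrite (cov_affine m1 m2 m3 qE qE) (cov_affine m1 m2 m3 qhE qhE) (cov_affine m1 m2 m3 qhE ahE)
    (cov_affine m1 m2 m3 ahE ahE).
  have trB m1' n1 (A B : 'M[R]_(m1', n1)) : (A - B)^T = A^T - B^T by rewrite linearB.
  have trD m1' n1 (A B : 'M[R]_(m1', n1)) : (A + B)^T = A^T + B^T by rewrite linearD.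
  have trN m1' n1 (A : 'M[R]_(m1', n1)) : (- A)^T = - A^T by rewrite linearN.
  split.
    rewrite !addr0 mulmxDl mu1 // add0r !mulmxBl mulNmx -mulmxA; split=> //.
    by rewrite addrC.
  rewrite !trB !trD !trN trmx_mul trC //.
  rewrite !(mulmxDl, mulmxDr, mulmxBl, mulmxBr, mulmxN, mulNmx) !mulmxA.
  rewrite C11 C13 C31 addr0 add0r.
  by split=> //; mx_ring.
Qed.

Theorem known_moments a q y qh :
  known_process T Rc SigV Pr W V q0 S p T0 a q y qh ->
  exists (mx : R -> 'cV[R]_d) (Cx : R -> 'M[R]_d),
  [/\ mx 0 = 0 /\ acm T mx (fun t => c3 a t - HS t *m mx t),
      Cx 0 = 0 /\ acm T Cx
        (fun t => kappa *: (p t *m J *m p t) - HS t *m Cx t - Cx t *m (HS t)^T) &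
      forall t, 0 <= t <= T ->
      [/\ mean Pr (q t) = mx t, mean Pr (qh t) = mx t,
          cov Pr (q t) (q t) = kappa *: p t + Cx t &
          cov Pr (qh t) (qh t) = Cx t]].
Proof.
move=> [rv hpath].
have [bHS bHB bc3] := bmm_loop T0 Rc bS11 bS12 acU a.
pose e t w := q t w - qh t w.
have rvt t : 0 <= t <= T -> random_vector (q t) /\ random_vector (qh t).
  by move=> tT; have := rv t; rewrite in_itv /= => /(_ tT)[].
have me t i : 0 <= t <= T -> measurable_fun setT (fun w => e t w i 0).
  move=> tT; have [h1 h2] := rvt t tT.
  rewrite (_ : (fun w => _) = fun w => q t w i 0 - qh t w i 0); last by apply/funext => w; rewrite !mxE.
  by apply: measurable_funB; [exact: h1 | exact: h2].
have hcore : {ae Pr, forall w, core_path T J p U (fun=> 0)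
   (fun t => 1%:M - p t *m J *m U t) (fun=> 0) HS (fun=> 0) (c3 a) 0
   (W ^~ w) (V ^~ w) (e ^~ w) (fun=> 0) (qh ^~ w) (q0 w)}.
  apply: filterS2 hpath noise_paths => w hp [cW cV W0 V0].
  exact: (known_path_core T_gt0 bS11 bS12 U acp cW cV W0 V0 hp).
have [mu [C [mu1 _ [mux0 acmux] bC [C1 _ [Cx0 acCx] mom]]]] :=
  core_moments T_gt0 psdV psdq hn symJ JV p0 symp acp acU (acm_cst T (0 : 'M[R]_d))
    (fun t _ => trmx0 _ _ _) bHS (bmm_cst T (0 : 'M[R]_d)) bc3 me
    (b := fun _ _ => 0) (fun t i _ => measurable_cst _)
    (fun t i tT => (rvt t tT).2 i) hcore.
exists (fun t => s3 *m mu t), (fun t => s3 *m C t *m s3^T).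
split.
- by split; [exact: mux0 | apply: acm_ext acmux => // t _; rewrite mul0mx sub0r addrC].
- split; first exact: Cx0.
  apply: acm_ext acCx => // t tT; rewrite mul0mx trmx0 mulmx0.
  by rewrite sub0r addr0 addrC addrA.
- move=> t tT; have [C11 [C12 C13 C21 C31 symC]] := C1 t tT.
  have [m1 m2 m3] := mom t tT.
  have z1 w : s1 *m stack e (fun _ _ => 0) qh t w = e t w.
    by have [] := sel_stack e (fun _ _ => 0) qh t w.
  have z3 w : s3 *m stack e (fun _ _ => 0) qh t w = qh t w.
    by have [] := sel_stack e (fun _ _ => 0) qh t w.
  have qE w : q t w = (s1 + s3) *m stack e (fun _ _ => 0) qh t w + 0.
    by rewrite addr0 mulmxDl z1 z3 /e subrK.
  have qhE w : qh t w = s3 *m stack e (fun _ _ => 0) qh t w + 0 by rewrite addr0 z3.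
  rewrite (mean_affine m1 m2 qE) (mean_affine m1 m2 qhE).
  rewrite (cov_affine m1 m2 m3 qE qE) (cov_affine m1 m2 m3 qhE qhE).
  rewrite !addr0 mulmxDl mu1 // add0r; split=> //.
  by rewrite [(s1 + s3)^T]linearD /= !(mulmxDl, mulmxDr) C11 C13 C31 addr0 add0r.
Qed.

End Processes.

Section PositiveDefinite.
Variables (R : realType) (d : nat).

Lemma sym_pd_unit (A : 'M[R]_d) : sym_pd A -> A \in unitmx.
Proof.
move=> [symA hA]; rewrite -row_free_unit -kermx_eq0; apply: contraT => /rowV0Pn[u uK u0].
have := hA u^T; rewrite trmx_eq0 trmxK => /(_ u0).
by move/sub_kermxP: uK => ->; rewrite mul0mx mxE ltxx.
Qed.

Lemma sym_pd_inv (A : 'M[R]_d) : sym_pd A -> sym_pd (invmx A).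
Proof.
move=> pdA; have uA := sym_pd_unit pdA; have [symA hA] := pdA.
have symI : (invmx A)^T = invmx A by rewrite trmx_inv symA.
split=> // v v0; have := hA (invmx A *m v).
rewrite trmx_mul symI !mulmxA mulmxKV // => -> //.
by apply: contraNneq v0 => /(congr1 (mulmx A)); rewrite mulmxA mulmxV // mul1mx mulmx0 => ->.
Qed.

Lemma sym_pd_psd (A : 'M[R]_d) : sym_pd A -> sym_psd A.
Proof.
move=> [symA hA]; split=> // v; have [->|/hA/ltW//] := eqVneq v 0.
by rewrite mulmx0 mxE.
Qed.

End PositiveDefinite.

(** The matrices C1, C2, C3 of the cost definitions are known only through their action on each
    drift [a], with processes that depend on [a]; the basis vectors recover their regularity. *)
Lemma bmm_cols (R : realType) (T : R) m n (F : R -> 'M[R]_(m, n)) :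
  (forall a : 'cV[R]_n, exists2 f, bmm T f & forall t, 0 <= t <= T -> F t *m a = f t) ->
  bmm T F.
Proof.
move=> h i j; have [f bf fE] := h (delta_mx j 0).
apply: bm_ext (bf i 0) => t tT.
by rewrite -fE // -colE mxE.
Qed.

(** Converts the integrand of the Bayesian cost, written in the covariances of qh and ah, into the
    form in the covariances of x and b to which [variance_cost] applies. *)
Lemma cost_trace (R : realType) d (Q Ri s z U p X Y B : 'M[R]_d) :
  Ri^T = Ri -> s^T = s -> B^T = B ->
  \tr (Q *m (p + X) + s *m Ri *m s *m (X - Y *m U^T - U *m Y^T + U *m B *m U^T)
    + 2 *: (s *m Ri *m z *m (U *m B - Y)^T) + z^T *m Ri *m z *m B)
  = \tr (Q *m (p + X) + Ri *m (s *m X *m s - s *m Y *m (s *m U + z)^T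
    - (s *m U + z) *m Y^T *m s + (s *m U + z) *m B *m (s *m U + z)^T)).
Proof.
(* [A] and its transpose are the two cross terms; they have the same trace against the symmetric
   [Ri], whence the factor 2. *)
move=> symRi syms symB; pose A := z *m (B *m U^T - Y^T) *m s.
have UBY : (U *m B - Y)^T = B *m U^T - Y^T by rewrite linearB /= trmx_mul symB.
have cyc (M N : 'M[R]_d) : \tr (M *m Ri *m N) = \tr (Ri *m (N *m M)).
  by rewrite -mulmxA mxtrace_mulC mulmxA.
have trA : \tr (Ri *m A^T) = \tr (Ri *m A).
  by rewrite -[Ri in LHS]symRi -trmx_mul mxtrace_tr mxtrace_mulC.
have AT : A^T = s *m (U *m B - Y) *m z^T.
  by rewrite /A !trmx_mul syms -UBY trmxK mulmxA.
have bT : (s *m U + z)^T = U^T *m s + z^T by rewrite linearD /= trmx_mul syms.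
have -> : Ri *m (s *m X *m s - s *m Y *m (s *m U + z)^T
    - (s *m U + z) *m Y^T *m s + (s *m U + z) *m B *m (s *m U + z)^T)
  = Ri *m (s *m (X - Y *m U^T - U *m Y^T + U *m B *m U^T) *m s)
    + Ri *m A + Ri *m A^T + Ri *m (z *m B *m z^T).
  rewrite bT AT /A; mx_ring.
rewrite !mxtraceD mxtraceZ trA -!(mulmxA (_ *m Ri)) !cyc UBY.
rewrite -[z *m (B *m U^T - Y^T) *m s]/A; ring.
Qed.

(** * Both costs as a common base plus an excess *)

Section Reduction.
Variables (R : realType) (d : nat) (T : R).
Hypothesis T_gt0 : 0 < T.
Variables (Q Rc SigV Sigq0 : 'M[R]_d).
Hypotheses (Rc_pd : sym_pd Rc) (SigV_pd : sym_pd SigV) (Sigq0_psd : sym_psd Sigq0).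
Context (disp : measure_display) (Om : measurableType disp).
Variables (Pr : probability Om R) (W V : R -> Om -> 'cV[R]_d) (q0 : Om -> 'cV[R]_d).
Hypothesis WVq0 : noise Pr SigV Sigq0 W V q0.
Variable S : R -> 'M[R]_(d + d).
Hypothesis S_riccati : control_riccati T Q Rc S.
Local Notation kappa := (normal_var R).
Let J := invmx SigV.
Let Ri := invmx Rc.
Let S11 t : 'M[R]_d := ulsubmx (S t).
Let S12 t : 'M[R]_d := ursubmx (S t).
Let S22 t : 'M[R]_d := drsubmx (S t).
Variables p U : R -> 'M[R]_d.
Hypothesis p_known : known_filter_riccati T SigV Sigq0 p.
Hypothesis U0 : U 0 = 0.
Hypothesis acU : acm T U (fun t => 1%:M - p t *m J *m U t).

Definition bias_gain t : 'M[R]_d := S11 t *m U t + S12 t.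
Definition bayes_gain (r t : R) : 'M[R]_d := invmx (r^-1%:M + fisher J U t).

Let symJ : J^T = J. Proof. by have [] := sym_pd_inv SigV_pd. Qed.
Let symRi : Ri^T = Ri. Proof. by have [] := sym_pd_inv Rc_pd. Qed.
Let JV : J *m SigV = 1%:M. Proof. by rewrite mulVmx // sym_pd_unit. Qed.
Let symSigq0 : Sigq0^T = Sigq0. Proof. by case: Sigq0_psd. Qed.
Let symV : SigV^T = SigV. Proof. by case: SigV_pd. Qed.
Let psdV := sym_pd_psd SigV_pd.

Let p0 : p 0 = Sigq0. Proof. by have [] := known_filter_acm T_gt0 symV symSigq0 p_known. Qed.
Let symp t : 0 <= t <= T -> (p t)^T = p t.
Proof. by have [_ h _] := known_filter_acm T_gt0 symV symSigq0 p_known; exact: h. Qed.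
Let acp : acm T p (fun t => 1%:M - p t *m J *m p t).
Proof. by have [] := known_filter_acm T_gt0 symV symSigq0 p_known. Qed.
Let symS11 t : 0 <= t <= T -> (S11 t)^T = S11 t.
Proof. by have [h _ _ _ _] := control_blocks T_gt0 S_riccati; exact: h. Qed.
Let ST : [/\ S11 T = 0, S12 T = 0 & S22 T = 0].
Proof. by have [] := control_blocks T_gt0 S_riccati. Qed.
Let acS11 : acm T S11 (fun t => S11 t *m Ri *m S11 t - Q).
Proof. by have [] := control_blocks T_gt0 S_riccati. Qed.
Let acS12 : acm T S12 (fun t => S11 t *m Ri *m S12 t - S11 t).
Proof. by have [] := control_blocks T_gt0 S_riccati. Qed.
Let acS22 : acm T S22 (fun t => (S12 t)^T *m Ri *m S12 t - (S12 t)^T - S12 t).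
Proof. by have [] := control_blocks T_gt0 S_riccati. Qed.
Let bS11 := acm_bmm acS11.
Let bS12 := acm_bmm acS12.

Lemma bmm_bias_gain : bmm T bias_gain.
Proof. by apply: bmmD => //; apply: bmmM => //; exact: acm_bmm acU. Qed.

(** The difference D = p1 - p solves a linear equation, since p1 J p1 - p J p = D J p1 + p J D. *)
Lemma known_filter_unique p1 : known_filter_riccati T SigV Sigq0 p1 ->
  forall t, 0 <= t <= T -> p1 t = p t.
Proof.
move=> h1; have [p10 _ acp1] := known_filter_acm T_gt0 symV symSigq0 h1.
have bL : lin_bdd T (fun t (D : 'M[R]_d) => - (D *m (J *m p1 t)) - (p t *m J) *m D).
  have bJ : bmm T (fun=> J) := bmm_cst T J.
  apply: lin_bddD; apply: lin_bddN.
    apply: (lin_bddMr (A := fun t => J *m p1 t)); last exact: lin_bdd_id.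
    exact: bmmM bJ (acm_bmm acp1).
  apply: (lin_bddMl (A := fun t => p t *m J)); last exact: lin_bdd_id.
  exact: bmmM (acm_bmm acp) bJ.
move=> t tT; apply/eqP; rewrite -subr_eq0; apply/eqP.
apply: (linear_mx_uniq T_gt0 (acmB acp1 acp) _ bL _ tT).
  by rewrite p10 p0 subrr.
move=> s _; rewrite /J; mx_ring.
Qed.

Section Horizon.
Variable T0 : R.
Hypotheses (T0_ge0 : 0 <= T0) (T0_ltT : T0 < T).
Let T0T := ltW T0_ltT.
Local Notation HS := (loop_state T0 Rc S).
Local Notation base_var := (base_variance T T0 Q J S11 p kappa).
Local Notation base_mean := (base_mean T0 S11 S12 S22).

(** The completed squares with beta = 0 and no drift error, so that the excess term is zero. *)
Lemma known_cost_value X Y : known_cost T Q Rc SigV Sigq0 Pr W V q0 S T0 X Y ->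
  Y = base_var /\ forall a : 'cV[R]_d, (a^T *m X *m a) 0 0 = base_mean a.
Proof.
move=> [p1 [C1 [C2 [Cqq [Chh [p1_known hproc -> ->]]]]]].
have [p10 symp1 acp1] := known_filter_acm T_gt0 symV symSigq0 p1_known.
have [U1 U10 acU1] := bias_exists T_gt0 acp1.
have [S11T S12T S22T] := ST.
have bz : bmm T (fun=> 0 : 'M[R]_d) := bmm_cst T 0.
have proc a : exists2 mx, mx 0 = 0 /\ acm T mx (fun t => loop_drift T0 Rc S a t - HS t *m mx t) &
    forall t, 0 <= t <= T -> C1 t *m a = mx t /\ C2 t *m a = mx t.
  have [q [y [qh [hp mom]]]] := hproc a.
  have [mx [Cx [hm _ hmom]]] := known_moments T_gt0 psdV Sigq0_psd WVq0 symJ JV bS11 bS12 p10 symp1 acp1 acU1 hp.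
  exists mx => // t tT; have := mom t; rewrite in_itv /= => /(_ tT)[e1 e2 _ _].
  by have [h1 h2 _ _] := hmom t tT; rewrite -e1 -e2 h1 h2.
have bC1 : bmm T C1.
  apply: bmm_cols => a; have [mx [_ hm] h] := proc a; exists mx; first exact: acm_bmm hm.
  by move=> t /h[].
have bC2 : bmm T C2.
  apply: bmm_cols => a; have [mx [_ hm] h] := proc a; exists mx; first exact: acm_bmm hm.
  by move=> t /h[].
have bR : bmm T (fun=> Ri) := bmm_cst T Ri.
split.
  have [q [y [qh [hp mom]]]] := hproc 0.
  have [mx [Cx [_ [Cx0 acCx] hmom]]] := known_moments T_gt0 psdV Sigq0_psd WVq0 symJ JV bS11 bS12 p10 symp1 acp1 acU1 hp.
  have acCx' : acm T Cx (fun t => (if t < T0 then 0 else Ri *m (0 : 'M[R]_d)) *m (0 : 'M[R]_d)^T - HS t *m Cx t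
      + (0 : 'M[R]_d) *m (if t < T0 then 0 else Ri *m (0 : 'M[R]_d))^T - Cx t *m (HS t)^T
      + kappa *: (p1 t *m J *m p1 t)).
    by apply: acm_ext acCx => // t tT; rewrite trmx0 mulmx0 mul0mx sub0r addr0; mx_ring.
  have h := variance_cost T0_ge0 T0T symRi symS11 S11T acS11 (acm_bmm acp1) bz (Cb := fun=> 0) bz Cx0 acCx'.
  have -> : base_var = base_variance T T0 Q J S11 p1 kappa.
    have T0s s : T0 <= s <= T -> 0 <= s <= T by move=> /andP[hs ->]; rewrite (le_trans T0_ge0 hs).
    have s0T s : 0 <= s <= T0 -> 0 <= s <= T by move=> /andP[-> hs]; rewrite (le_trans hs T0T).
    rewrite /base_variance; congr (_ + _ + _).
    - by apply: tail_int_ext => t /T0s tT; rewrite (known_filter_unique p1_known tT).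
    - by apply: tail_int_ext => t /T0s tT; rewrite (known_filter_unique p1_known tT).
    - by congr (\tr (_ *m _)); apply: integral_mx_ext => t /s0T tT; rewrite (known_filter_unique p1_known tT).
  rewrite -[RHS]addr0.
  have -> : (0 : R) = tail_int T T0 (fun t => \tr (Ri *m ((0 : 'M[R]_d) *m 0 *m (0 : 'M[R]_d)^T))).
    rewrite (@tail_int_ext _ _ _ _ (fun=> 0)) ?(tail_intE T0_ge0 T0T (bm_cst _ _)).
      by rewrite !int0_cst ?mul0r ?subrr // ltW.
    by move=> t _; rewrite !(mul0mx, mulmx0) mxtrace0.
  rewrite -h; apply: tail_int_ext => t /andP[tT0 tT].
  have t0T : 0 <= t <= T by rewrite tT (le_trans T0_ge0 tT0).
  have := mom t; rewrite in_itv /= => /(_ t0T)[_ _ e3 e4].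
  have [_ _ h3 h4] := hmom t t0T; rewrite -e3 -e4 h3 h4.
  rewrite -/(S11 t) symS11 // !(mul0mx, mulmx0, subr0, addr0) -/Ri.
  rewrite [LHS]mxtraceD [RHS]mxtraceD; congr (_ + _).
  by rewrite -!mulmxA mxtrace_mulC !mulmxA.
move=> a; have [mx [mx0 hm] h] := proc a.
rewrite (quad_integral_tail T0_ge0 T0T); last first.
  apply: bmmD.
    by apply: bmmM => //; apply: bmmM; [exact: bmm_tr | exact: bmm_cst].
  have bL : bmm T (fun t => S11 t *m C2 t + S12 t) by apply: bmmD => //; exact: bmmM.
  by apply: bmmM => //; apply: bmmM => //; exact: bmm_tr.
have acm_mx : acm T mx (fun t => (if t < T0 then 0 else Ri *m (0 : 'M[R]_d)) *m (0 : 'cV[R]_d) - HS t *m mx t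
    + loop_drift T0 Rc S a t).
  by apply: acm_ext hm => // t tT; rewrite mulmx0 sub0r addrC.
have hc := mean_cost T0_ge0 T0T symRi symS11 S11T S12T S22T acS11 acS12 acS22 bz mx0 (bmm_cst T 0) acm_mx.
rewrite -[RHS]addr0.
have -> : (0 : R) = tail_int T T0 (fun t => (((0 : 'M[R]_d) *m (0 : 'cV[R]_d))^T *m Ri *m ((0 : 'M[R]_d) *m (0 : 'cV[R]_d))) 0 0).
  rewrite (@tail_int_ext _ _ _ _ (fun=> 0)) ?(tail_intE T0_ge0 T0T (bm_cst _ _)).
    by rewrite !int0_cst ?mul0r ?subrr // ltW.
  by move=> t _; rewrite !(mul0mx, mulmx0) mxE.
rewrite -hc; apply: tail_int_ext => t /andP[tT0 tT].
have t0T : 0 <= t <= T by rewrite tT (le_trans T0_ge0 tT0).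
have [e1 e2] := h t t0T.
rewrite mul0mx subr0 -/(S11 t) -/(S12 t) -/Ri -{1 2}e1 -e2; congr ((_ : 'M[R]_1) 0 0).
have -> : S11 t *m (C2 t *m a) + S12 t *m a = (S11 t *m C2 t + S12 t) *m a.
  by rewrite mulmxDl mulmxA.
by rewrite [in RHS]trmx_mul [in RHS](trmx_mul _ a) mulmxDr mulmxDl !mulmxA.
Qed.

Definition excess_variance (r : R) : R := tail_int T T0 (fun t => \tr (Ri *m
  (bias_gain t *m (kappa *: (bayes_gain r t *m fisher J U t *m bayes_gain r t)) *m (bias_gain t)^T))).

Definition excess_mean (r : R) (a : 'cV[R]_d) : R := tail_int T T0 (fun t =>
  ((bias_gain t *m (r^-1 *: (bayes_gain r t *m a)))^T *m Ri
    *m (bias_gain t *m (r^-1 *: (bayes_gain r t *m a)))) 0 0).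

(** The regularity of [bayes_gain] is recorded as well: on [0, T] it coincides with the block P22,
    which is absolutely continuous, so matrix inversion need not be studied. *)
Lemma bayes_cost_value r X Y : 0 < r ->
  bayes_cost T Q Rc SigV Sigq0 Pr W V q0 S r%:M T0 X Y ->
  [/\ bmm T (bayes_gain r), Y = base_var + excess_variance r &
    forall a : 'cV[R]_d, (a^T *m X *m a) 0 0 = base_mean a + excess_mean r a].
Proof.
move=> r_gt0 [P [C1 [C2 [C3 [Cqq [Chh [Cha [Caa [hP hproc -> ->]]]]]]]]].
have r_neq0 : r != 0 by rewrite gt_eqF.
have [symP [P110 P120 P220] acP11 acP12 acP22] := filter_blocks T_gt0 hP.
pose P2 t := drsubmx (P t).
have symP11 t : 0 <= t <= T -> (ulsubmx (P t))^T = ulsubmx (P t) by move=> /symP[].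
have symP2 t : 0 <= t <= T -> (P2 t)^T = P2 t by move=> /symP[].
have P110p : ulsubmx (P 0) = p 0 by rewrite P110 p0.
have Pstruct := filter_structure T_gt0 symJ acp U0 acU symP2 P110p P120 acP11 acP12 acP22 symP11.
have acP2 : acm T P2 (fun t => - (P2 t *m ((U t)^T *m J *m U t) *m P2 t)) :=
  acm_P22 T_gt0 symJ acp U0 acU symP2 P110p P120 acP11 acP12 acP22 symP11.
have P2E t : 0 <= t <= T -> P2 t = bayes_gain r t.
  move=> tT; have h := gain_inverse T_gt0 acU r_neq0 P220 acP2 tT.
  have [_ uM] := mulmx1_unit h.
  by rewrite -[P2 t]mulmx1 -(mulmxV uM) mulmxA h mul1mx.
pose N t := (U t)^T *m J *m U t.
have bN : bmm T N := bmm_info acU.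
have bP2 := acm_bmm acP2.
have symN t : (N t)^T = N t by rewrite /N !trmx_mul trmxK symJ mulmxA.
have [S11T S12T S22T] := ST.
have bbeta := bmm_bias_gain.
have bR : bmm T (fun=> Ri) := bmm_cst T Ri.
(* P2' = - P2 N P2 makes r^-1 P2 a a solution of the same linear equation, with initial value a
   because P2 0 = r. *)
have mbE (mb : R -> 'cV[R]_d) a : mb 0 = a -> acm T mb (fun t => - (P2 t *m N t *m mb t)) ->
    forall t, 0 <= t <= T -> mb t = r^-1 *: (P2 t *m a).
  move=> mb0 acmb t tT; apply/eqP; rewrite -subr_eq0; apply/eqP.
  have bL : lin_bdd T (fun t (D : 'cV[R]_d) => - (P2 t *m N t) *m D).
    by apply: (lin_bddMl (A := fun t => - (P2 t *m N t))); [apply: bmmN; exact: bmmM | exact: lin_bdd_id].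
  have acr := acmMr a (acmMl (r^-1%:M : 'M[R]_d) acP2).
  rewrite scalemxAl -mul_scalar_mx; apply: (linear_mx_uniq T_gt0 (acmB acmb acr) _ bL _ tT).
    by rewrite mb0 /P2 P220 -scalar_mxM mulVf // mul1mx subrr.
  by move=> s _; rewrite !mul_scalar_mx /N; mx_ring.
have procm a : exists2 mx : R -> 'cV[R]_d, mx 0 = 0 /\ acm T mx (fun t => loop_bias T0 Rc S U t *m (r^-1 *: (P2 t *m a))
      - HS t *m mx t + loop_drift T0 Rc S a t) &
    forall t, 0 <= t <= T -> [/\ C1 t *m a = mx t, C2 t *m a = mx t - U t *m (r^-1 *: (P2 t *m a)) &
      C3 t *m a = a - r^-1 *: (P2 t *m a)].
  have [q [y [qh [ah [hp mom]]]]] := hproc a.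
  have [mb [mx [Cb [Cx [Cxb [[mb0 acmb] [mx0 acmx] _ _ hmom]]]]]] := bayes_moments T_gt0 psdV Sigq0_psd WVq0
    symJ JV bS11 bS12 p0 symp acp U0 acU acP2 symP2 Pstruct hp.
  have mbE' := mbE mb a mb0 acmb.
  exists mx.
    by split=> //; apply: acm_ext acmx => // t tT; rewrite mbE'.
  move=> t tT; have := mom t; rewrite in_itv /= => /(_ tT)[[e1 e2 e3] _].
  by have [[h1 h2 h3] _] := hmom t tT; rewrite -mbE' // -e1 -e2 -e3 h1 h2 h3.
have bmb (a : 'cV[R]_d) : bmm T (fun t => r^-1 *: (P2 t *m a)).
  by apply: bmmZ; apply: bmmM => //; exact: bmm_cst.
have bC1 : bmm T C1.
  apply: bmm_cols => a; have [mx [_ hm] h] := procm a; exists mx; first exact: acm_bmm hm.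
  by move=> t /h[].
have bC2 : bmm T C2.
  apply: bmm_cols => a; have [mx [_ hm] h] := procm a.
  exists (fun t => mx t - U t *m (r^-1 *: (P2 t *m a))); last by move=> t /h[].
  by apply: bmmB; [exact: acm_bmm hm | apply: bmmM => //; exact: acm_bmm acU].
have bC3 : bmm T C3.
  apply: bmm_cols => a; have [mx [_ hm] h] := procm a.
  exists (fun t => a - r^-1 *: (P2 t *m a)); last by move=> t /h[].
  by apply: bmmB => //; exact: bmm_cst.
split.
- exact: bmm_ext P2E bP2.
- have [q [y [qh [ah [hp mom]]]]] := hproc 0.
  have [mb [mx [Cb [Cx [Cxb [_ _ [Cb0 acCb] [Cx0 bCxb acCx] hmom]]]]]] := bayes_moments T_gt0 psdV Sigq0_psd WVq0
    symJ JV bS11 bS12 p0 symp acp U0 acU acP2 symP2 Pstruct hp.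
  (* The product rule shows that kappa P2 M P2 solves the covariance equation of [b]; both sides
     vanish at 0 because M 0 = 0. *)
  have CbE t : 0 <= t <= T -> Cb t = kappa *: (P2 t *m fisher J U t *m P2 t).
    move=> tT; apply/eqP; rewrite -subr_eq0; apply/eqP.
    have bL : lin_bdd T (fun t (D : 'M[R]_d) => - ((P2 t *m N t) *m D) - D *m (P2 t *m N t)^T).
      have bPN : bmm T (fun t => P2 t *m N t) := bmmM bP2 bN.
      apply: lin_bddD; apply: lin_bddN.
        by apply: (lin_bddMl (A := fun t => P2 t *m N t)) => //; exact: lin_bdd_id.
      apply: (lin_bddMr (A := fun t => (P2 t *m N t)^T)); last exact: lin_bdd_id.
      exact: bmm_tr.
    have ack := acmMl (kappa%:M : 'M[R]_d) (acmM (acmM acP2 (acm_fisher acU)) acP2).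
    rewrite -mul_scalar_mx; apply: (linear_mx_uniq T_gt0 (acmB acCb ack) _ bL _ tT).
      by rewrite Cb0 /fisher integral_mx0 mulmx0 mul0mx mulmx0 subrr.
    move=> s sT; rewrite !trmx_mul !trmxK symJ symP2 // !mul_scalar_mx /N /P2; mx_ring.
  have symF t : 0 <= t <= T -> (fisher J U t)^T = fisher J U t.
    move=> tT; have h : acm T (fun t => (fisher J U t)^T - fisher J U t) (fun=> 0).
      apply: acm_ext (acmB (acm_tr (acm_fisher acU)) (acm_fisher acU)) => // s _.
      by rewrite -/(N s) symN subrr.
    have := acm_eq0 h tT; rewrite /fisher integral_mx0 trmx0 subrr => /eqP.
    by rewrite subr_eq0 => /eqP.
  have symCb t : 0 <= t <= T -> (Cb t)^T = Cb t.
    by move=> tT; rewrite CbE // linearZ /= !trmx_mul symP2 // symF // mulmxA.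
  have bCb := acm_bmm acCb.
  have h := variance_cost T0_ge0 T0T symRi symS11 S11T acS11 (acm_bmm acp) bbeta bCb Cx0 acCx.
  transitivity (base_var + tail_int T T0 (fun t => \tr (Ri *m (bias_gain t *m Cb t *m (bias_gain t)^T)))); last first.
    congr (_ + _); apply: tail_int_ext => t /andP[tT0 tT].
    by rewrite CbE ?P2E // tT (le_trans T0_ge0 tT0).
  rewrite -h; apply: tail_int_ext => t /andP[tT0 tT].
  have t0T : 0 <= t <= T by rewrite tT (le_trans T0_ge0 tT0).
  have := mom t; rewrite in_itv /= => /(_ t0T)[_ [e1 e2 e3 e4]].
  have [_ [h1 h2 h3 h4]] := hmom t t0T; rewrite -e1 -e2 -e3 -e4 h1 h2 h3 h4.
  rewrite -/(S11 t) -/(S12 t) symS11 // -/Ri.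
  exact: (cost_trace Q (S12 t) (U t) (kappa *: p t) (Cx t) (Cxb t) symRi (symS11 t0T) (symCb t t0T)).
move=> a; have [mx [mx0 hm] h] := procm a.
rewrite (quad_integral_tail T0_ge0 T0T); last first.
  apply: bmmD.
    by apply: bmmM => //; apply: bmmM; [exact: bmm_tr | exact: bmm_cst].
  have bL : bmm T (fun t => S11 t *m C2 t + S12 t *m C3 t) by apply: bmmD; exact: bmmM.
  by apply: bmmM => //; apply: bmmM => //; exact: bmm_tr.
have hc := mean_cost T0_ge0 T0T symRi symS11 S11T S12T S22T acS11 acS12 acS22 bbeta mx0 (bmb a) hm.
transitivity (base_mean a + tail_int T T0 (fun t =>
  ((bias_gain t *m (r^-1 *: (P2 t *m a)))^T *m Ri
    *m (bias_gain t *m (r^-1 *: (P2 t *m a)))) 0 0)); last first.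
  congr (_ + _); apply: tail_int_ext => t /andP[tT0 tT].
  by rewrite P2E // tT (le_trans T0_ge0 tT0).
rewrite -hc; apply: tail_int_ext => t /andP[tT0 tT].
have t0T : 0 <= t <= T by rewrite tT (le_trans T0_ge0 tT0).
have [e1 e2 e3] := h t t0T.
have -> : S11 t *m mx t + S12 t *m a - bias_gain t *m (r^-1 *: (P2 t *m a))
   = (S11 t *m C2 t + S12 t *m C3 t) *m a.
  rewrite mulmxDl -!mulmxA e2 e3 /bias_gain; mx_ring.
rewrite -e1 -/(S11 t) -/(S12 t) -/Ri; congr ((_ : 'M[R]_1) 0 0).
by rewrite [in RHS]trmx_mul [in RHS](trmx_mul _ a) mulmxDr mulmxDl !mulmxA.
Qed.

End Horizon.
End Reduction.

(** * The limit of vague priors *)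

Lemma sum_le_mulrn (R : realType) n (F : 'I_n -> R) c : (forall i, F i <= c) ->
  \sum_i F i <= c *+ n.
Proof. by move=> h; rewrite -[in leRHS](card_ord n) -sumr_const; apply: ler_sum. Qed.

(** * Quadratic forms, coercivity and inverses *)

Section QuadraticForms.
Variables (R : realType) (n : nat).
Implicit Types (x y : 'cV[R]_n) (A B M : 'M[R]_n).

Definition qf A x : R := (x^T *m A *m x) 0 0.
Definition nsq x : R := (x^T *m x) 0 0.

Lemma nsqE x : nsq x = \sum_i x i 0 ^+ 2.
Proof. by rewrite /nsq mxE; apply: eq_bigr => i _; rewrite mxE expr2. Qed.

Lemma nsq_ge0 x : 0 <= nsq x.
Proof. by rewrite nsqE sumr_ge0 // => i _; rewrite sqr_ge0. Qed.

Lemma sqr_coord_le x i : x i 0 ^+ 2 <= nsq x.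
Proof. by rewrite nsqE (bigD1 i) //= lerDl sumr_ge0 // => j _; rewrite sqr_ge0. Qed.

Lemma nsq_eq0 x : nsq x = 0 -> x = 0.
Proof.
move=> x0; apply/matrixP => i j; rewrite ord1 mxE; apply/eqP.
by rewrite -sqrf_eq0 eq_le sqr_ge0 andbT -x0 sqr_coord_le.
Qed.

Lemma nsqZ c x : nsq (c *: x) = c ^+ 2 * nsq x.
Proof. by rewrite !nsqE mulr_sumr; apply: eq_bigr => i _; rewrite mxE exprMn. Qed.

Lemma dot_le c x y : 0 < c -> (x^T *m y) 0 0 <= (c * nsq x + nsq y / c) / 2.
Proof.
move=> c0; rewrite !nsqE mxE mulr_sumr !mulr_suml -big_split mulr_suml.
apply: ler_sum => i _ /=; rewrite mxE -subr_ge0.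
have -> : (c * x i 0 ^+ 2 + y i 0 ^+ 2 / c) / 2 - x i 0 * y i 0
    = (c * x i 0 - y i 0) ^+ 2 / (2 * c) by field; rewrite gt_eqF.
by rewrite divr_ge0 ?sqr_ge0 // mulr_ge0 // ltW.
Qed.

Lemma qfE A x : qf A x = \sum_i \sum_j A i j * (x i 0 * x j 0).
Proof.
rewrite /qf -mulmxA mxE; apply: eq_bigr => i _; rewrite mxE mxE mulr_sumr.
by apply: eq_bigr => j _; ring.
Qed.

Lemma qf_le A c x : (forall i j, `|A i j| <= c) -> `|qf A x| <= c *+ n *+ n * nsq x.
Proof.
move=> Ac; rewrite qfE.
have h i j : `|A i j * (x i 0 * x j 0)| <= c * nsq x.
  rewrite normrM ler_pM // ler_norml.
  have hi := sqr_coord_le x i; have hj := sqr_coord_le x j.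
  have h1 := sqr_ge0 (x i 0 - x j 0); have h2 := sqr_ge0 (x i 0 + x j 0).
  by move: hi hj h1 h2; rewrite !expr2; lra.
apply: le_trans (ler_norm_sum _ _ _) _.
have -> : c *+ n *+ n * nsq x = \sum_(i < n) c *+ n * nsq x by rewrite sumr_const card_ord mulrnAl.
apply: ler_sum => i _; apply: le_trans (ler_norm_sum _ _ _) _.
have -> : c *+ n * nsq x = \sum_(i < n) c * nsq x by rewrite sumr_const card_ord mulrnAl.
by apply: ler_sum.
Qed.

Lemma mx_bounded A : exists2 c : R, 0 < c & forall i j, `|A i j| <= c.
Proof.
exists (1 + \sum_(k : 'I_n * 'I_n) `|A k.1 k.2|); first by rewrite ltr_wpDr // sumr_ge0.
by move=> i j; rewrite (bigD1 (i, j)) //= addrCA lerDl addr_ge0 // sumr_ge0.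
Qed.

Lemma qf_bounded A : exists2 c : R, 0 < c & forall x, qf A x <= c * nsq x.
Proof.
have [c c0 Ac] := mx_bounded A; exists (1 + c *+ n *+ n).
  by rewrite ltr_wpDr // mulrn_wge0 // mulrn_wge0 // ltW.
move=> x; have := qf_le x Ac; have := nsq_ge0 x; have := ler_norm (qf A x).
rewrite mulrDl mul1r; lra.
Qed.

Lemma nsq_mul A x : nsq (A *m x) = qf (A^T *m A) x.
Proof. by rewrite /nsq /qf trmx_mul !mulmxA. Qed.

Lemma qf_sub M x y s : M^T = M ->
  qf M (x - s *: y) = qf M x - s * 2 * (y^T *m M *m x) 0 0 + s ^+ 2 * qf M y.
Proof.
move=> symM.
have e : (x^T *m M *m y) 0 0 = (y^T *m M *m x) 0 0.
  have tr1 (B : 'M[R]_1) : B 0 0 = B^T 0 0 by rewrite mxE.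
  by rewrite tr1 !trmx_mul trmxK symM mulmxA.
rewrite /qf; have -> : (x - s *: y)^T = x^T - s *: y^T by rewrite linearB linearZ.
rewrite !(mulmxBl, mulmxBr) -!scalemxAl -!scalemxAr -?scalemxAl.
rewrite !(mxDE, mxNE, mxZE) e; ring.
Qed.

(** Nonnegativity of the form at x - M x / c, expanded, together with the upper bound at M x. *)
Lemma psd_mul_le M c x : sym_psd M -> 0 < c -> (forall y, qf M y <= c * nsq y) ->
  nsq (M *m x) <= c * qf M x.
Proof.
move=> [symM psdM] c0 hM.
have := psdM (x - c^-1 *: (M *m x)); rewrite -/(qf M _) qf_sub //.
have := hM (M *m x).
have -> : ((M *m x)^T *m M *m x) 0 0 = nsq (M *m x) by rewrite -mulmxA.
move=> h1 h2.
have h3 : c^-1 ^+ 2 * qf M (M *m x) <= c^-1 * nsq (M *m x).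
  rewrite expr2 -mulrA; apply: ler_wpM2l; first by rewrite invr_ge0 ltW.
  by rewrite ler_pdivrMl.
have h4 : c^-1 * nsq (M *m x) <= qf M x by lra.
by rewrite -ler_pdivrMl.
Qed.

Lemma coercive_unit B c : 0 < c -> (forall x, c * nsq x <= qf B x) -> B \in unitmx.
Proof.
move=> c0 hB; rewrite -row_free_unit -kermx_eq0; apply: contraT => /rowV0Pn[u uK u0].
have := hB u^T; rewrite /qf trmxK; move/sub_kermxP: uK => ->; rewrite mul0mx mxE.
rewrite pmulr_rle0 // => h; have /nsq_eq0 : nsq u^T = 0 by apply/eqP; rewrite eq_le h nsq_ge0.
by move/eqP; rewrite trmx_eq0 (negPf u0).
Qed.

Lemma coercive_inv_le B c y : 0 < c -> (forall x, c * nsq x <= qf B x) ->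
  nsq (invmx B *m y) <= nsq y / c ^+ 2.
Proof.
move=> c0 hB; have uB := coercive_unit c0 hB; pose x := invmx B *m y.
have := hB x; have -> : qf B x = (x^T *m y) 0 0 by rewrite /qf -mulmxA mulKVmx.
have := dot_le x y c0; rewrite -/x => h1 h2.
have h3 : c * nsq x <= nsq y / c by lra.
by rewrite ler_pdivlMr ?exprn_gt0 // expr2 mulrA -ler_pdivlMr // mulrC.
Qed.

(** An upper bound on a form is a lower bound on the inverse form: apply [psd_mul_le] at A x, where
    B A x = x. *)
Lemma psd_coercive A B c x : sym_psd B -> B *m A = 1%:M -> A^T = A -> 0 < c ->
  (forall y, qf B y <= c * nsq y) -> nsq x <= c * qf A x.
Proof.
move=> psdB BA symA c0 hB; have := psd_mul_le (A *m x) psdB c0 hB.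
by rewrite mulmxA BA mul1mx /qf trmx_mul symA -!mulmxA (mulmxA B) BA mul1mx.
Qed.

(** A resolvent identity: G M = 1 - e G and M^-1 = G + e M^-1 G. It makes the convergence of G M G
    to M^-1 quantitative in e. *)
Lemma inv_defect e M : M \in unitmx -> e%:M + M \in unitmx ->
  let G := invmx (e%:M + M) in
  invmx M - G *m M *m G = e *: (invmx M *m G + G *m G).
Proof.
move=> uM uG G; pose K := invmx M.
have h1 : G *m M = 1%:M - e *: G.
  by rewrite -(mulVmx uG) -/G mulmxDr mul_mx_scalar addrAC subrr add0r.
have h2 : K = G + e *: (K *m G).
  have e1 : K *m (e%:M + M) *m G = K by rewrite -mulmxA mulmxV // mulmx1.
  rewrite mulmxDr mulVmx // mul_mx_scalar mulmxDl mul1mx -scalemxAl in e1.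
  by rewrite -{1}e1 addrC.
by rewrite h1 mulmxBl mul1mx -scalemxAl -/K {1}h2; mx_ring.
Qed.

End QuadraticForms.

Section RankOne.
Variables (R : realType) (n : nat).

Lemma psd_diag0 (A : 'M[R]_n) : sym_psd A -> (forall i, A i i = 0) -> A = 0.
Proof.
move=> [symA psdA] A0; apply/matrixP => i j; rewrite mxE.
have symij : A j i = A i j by rewrite -{1}symA mxE.
(* The form at e_i + s e_j, whose diagonal terms vanish; s = 1 and s = -1 leave only A i j = 0. *)
have e s : 0 <= s * 2 * A i j.
  pose x : 'cV[R]_n := delta_mx i 0; pose y : 'cV[R]_n := delta_mx j 0.
  have ent (k l : 'I_n) : ((delta_mx k 0 : 'cV[R]_n)^T *m A *m (delta_mx l 0 : 'cV[R]_n)) 0 0 = A k l.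
    by rewrite trmx_delta -rowE -colE !mxE.
  have := psdA (x - (- s) *: y); rewrite -/(qf A _) qf_sub // /qf !ent !A0 symij; lra.
have := e 1; have := e (-1); lra.
Qed.

(* Gaussian elimination along a nonzero diagonal entry keeps the form
   nonnegative and clears that entry. *)
Lemma rank_one_sum (A : 'M[R]_n) : sym_psd A ->
  exists ws : seq 'cV[R]_n, A = \sum_(w <- ws) w *m w^T.
Proof.
have [m] := ubnP #|[pred i | A i i != 0]|; elim: m A => // m IHm A lem psdA.
have [symA hA] := psdA.
have [i /= Ai|A0] := pickP [pred i | A i i != 0]; last first.
  exists [::]; rewrite big_nil; apply: psd_diag0 => // i.
  by have := A0 i; rewrite /= => /negbFE/eqP.
have ent (k l : 'I_n) : ((delta_mx k 0 : 'cV[R]_n)^T *m A *m (delta_mx l 0 : 'cV[R]_n)) 0 0 = A k l.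
  by rewrite trmx_delta -rowE -colE !mxE.
have diag_ge0 k : 0 <= A k k by rewrite -ent; exact: hA.
have Ai_gt0 : 0 < A i i by rewrite lt_neqAle eq_sym Ai diag_ge0.
pose w := (Num.sqrt (A i i))^-1 *: col i A.
have wwE k l : (w *m w^T) k l = A k i * A l i / A i i.
  rewrite mxE big_ord1 !mxE mulrACA -expr2 exprVn sqr_sqrtr ?ltW //; ring.
pose B := A - w *m w^T.
have symB : B^T = B by rewrite /B linearB /= trmx_mul trmxK symA.
have psdB : sym_psd B.
  split=> // v; pose y : 'cV[R]_n := delta_mx i 0.
  pose c := (y^T *m A *m v) 0 0.
  have := hA (v - (c / A i i) *: y); rewrite -/(qf A _) qf_sub // -/c /qf ent => h.
  have cE : c = \sum_k A k i * v k 0.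
    rewrite /c trmx_delta -rowE mxE; apply: eq_bigr => k _.
    by rewrite mxE -[in LHS]symA mxE.
  rewrite /B mulmxBr mulmxBl mxDE mxNE.
  have -> : (v^T *m (w *m w^T) *m v) 0 0 = c ^+ 2 / A i i.
    rewrite -/(qf _ v) qfE cE expr2 !mulr_suml; apply: eq_bigr => k _.
    rewrite mulr_sumr mulr_suml; apply: eq_bigr => l _; rewrite wwE; ring.
  rewrite (_ : c ^+ 2 / A i i = c / A i i * 2 * c - (c / A i i) ^+ 2 * A i i); first lra.
  by field.
have B_ge0 k : 0 <= B k k.
  by have := psdB.2 (delta_mx k 0); rewrite trmx_delta -rowE -colE !mxE.
have [|ws hws] := IHm B _ psdB.
  apply: leq_trans (lem : (_ <= m)%N); apply: proper_card; apply/properP; split.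
    apply/fintype.subsetP => k; rewrite !inE; apply: contra => /eqP Ak.
    rewrite eq_le B_ge0 andbT /B mxDE mxNE wwE Ak sub0r oppr_le0.
    by rewrite divr_ge0 ?diag_ge0 // -expr2 sqr_ge0.
  exists i; rewrite ?inE // negbK /B mxDE mxNE wwE.
  by rewrite -mulrA divff // mulr1 subrr eqxx.
by exists (w :: ws); rewrite big_cons -hws addrC subrK.
Qed.

End RankOne.

(** If f s were positive, the Lipschitz bound would keep f above f s / 2 on a short window around s,
    making the integral positive. *)
Lemma int0_eq0 (R : realType) (T t : R) (f f' : R -> R) :
  ac T f f' -> (forall s : R, 0 <= s <= T -> 0 <= f s) -> 0 < t <= T -> int0 f t = 0 ->
  forall s : R, 0 <= s <= t -> f s = 0.
Proof.
move=> acf f0 /andP[t0 tT] It s /andP[s0 st].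
have bf := ac_bm acf; have [B B0 lipf] := ac_lip acf.
have sT : 0 <= s <= T by rewrite s0 (le_trans st tT).
have lip2 (a b e : R) : 0 <= a <= T -> 0 <= b <= T -> a - e <= b <= a + e ->
    f a - f b <= B * e.
  move=> /andP[a0 aT] /andP[b0 bT] /andP[l1 l2]; have [ab|/ltW ba] := lerP a b.
    have := lipf a b _ bT; rewrite a0 ab ler_norml => /(_ isT)/andP[h1 _].
    have : B * (b - a) <= B * e by apply: ler_wpM2l; [exact: ltW | lra].
    lra.
  have := lipf b a _ aT; rewrite b0 ba ler_norml => /(_ isT)/andP[_ h1].
  have : B * (a - b) <= B * e by apply: ler_wpM2l; [exact: ltW | lra].
  lra.
have inc_ge0 u v : 0 <= u -> u <= v -> v <= T -> 0 <= int0 f v - int0 f u.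
  move=> u0 uv vT; rewrite (int0_inc bf) ?u0 //.
  by apply: Rintegral_ge0 => x /=; rewrite in_itv /= => /andP[/ltW ux xv];
    rewrite f0 // (le_trans u0 ux) (le_trans xv vT).
have I0 u : 0 <= u <= t -> int0 f u = 0.
  move=> /andP[u0 ut]; have h1 := inc_ge0 u t u0 ut tT.
  have := inc_ge0 0 u (lexx 0) u0 (le_trans ut tT); rewrite int0_0; lra.
apply/eqP; rewrite eq_le f0 // andbT leNgt; apply/negP => fs0.
have [e [e0 et eB]] : exists e : R, [/\ 0 < e, e <= t / 2 & B * e <= f s / 2].
  exists (Num.min (t / 2) (f s / 2 / B)); split.
  - by rewrite lt_min !divr_gt0.
  - by rewrite ge_min lexx.
  - by rewrite mulrC -ler_pdivlMr // ge_min lexx orbT.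
(* The window [u, u + e] starts at s, or ends at t when s is too close to t. *)
have [u [u0 us su ut]] : exists u : R, [/\ 0 <= u, u <= s, s <= u + e & u + e <= t].
  have [h|h] := lerP (s + e) t; first by exists s; split=> //; rewrite lerDl ltW.
  by exists (t - e); split; lra.
have uT : 0 <= u <= u + e by rewrite u0 lerDl ltW.
have ueT : u + e <= T := le_trans ut tT.
have := int0_inc_le (bm_cst T (f s / 2)) bf uT ueT.
have -> : int0 f (u + e) = 0 by apply: I0; rewrite ut addr_ge0 // ltW.
have -> : int0 f u = 0 by apply: I0; rewrite u0; apply: le_trans ut; rewrite lerDl ltW.
have ue0 : 0 <= u + e by rewrite addr_ge0 // ltW.
rewrite !int0_cst // subrr => h.
suff : f s / 2 * (u + e) - f s / 2 * u <= 0.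
  have -> : f s / 2 * (u + e) - f s / 2 * u = f s / 2 * e by ring.
  by rewrite leNgt mulr_gt0 // divr_gt0.
apply: h => x /andP[ux xue].
have xT : 0 <= x <= T by rewrite (le_trans u0 ux) (le_trans xue ueT).
have := lip2 s x e sT xT; have -> : s - e <= x <= s + e by apply/andP; split; lra.
by move=> /(_ isT); lra.
Qed.

(** * The Fisher information near time zero *)

Section Fisher.
Variables (R : realType) (d : nat) (T : R).
Variables (J : 'M[R]_d) (p U : R -> 'M[R]_d).
Hypothesis pdJ : sym_pd J.
Hypothesis U0 : U 0 = 0.
Hypothesis acU : acm T U (fun t => 1%:M - p t *m J *m U t).
Local Notation M := (fisher J U).
Let N t := (U t)^T *m J *m U t.

Let bN : bmm T N. Proof. exact: bmm_info acU. Qed.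

Let qfN t v : qf (N t) v = qf J (U t *m v).
Proof. by rewrite /qf /N trmx_mul !mulmxA. Qed.

Let qfN_ge0 t v : 0 <= qf (N t) v.
Proof. by rewrite qfN; exact: (sym_pd_psd pdJ).2. Qed.

Let bqfN v : bm T (fun t => qf (N t) v).
Proof. by apply: (bmmM (bmmM (bmm_cst T v^T) bN) (bmm_cst T v)). Qed.

Lemma fisher_qf t v : 0 <= t <= T -> qf (M t) v = int0 (fun s => qf (N s) v) t.
Proof.
move=> tT; rewrite /qf /fisher -(integral_mxMl _ bN) //.
rewrite -(integral_mxMr _ (bmmM (bmm_cst T v^T) bN)) //; by rewrite mxE.
Qed.

Lemma fisher_le s t v : 0 <= s -> s <= t -> t <= T -> qf (M s) v <= qf (M t) v.
Proof.
move=> s0 st tT; rewrite !fisher_qf ?s0 ?(le_trans s0 st) ?(le_trans st tT) //.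
have := int0_inc_le (bm_cst T 0) (bqfN v) (_ : 0 <= s <= t) tT (fun r _ => qfN_ge0 r v).
rewrite s0 st => /(_ isT); rewrite !int0_cst ?(le_trans s0 st) // !mul0r; lra.
Qed.

Lemma fisher_psd t : 0 <= t <= T -> sym_psd (M t).
Proof.
move=> tT; split; last first.
  move=> v; rewrite -/(qf _ v) fisher_qf //; apply: int0_ge0 => s _; exact: qfN_ge0.
have symN s : (N s)^T = N s by rewrite /N !trmx_mul trmxK pdJ.1 mulmxA.
have h : acm T (fun t => (M t)^T - M t) (fun=> 0).
  apply: acm_ext (acmB (acm_tr (acm_fisher acU)) (acm_fisher acU)) => // s _.
  by rewrite -/(N s) symN subrr.
have := acm_eq0 h tT; rewrite /fisher integral_mx0 trmx0 subrr => /eqP.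
by rewrite subr_eq0 => /eqP.
Qed.

(** If the form vanishes at v, then U v = 0 on [0, t]; but then (U v)' = v - p J U v = v, so t v =
    0. *)
Lemma fisher_pd t : 0 < t <= T -> sym_pd (M t).
Proof.
move=> /andP[t0 tT]; have t0T : 0 <= t <= T by rewrite ltW.
have [symM psdM] := fisher_psd t0T; split=> // v v0.
rewrite lt_neqAle psdM andbT eq_sym; apply: contra_neq v0 => qM0.
have acN : ac T (fun s => qf (N s) v) _ :=
  acmMr v (acmMl v^T (acmM (acmM (acm_tr acU) (acm_cst T J)) acU)) 0 0.
have Uv0 s : 0 <= s <= t -> U s *m v = 0.
  move=> st; have := int0_eq0 acN (fun s _ => qfN_ge0 s v) (_ : 0 < t <= T) _ st.
  rewrite t0 tT -fisher_qf // /qf qM0 => /(_ isT erefl).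
  rewrite -/(qf (N s) v) qfN; have [->//|/pdJ.2] := eqVneq (U s *m v) 0.
  by rewrite -/(qf _ _) => /gt_eqF/eqP.
have h := acmMr v acU.
have tt : 0 <= t <= t by rewrite ltW ?lexx.
have := acmE h t0T; rewrite (Uv0 t tt) U0 mul0mx add0r.
have -> : integral_mx 0 t (fun s => (1%:M - p s *m J *m U s) *m v) = t *: v.
  rewrite (integral_mx_ext (G := fun=> v)); last first.
    by move=> s st; rewrite mulmxBl mul1mx -!mulmxA Uv0 // !mulmx0 subr0.
  by apply/matrixP => i j; rewrite !mxE -/(int0 _ _) int0_cst 1?mulrC // ltW.
by move/esym/eqP; rewrite scaler_eq0 gt_eqF //= => /eqP.
Qed.

(** U vanishes at 0 and is Lipschitz, so the integrand of the information is O(s^2). The added 1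
    keeps the constant positive. *)
Lemma fisher_cubic : exists2 C : R, 0 < C &
  forall t v, 0 <= t <= T -> qf (M t) v <= C * t ^+ 3 * nsq v.
Proof.
have [B B0 lipU] := acm_lip acU.
have [c c0 hJ] := qf_bounded J.
pose D := c * (B ^+ 2 *+ d *+ d *+ d).
have D0 : 0 <= D by rewrite mulr_ge0 ?mulrn_wge0 ?sqr_ge0 // ltW.
exists (D + 1); first by rewrite ltr_wpDl.
move=> t v tT; have /andP[t0 tT'] := tT.
have UB s i j : 0 <= s <= T -> `|U s i j| <= B * s.
  move=> /andP[s0 sT]; have := lipU 0 s i j (_ : 0 <= 0 <= s) sT.
  by rewrite lexx s0 U0 mxE !subr0; apply.
have Uv (s : R) : 0 <= s <= t -> qf (N s) v <= D * t ^+ 2 * nsq v.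
  move=> /andP[s0 st]; have sT : 0 <= s <= T by rewrite s0 (le_trans st).
  rewrite qfN; apply: le_trans (hJ _) _; rewrite nsq_mul /D -!mulrA.
  apply: ler_wpM2l; first exact: ltW.
  apply: le_trans (ler_norm _) _.
  apply: le_trans (qf_le (c := (B * t) ^+ 2 *+ d) _ _) _.
    move=> i j; rewrite mxE; apply: le_trans (ler_norm_sum _ _ _) _.
    rewrite -[in leRHS](card_ord d) -sumr_const; apply: ler_sum => k _.
    rewrite mxE normrM expr2; apply: ler_pM => //; apply: le_trans (UB _ _ _ sT) _;
      by apply: ler_wpM2l => //; exact: ltW.
  by rewrite exprMn expr2 [t ^+ 2]expr2 !mulrnAl !mulrA.
rewrite fisher_qf //.
have := int0_le (bqfN v) (bm_cst T _) tT' Uv.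
rewrite int0_cst // => h; apply: le_trans h _.
have := mulr_ge0 (exprn_ge0 3 t0) (nsq_ge0 v); rewrite !exprS expr0; lra.
Qed.

End Fisher.

(** Dominated convergence by hand: a crude bound A on the short interval [0, e], a small bound B on
    the rest. *)
Lemma tail_int_split_le (R : realType) (T T0 e A B : R) (f : R -> R) :
  0 <= T0 <= T -> 0 <= e <= T -> 0 <= B -> bm T f ->
  (forall t : R, 0 <= t <= T -> 0 <= f t) ->
  (forall t : R, 0 <= t <= e -> f t <= A) -> (forall t : R, e <= t <= T -> f t <= B) ->
  0 <= tail_int T T0 f <= A * e + B * T.
Proof.
move=> /andP[T00 T0T] /andP[e0 eT] B0 bf f0 fA fB; have T_ge0 := le_trans T00 T0T.
rewrite (tail_intE T00 T0T bf); apply/andP; split.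
  have := int0_inc_le (bm_cst T 0) bf (_ : 0 <= T0 <= T) (lexx T).
  rewrite T00 T0T !int0_cst // !mul0r subrr => /(_ isT); apply.
  by move=> t /andP[h1 h2]; rewrite f0 // h2 (le_trans T00).
have h1 : 0 <= int0 f T0.
  by apply: int0_ge0 => s /andP[s0 sT]; rewrite f0 // s0 (le_trans sT).
have h2 : int0 f e <= A * e.
  by rewrite -int0_cst //; apply: (int0_le bf (bm_cst T A) eT).
have h3 : int0 f T - int0 f e <= B * T - B * e.
  rewrite -!int0_cst //; apply: (int0_inc_le bf (bm_cst T B)) => //.
  by rewrite e0.
have := mulr_ge0 B0 e0; lra.
Qed.

Lemma bmm_bound (R : realType) (T : R) m n (F : R -> 'M[R]_(m, n)) : bmm T F ->
  exists2 c, 0 < c & forall (t : R) i j, 0 <= t <= T -> `|F t i j| <= c.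
Proof.
move=> bF.
have /choice[B hB] : forall x : 'I_m * 'I_n, exists B : R, 0 < B /\
    forall t : R, 0 <= t <= T -> `|F t x.1 x.2| <= B.
  by move=> x; have [B ? ?] := bm_bound (bF x.1 x.2); exists B.
have B0 x : 0 <= B x by have [/ltW] := hB x.
exists (1 + \sum_x B x); first by rewrite ltr_pwDl // sumr_ge0.
move=> t i j tT; have [_ /(_ t tT) h] := hB (i, j); apply: le_trans h _.
by rewrite (bigD1 (i, j)) //= addrCA lerDl addr_ge0 // sumr_ge0.
Qed.

Lemma qf_scalar_add (R : realType) n e (M : 'M[R]_n) x :
  qf (e%:M + M) x = e * nsq x + qf M x.
Proof.
by rewrite /qf /nsq mulmxDr mulmxDl mxDE mul_mx_scalar -scalemxAl mxZE.
Qed.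

Lemma mx_entry_le (R : realType) n (A : 'M[R]_n) c i j : 0 <= c ->
  (forall y, nsq (A *m y) <= c ^+ 2 * nsq y) -> `|A i j| <= c.
Proof.
move=> c0 h; have := h (delta_mx j 0); have := sqr_coord_le (A *m delta_mx j 0) i.
have -> : (A *m (delta_mx j 0 : 'cV[R]_n)) i 0 = A i j by rewrite -colE mxE.
have -> : nsq (delta_mx j 0 : 'cV[R]_n) = 1.
  by rewrite /nsq trmx_delta mul_delta_mx mxE !eqxx.
rewrite mulr1 => h1 h2; rewrite -ler_sqr ?nnegrE // real_normK ?num_real //.
exact: le_trans h1 h2.
Qed.

Section Gain.
Variables (R : realType) (d : nat) (T : R).
Hypothesis T_gt0 : 0 < T.
Variables (J : 'M[R]_d) (p U : R -> 'M[R]_d).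
Hypothesis pdJ : sym_pd J.
Hypothesis U0 : U 0 = 0.
Hypothesis acU : acm T U (fun t => 1%:M - p t *m J *m U t).
Local Notation M := (fisher J U).
Variables (beta : R -> 'M[R]_d) (Ri : 'M[R]_d).
Hypothesis pdRi : sym_pd Ri.
Hypothesis bbeta : bmm T beta.
Let G (r t : R) : 'M[R]_d := invmx (r^-1%:M + M t).
Hypothesis bG : forall r, 0 < r -> bmm T (G r).

(** The information is nondecreasing, so the coercivity constant at t serves on all of [t, T]. *)
Lemma fisher_coercive t : 0 < t <= T -> exists2 l : R, 0 < l &
  forall s y, t <= s <= T -> l * nsq y <= qf (M s) y.
Proof.
move=> tT; have pdM := fisher_pd pdJ U0 acU tT.
have pdB := sym_pd_inv pdM; have [c c0 hc] := qf_bounded (invmx (M t)).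
exists c^-1; first by rewrite invr_gt0.
move=> s y /andP[ts sT]; have /andP[t0 tT'] := tT.
apply: le_trans (fisher_le pdJ acU y (ltW t0) ts sT).
rewrite ler_pdivrMl //; apply: (psd_coercive _ (sym_pd_psd pdB)) => //.
  by rewrite mulVmx // sym_pd_unit.
by case: pdM.
Qed.

(** Since r^-1 + M >= r^-1, the mean error on the drift never exceeds [a], even near 0 where the
    information degenerates. *)
Lemma gain_small r t a : 0 < r -> 0 <= t <= T -> nsq (r^-1 *: (G r t *m a)) <= nsq a.
Proof.
move=> r0 tT; have ri : 0 < r^-1 by rewrite invr_gt0.
have h := coercive_inv_le a ri (B := r^-1%:M + M t).
rewrite nsqZ mulrC -ler_pdivlMr ?exprn_gt0 //; apply: h => x.
rewrite qf_scalar_add lerDl; exact: (fisher_psd pdJ acU tT).2.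
Qed.

Section Coercive.
Variables (l t0 : R).
Hypothesis l0 : 0 < l.
Hypothesis hl : forall s y, t0 <= s <= T -> l * nsq y <= qf (M s) y.

Let gain_coercive r t x : 0 < r -> t0 <= t <= T -> l * nsq x <= qf (r^-1%:M + M t) x.
Proof.
move=> r0 tT; apply: le_trans (hl _ tT) _; rewrite qf_scalar_add lerDr.
by rewrite mulr_ge0 ?nsq_ge0 // invr_ge0 ltW.
Qed.

Lemma gain_le r t a : 0 < r -> t0 <= t <= T -> nsq (G r t *m a) <= nsq a / l ^+ 2.
Proof. by move=> r0 tT; apply: coercive_inv_le => // x; exact: gain_coercive. Qed.

Lemma info_inv_le t a : t0 <= t <= T -> nsq (invmx (M t) *m a) <= nsq a / l ^+ 2.
Proof. by move=> tT; apply: coercive_inv_le => // x; exact: hl. Qed.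

Let prod_entry (A B : 'M[R]_d) i j : (forall a, nsq (A *m a) <= nsq a / l ^+ 2) ->
  (forall a, nsq (B *m a) <= nsq a / l ^+ 2) -> `|(A *m B) i j| <= l^-1 ^+ 2.
Proof.
move=> hA hB; apply: mx_entry_le; first by rewrite sqr_ge0.
move=> y; rewrite -mulmxA; apply: le_trans (hA _) _.
rewrite ler_pdivrMr ?exprn_gt0 //; apply: le_trans (hB _) _.
by rewrite le_eqVlt; apply/orP; left; apply/eqP; field; rewrite gt_eqF.
Qed.

Lemma gain_defect r t : 0 < r -> t0 <= t <= T ->
  invmx (M t) - G r t *m M t *m G r t = r^-1 *: (invmx (M t) *m G r t + G r t *m G r t) /\
  forall i j, `|(invmx (M t) *m G r t + G r t *m G r t) i j| <= 2 * l^-1 ^+ 2.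
Proof.
move=> r0 tT; split.
  apply: inv_defect; first by apply: (coercive_unit l0) => x; exact: hl.
  by apply: (coercive_unit l0) => x; exact: gain_coercive.
move=> i j; rewrite mxDE; apply: le_trans (ler_normD _ _) _.
have h1 := prod_entry i j (fun a => info_inv_le a tT) (fun a => gain_le a r0 tT).
have h2 := prod_entry i j (fun a => gain_le a r0 tT) (fun a => gain_le a r0 tT).
lra.
Qed.

(** Measurability comes from writing M^-1 as the pointwise limit of G M G for r = 1, 2, 3, ...,
    whose regularity is known. *)
Lemma bmm_info_inv : bmm T (fun t => if t < t0 then 0 else invmx (M t)).
Proof.
move=> i j; split; last first.
  exists l^-1 => t /andP[_ tT]; case: ltP => tt0; first by rewrite mxE normr0 invr_ge0 ltW.
  apply: mx_entry_le; first by rewrite invr_ge0 ltW.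
  by move=> y; rewrite exprVn mulrC; apply: info_inv_le; rewrite tt0.
pose h n t := (if t < t0 then 0 else G n.+1%:R t *m M t *m G n.+1%:R t) i j.
apply: (@measurable_fun_cvg _ _ _ _ h).
  move=> n; have bGn : bmm T (G n.+1%:R) by exact: bG.
  by have [] := bmm_tail t0 (bmmM (bmmM bGn (acm_bmm (acm_fisher acU))) bGn) i j.
move=> t /=; rewrite in_itv /= => /andP[_ tT].
have [tt0|tt0] := ltP t t0.
  by rewrite (_ : h ^~ t = fun=> 0); [rewrite mxE; exact: cvg_cst | apply/funext => n; rewrite /h tt0 mxE].
apply/cvgrPdist_le => e e0.
have := cvg_harmonic (R := R).
move/cvgrPdist_le => /(_ (e * l ^+ 2 / 2)); rewrite divr_gt0 ?mulr_gt0 ?exprn_gt0 //.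
move=> /(_ isT); apply: filterS => n; rewrite /harmonic /= sub0r normrN => /(le_trans (ler_norm _)) hn.
rewrite /h ltNge tt0 /= -mxNE -mxDE.
have ttT : t0 <= t <= T by rewrite tt0.
have [-> hb] := gain_defect (ltr0Sn R n) ttT.
rewrite mxZE normrM ger0_norm ?invr_ge0 ?ler0n //.
apply: le_trans (_ : (e * l ^+ 2 / 2) * (2 * l^-1 ^+ 2) <= e).
  by apply: ler_pM.
by rewrite le_eqVlt; apply/orP; left; apply/eqP; field; rewrite gt_eqF.
Qed.

End Coercive.

Lemma weight_bound : exists2 K : R, 0 < K & forall t y, 0 <= t <= T ->
  0 <= qf Ri (beta t *m y) <= K * nsq y.
Proof.
have bF : bmm T (fun t => (beta t)^T *m Ri *m beta t).
  by apply: bmmM => //; apply: bmmM; [exact: bmm_tr | exact: bmm_cst].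
have [c c0 hc] := bmm_bound bF; exists (1 + c *+ d *+ d).
  by rewrite ltr_wpDr // mulrn_wge0 // mulrn_wge0 // ltW.
move=> t y tT; rewrite (sym_pd_psd pdRi).2 /=.
have -> : qf Ri (beta t *m y) = qf ((beta t)^T *m Ri *m beta t) y.
  by rewrite /qf trmx_mul !mulmxA.
have := qf_le y (fun i j => hc t i j tT); have := nsq_ge0 y.
have := ler_norm (qf ((beta t)^T *m Ri *m beta t) y).
rewrite mulrDl mul1r; lra.
Qed.

Lemma excess_mean_cvg T0 (a : 'cV[R]_d) : 0 <= T0 -> T0 < T ->
  tail_int T T0 (fun t => ((beta t *m (r^-1 *: (G r t *m a)))^T *m Ri
    *m (beta t *m (r^-1 *: (G r t *m a)))) 0 0) @[r --> +oo] --> (0 : R).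
Proof.
move=> T00 T0T; have [K K0 hK] := weight_bound.
have hT : 0 <= T0 <= T by rewrite T00 ltW.
pose A := K * nsq a + 1; have A0 : 0 < A by rewrite ltr_wpDl // mulr_ge0 ?nsq_ge0 // ltW.
apply/cvgrPdist_le => e e0.
(* [T0] may be 0, where no coercivity is available: [0, dl] contributes at most e / 2 by
   [gain_small], and coercivity holds beyond [dl]. *)
pose dl := Num.min T (e / 2 / A).
have dl0 : 0 < dl by rewrite lt_min T_gt0 !divr_gt0.
have dlT : dl <= T by rewrite ge_min lexx.
have dle : A * dl <= e / 2 by rewrite mulrC -ler_pdivlMr // ge_min lexx orbT.
have dl_in : 0 < dl <= T by rewrite dl0.
have [l l0 hl] := fisher_coercive dl_in.
near=> r.
have r1 : 1 <= r by near: r; apply: nbhs_pinfty_ge; exact: num_real.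
have r0 : 0 < r := lt_le_trans ltr01 r1.
have rbig : A * T / (l ^+ 2 * (e / 2)) <= r.
  by near: r; apply: nbhs_pinfty_ge; exact: num_real.
pose y t := r^-1 *: (G r t *m a).
have by_ : bmm T y by apply: bmmZ; apply: bmmM; [exact: bG | exact: bmm_cst].
pose f t := qf Ri (beta t *m y t).
have bf : bm T f.
  have bz : bmm T (fun t => beta t *m y t) by exact: bmmM.
  exact: (bmmM (bmmM (bmm_tr bz) (bmm_cst T Ri)) bz).
have fle t : 0 <= t <= T -> 0 <= f t <= K * nsq (y t) by move=> tT; exact: hK.
(* Of the two factors r^-1 in the square one suffices; the other is at most 1 since r >= 1. *)
pose B := A / (r * l ^+ 2).
have B0 : 0 <= B by rewrite divr_ge0 ?mulr_ge0 ?exprn_ge0 // ltW.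
have AK : K * nsq a <= A by rewrite /A lerDl.
have := tail_int_split_le (f := f) (A := A) (e := dl) hT _ B0 bf.
rewrite dlT (ltW dl0) => /(_ isT) h.
have /andP[f0 fB] : 0 <= tail_int T T0 f <= A * dl + B * T.
  apply: h => t tT.
  - by have /andP[] := fle t tT.
  - have tT' : 0 <= t <= T by case/andP: tT => -> /le_trans; apply.
    have /andP[_ hf] := fle t tT'; apply: le_trans hf _; apply: le_trans AK.
    by apply: ler_wpM2l; [exact: ltW | exact: gain_small].
  - have tT' : 0 <= t <= T by case/andP: tT => h1 ->; rewrite (le_trans (ltW dl0) h1).
    have /andP[_ hf] := fle t tT'; apply: le_trans hf _.
    have h1 := gain_le l0 hl a r0 tT.
    have h2 : nsq (y t) <= r^-1 * (nsq a / l ^+ 2).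
      rewrite /y nsqZ; apply: ler_pM; rewrite ?sqr_ge0 ?nsq_ge0 //.
      by rewrite expr2 ger_pMl ?invr_gt0 // invf_le1.
    apply: le_trans (ler_wpM2l (ltW K0) h2) _.
    have -> : K * (r^-1 * (nsq a / l ^+ 2)) = r^-1 * (K * nsq a / l ^+ 2) by ring.
    have -> : B = r^-1 * (A / l ^+ 2) by rewrite /B invfM mulrCA.
    by rewrite ler_pM2l ?invr_gt0 // ler_pM2r ?invr_gt0 ?exprn_gt0.
rewrite sub0r normrN ger0_norm //; apply: le_trans fB _.
have : B * T <= e / 2.
  rewrite /B mulrAC ler_pdivrMr ?mulr_gt0 ?exprn_gt0 //.
  by move: rbig; rewrite ler_pdivrMr ?mulr_gt0 ?exprn_gt0 ?divr_gt0 // => /le_trans; apply; lra.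
lra.
Unshelve. all: by end_near.
Qed.

Definition limit_integrand k t : R :=
  k * \tr (Ri *m (beta t *m invmx (M t) *m (beta t)^T)).

(** The limit integrand may blow up at 0, so the calculus on [0, T] is applied to its cut-off below
    [T0]. *)
Lemma limit_integrand_tail k T0 : 0 < T0 -> T0 < T ->
  exists2 g, bm T g & forall t, T0 <= t <= T -> g t = limit_integrand k t.
Proof.
move=> T00 T0T; have hT0 : 0 < T0 <= T by rewrite T00 ltW.
have [l l0 hl] := fisher_coercive hT0.
have bK := bmm_info_inv l0 hl.
exists (fun t => k * \tr (Ri *m (beta t *m (if t < T0 then 0 else invmx (M t)) *m (beta t)^T))).
  apply: bmM; first exact: bm_cst.
  apply: bm_tr; apply: bmmM; first exact: bmm_cst.
  by apply: bmmM; [exact: bmmM | exact: bmm_tr].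
by move=> t /andP[h _]; rewrite ltNge h.
Qed.

(** By [gain_defect] the integrand differs from its limit by at most D / r, uniformly on [T0, T]. *)
Lemma excess_variance_cvg k T0 : 0 < T0 -> T0 < T ->
  tail_int T T0 (fun t => \tr (Ri *m
    (beta t *m (k *: (G r t *m M t *m G r t)) *m (beta t)^T))) @[r --> +oo]
  --> tail_int T T0 (limit_integrand k).
Proof.
move=> T00 T0T; have hT0 : 0 < T0 <= T by rewrite T00 ltW.
have [l l0 hl] := fisher_coercive hT0.
have [g bg gE] := limit_integrand_tail k T00 T0T.
have <- : tail_int T T0 g = tail_int T T0 (limit_integrand k) by exact: tail_int_ext.
have bF : bmm T (fun t => (beta t)^T *m Ri *m beta t).
  by apply: bmmM => //; apply: bmmM; [exact: bmm_tr | exact: bmm_cst].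
have [c c0 hc] := bmm_bound bF.
pose D := `|k| * (c * (2 * l^-1 ^+ 2)) *+ d *+ d.
have D0 : 0 <= D.
  by rewrite /D !mulrn_wge0 // mulr_ge0 // mulr_ge0 ?(ltW c0) // mulr_ge0 // sqr_ge0.
apply/cvgrPdist_le => e e0; near=> r.
have r0 : 0 < r by near: r; apply: nbhs_pinfty_gt; exact: num_real.
have rbig : D * T / e <= r by near: r; apply: nbhs_pinfty_ge; exact: num_real.
pose f t := \tr (Ri *m (beta t *m (k *: (G r t *m M t *m G r t)) *m (beta t)^T)).
have bf : bm T f.
  apply: bm_tr; apply: bmmM; first exact: bmm_cst.
  apply: bmmM; last exact: bmm_tr.
  apply: bmmM => //; apply: bmmZ; apply: bmmM; last exact: bG.
  by apply: bmmM; [exact: bG | exact: acm_bmm (acm_fisher acU)].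
rewrite -/(tail_int T T0 f) -(tail_intB (ltW T00) (ltW T0T) bg bf).
rewrite (tail_intE (ltW T00) (ltW T0T) (bmB bg bf)).
have hT : 0 <= T0 <= T by rewrite ltW ?ltW.
apply: le_trans (int0_inc_bound (B := D / r) (bmB bg bf) hT (lexx T) _) _; last first.
  apply: le_trans (_ : D / r * T <= e).
    by apply: ler_wpM2l; [rewrite divr_ge0 // ltW | lra].
  by move: rbig; rewrite ler_pdivrMr // mulrAC ler_pdivrMr // [r * e]mulrC.
move=> t tT; rewrite gE // /limit_integrand /f.
have [h1 h2] := gain_defect l0 hl r0 tT.
pose Z := invmx (M t) *m G r t + G r t *m G r t.
have -> : k * \tr (Ri *m (beta t *m invmx (M t) *m (beta t)^T))
   - \tr (Ri *m (beta t *m (k *: (G r t *m M t *m G r t)) *m (beta t)^T))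
   = k * r^-1 * \tr ((beta t)^T *m Ri *m beta t *m Z).
  rewrite -scalemxAr -scalemxAl -scalemxAr mxtraceZ -mulrBr -mulrA; congr (k * _).
  rewrite -raddfB /= -mulmxBr -mulmxBl -mulmxBr h1 -/Z.
  rewrite -scalemxAr -scalemxAl -scalemxAr mxtraceZ; congr (_ * _).
  by rewrite mulmxA mxtrace_mulC !mulmxA.
have ri : 0 <= r^-1 by rewrite invr_ge0 ltW.
rewrite !normrM (ger0_norm ri).
have tT' : 0 <= t <= T by case/andP: tT => h ->; rewrite (le_trans (ltW T00) h).
have : `|\tr ((beta t)^T *m Ri *m beta t *m Z)| <= c * (2 * l^-1 ^+ 2) *+ d *+ d.
  apply: le_trans (ler_norm_sum _ _ _) _.
  apply: sum_le_mulrn => i; rewrite mxE; apply: le_trans (ler_norm_sum _ _ _) _.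
  apply: sum_le_mulrn => j.
  by rewrite normrM; apply: ler_pM => //; exact: hc.
have kr : 0 <= `|k| * r^-1 by rewrite mulr_ge0.
move=> /(ler_wpM2l kr) h; apply: le_trans h _.
have E x : `|k| / r * (x *+ d *+ d) = `|k| * x *+ d *+ d / r.
  by rewrite !mulrnAr !mulrnAl mulrAC.
by rewrite E.
Unshelve. all: by end_near.
Qed.

(** A sum of rank one terms for [Ri] turns the trace into a sum of quadratic forms. The cubic bound
    on the information then bounds each form of its inverse from below, so the integrand is at least
    k rho t / (C t^3). *)
Lemma limit_blowup k beta' : 0 < k -> acm T beta beta' -> beta 0 != 0 ->
  exists c tau : R, [/\ 0 < c, 0 < tau, tau < T &
    forall T0, 0 < T0 -> T0 < tau -> c / T0 ^+ 2 <= tail_int T T0 (limit_integrand k)].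
Proof.
move=> k0 acb b0.
have [ws wsE] := rank_one_sum (sym_pd_psd pdRi).
have [C C0 hC] := fisher_cubic U0 acU.
pose rho t := \tr (Ri *m (beta t *m (beta t)^T)).
have trE (Z : 'M[R]_d) : \tr (Ri *m Z) = \sum_(w <- ws) qf Z w.
  rewrite [X in X *m Z]wsE mulmx_suml raddf_sum; apply: eq_bigr => w _ /=.
  by rewrite mxtrace_mulC mulmxA mxtrace_mulC mulmxA /qf /mxtrace big_ord1.
have qbb t w : qf (beta t *m (beta t)^T) w = nsq ((beta t)^T *m w).
  by rewrite nsq_mul trmxK.
have rho_ge0 t : 0 <= rho t.
  by rewrite /rho trE; apply: sumr_ge0 => w _; rewrite qbb nsq_ge0.
have rho0 : 0 < rho 0.
  rewrite lt_neqAle rho_ge0 andbT eq_sym; apply: contraNneq b0 => r0.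
  have h w : w \in ws -> (beta 0)^T *m w = 0.
    move=> wws; apply: nsq_eq0; apply/eqP; rewrite -qbb eq_le.
    rewrite {2}qbb nsq_ge0 andbT -[leRHS]r0 /rho trE (big_rem w) //= lerDl.
    by apply: sumr_ge0 => x _; rewrite qbb nsq_ge0.
  have : (beta 0)^T *m Ri = 0.
    rewrite wsE mulmx_sumr big_seq big1 // => w /h hw; by rewrite mulmxA hw mul0mx.
  move/(congr1 (fun A => A *m invmx Ri)); rewrite mulmxK ?sym_pd_unit // mul0mx.
  by move/(congr1 trmx); rewrite trmxK trmx0 => ->.
have acrho := acm_mxtrace (acmMl Ri (acmM acb (acm_tr acb))).
have [B B0 lipr] := ac_lip acrho.
(* On [0, 2 tau] the Lipschitz function [rho] stays above half its initial value; the outer half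
   makes room for the window [T0, 2 T0]. *)
pose tau := Num.min T (rho 0 / (2 * B)) / 2.
have m0 : 0 < Num.min T (rho 0 / (2 * B)) by rewrite lt_min T_gt0 divr_gt0 ?mulr_gt0.
have tau0 : 0 < tau by rewrite divr_gt0.
have tauT : 2 * tau <= T by rewrite /tau mulrC divfK // ge_min lexx.
have rho_low (t : R) : 0 <= t -> t <= 2 * tau -> rho 0 / 2 <= rho t.
  move=> t0 tt; have tT := le_trans tt tauT.
  have := lipr 0 t; rewrite lexx t0 tT subr0 -/(rho t) -/(rho 0) => /(_ isT isT).
  have : B * t <= rho 0 / 2.
    have : 2 * tau <= rho 0 / (2 * B) by rewrite /tau mulrC divfK // ge_min lexx orbT.
    move=> /(le_trans tt)/(ler_wpM2l (ltW B0)) h; apply: le_trans h _.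
    by rewrite le_eqVlt; apply/orP; left; apply/eqP; field; rewrite gt_eqF.
  rewrite ler_norml => h1 /andP[h2 _]; lra.
(* On [T0, 2 T0], of length T0, the integrand is at least k (rho 0 / 2) / (C 8 T0^3): 16 is 2 from
   [rho] times 8 from t^3. *)
exists (k * rho 0 / (16 * C)), tau; split=> //; first by rewrite divr_gt0 ?mulr_gt0.
  lra.
move=> T0 T00 T0t; have T0T : T0 < T by lra.
have [g bg gE] := limit_integrand_tail k T00 T0T.
have <- : tail_int T T0 g = tail_int T T0 (limit_integrand k) by exact: tail_int_ext.
have glow t : T0 <= t <= T -> k * (rho t / (C * t ^+ 3)) <= g t.
  move=> tT; have t0 : 0 < t by case/andP: tT => h _; exact: lt_le_trans h.
  have tT' : 0 < t <= T by rewrite t0; case/andP: tT.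
  have tT2 : 0 <= t <= T by rewrite ltW; case/andP: tT.
  have Ct : 0 < C * t ^+ 3 by rewrite mulr_gt0 ?exprn_gt0.
  have pdM := fisher_pd pdJ U0 acU tT'.
  rewrite gE // /limit_integrand ler_wpM2l ?(ltW k0) // /rho !trE mulr_suml.
  apply: ler_sum => w _; rewrite qbb ler_pdivrMr // mulrC.
  pose y := (beta t)^T *m w.
  have -> : qf (beta t *m invmx (M t) *m (beta t)^T) w = qf (invmx (M t)) y.
    by rewrite /qf /y trmx_mul trmxK !mulmxA.
  apply: (psd_coercive _ (sym_pd_psd pdM)) => //; first by rewrite mulmxV ?sym_pd_unit.
    by have [] := sym_pd_inv pdM.
  by move=> z; exact: hC.
have g0 t : T0 <= t <= T -> 0 <= g t.
  move=> tT; apply: le_trans (glow t tT); have t0 : 0 <= t.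
    by case/andP: tT => h _; exact: le_trans (ltW T00) h.
  by rewrite mulr_ge0 ?(ltW k0) // divr_ge0 ?rho_ge0 // mulr_ge0 ?exprn_ge0 // ltW.
rewrite (tail_intE (ltW T00) (ltW T0T) bg).
pose T1 := 2 * T0; have T1T : T1 <= T by rewrite /T1; lra.
have T01 : T0 <= T1 by rewrite /T1; lra.
have T10 : 0 <= T1 by rewrite /T1; lra.
pose v := k * rho 0 / (16 * C) / T0 ^+ 3.
have h1 : v * T1 - v * T0 <= int0 g T1 - int0 g T0.
  rewrite -!int0_cst ?(ltW T00) //.
  apply: (int0_inc_le (bm_cst T v) bg) => //; first by rewrite ltW.
  move=> t /andP[t1 t2]; apply: le_trans (glow t _); last by rewrite t1 (le_trans t2).
  have t0 : 0 < t := lt_le_trans T00 t1.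
  have hr : rho 0 / 2 <= rho t by apply: rho_low; [exact: ltW | rewrite /T1 in t2; lra].
  have ht : t ^+ 3 <= 8 * T0 ^+ 3.
    have -> : 8 * T0 ^+ 3 = T1 ^+ 3 by rewrite /T1; ring.
    by rewrite lerXn2r ?nnegrE // ltW.
  rewrite /v -!mulrA ler_pM2l //.
  apply: le_trans (_ : rho 0 / 2 / (C * (8 * T0 ^+ 3)) <= _).
    rewrite le_eqVlt; apply/orP; left; apply/eqP; field; rewrite ?gt_eqF //.
  apply: ler_pM => //.
    by rewrite divr_ge0 // ltW.
    by rewrite invr_ge0 !mulr_ge0 ?exprn_ge0 // ltW.
  by rewrite lef_pV2 ?posrE ?mulr_gt0 ?exprn_gt0 // ler_pM2l.
have h2 : 0 <= int0 g T - int0 g T1.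
  have := int0_inc_le (bm_cst T 0) bg (_ : 0 <= T1 <= T) (lexx T).
  rewrite T10 T1T !int0_cst ?(ltW T_gt0) // !mul0r subrr => /(_ isT); apply.
  by move=> t /andP[h1' h2']; rewrite g0 // h2' (le_trans T01 h1').
have -> : k * rho 0 / (16 * C) / T0 ^+ 2 = v * T1 - v * T0.
  by rewrite /v /T1; field; rewrite ?gt_eqF.
lra.
Qed.

End Gain.

Lemma qf_eq0 (R : realType) n (A : 'M[R]_n) : A^T = A -> (forall v, qf A v = 0) -> A = 0.
Proof.
move=> symA A0; apply: psd_diag0 => [|i].
  by split=> // v; rewrite -/(qf A v) A0.
have := A0 (delta_mx i 0); by rewrite /qf trmx_delta -rowE -colE !mxE.
Qed.

(** * Nonvanishing of the initial feedback on the drift *)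

Section InitialCoupling.
Variables (R : realType) (d : nat) (T : R).
Hypothesis T_gt0 : 0 < T.
Variables (Q Rc : 'M[R]_d) (S11 S12 : R -> 'M[R]_d).
Let Ri := invmx Rc.
Hypotheses (psdQ : sym_psd Q) (pdRc : sym_pd Rc).
Hypothesis symS11 : forall t, 0 <= t <= T -> (S11 t)^T = S11 t.
Hypotheses (S11T : S11 T = 0) (S12T : S12 T = 0).
Hypothesis acS11 : acm T S11 (fun t => S11 t *m Ri *m S11 t - Q).
Hypothesis acS12 : acm T S12 (fun t => S11 t *m Ri *m S12 t - S11 t).

(* If [S12 0 = 0], the optimally controlled flow [phi] satisfies
   [phi 0 = phi T = 1], so that [phi^T *m Rc *m phi], which is nonincreasing, is
   constant; this forces [S11] to vanish along [phi], hence [Q = 0]. *)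
Lemma coupling_neq0 : Q != 0 -> S12 0 != 0.
Proof.
move=> Q0; apply: contra_neq Q0 => S120.
have uR := sym_pd_unit pdRc; have pdRi := sym_pd_inv pdRc.
have symRi : Ri^T = Ri by case: pdRi.
have symRc : Rc^T = Rc by case: pdRc.
have TT : 0 <= T <= T by rewrite lexx ltW.
have bA : bmm T (fun t => - (Ri *m S11 t)).
  by apply: bmmN; apply: bmmM; [exact: bmm_cst | exact: acm_bmm acS11].
have [Phi [Psi [_ _ acPhi _ inv]]] := fundamental_matrix T_gt0 bA.
pose phi t := Phi t *m Psi T.
have phiT : phi T = 1%:M by have [] := inv T TT.
have acphi : acm T phi (fun t => - (Ri *m S11 t *m phi t)).
  by apply: acm_ext (acmMr (Psi T) acPhi) => // t _; rewrite /phi; mx_ring.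
clearbody phi; have phi0 : phi 0 = 1%:M.
  (* Z = Rc - S12 satisfies Z' = S11 Ri Z, the equation adjoint to that of [phi], so Z^T phi is
     constant; it equals Rc phi at both ends. *)
  have acZ := acmB (acm_cst T Rc) acS12.
  have h : acm T (fun t => (Rc - S12 t)^T *m phi t) (fun=> 0).
    apply: acm_ext (acmM (acm_tr acZ) acphi) => // t tT.
    have -> : 0 - (S11 t *m Ri *m S12 t - S11 t) = S11 t *m Ri *m (Rc - S12 t).
      by rewrite mulmxBr mulmxKV // sub0r opprB.
    by rewrite !trmx_mul symRi symS11 // mulmxN !mulmxA subrr.
  have := acm_eq0 h TT; rewrite S12T S120 phiT !subr0 symRc mulmx1.
  by move/(congr1 (mulmx Ri)); rewrite mulVmx // mulKmx.
have acR : acm T (fun t => (phi t)^T *m Rc *m phi t)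
    (fun t => - (2 *: ((phi t)^T *m S11 t *m phi t))).
  apply: acm_ext (acmM (acmMr Rc (acm_tr acphi)) acphi) => // t tT.
  rewrite linearN /= !trmx_mul symRi symS11 // !mulNmx mulmxN !mulmxA.
  rewrite mulmxKV // -(mulmxA _ Rc Ri) mulmxV // mulmx1 -opprD.
  by rewrite scaler_nat mulr2n.
pose D t := (phi t)^T *m (Q + S11 t *m Ri *m S11 t) *m phi t.
have acH : acm T (fun t => (phi t)^T *m S11 t *m phi t) (fun t => - D t).
  apply: acm_ext (acmM (acmM (acm_tr acphi) acS11) acphi) => // t tT.
  rewrite linearN /= !trmx_mul symRi symS11 // /D; mx_ring.
have acD : exists D', acm T D D'.
  eexists; apply: (acmM (acmM (acm_tr acphi) _) acphi).
  apply: acmD; first exact: acm_cst.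
  by apply: acmM; [apply: acmMr; exact: acS11 | exact: acS11].
have [D' acDD] := acD.
apply: qf_eq0; first by case: psdQ.
move=> v.
have acvD : ac T (fun t => qf (D t) v) _ := acmMr v (acmMl v^T acDD) 0 0.
have acvH : ac T (fun t => qf ((phi t)^T *m S11 t *m phi t) v) (fun t => - qf (D t) v).
  apply: ac_ext (acmMr v (acmMl v^T acH) 0 0) => t _ //.
  by rewrite mulmxN mulNmx mxNE.
have acvR : ac T (fun t => qf ((phi t)^T *m Rc *m phi t) v)
    (fun t => - (2 * qf ((phi t)^T *m S11 t *m phi t) v)).
  apply: ac_ext (acmMr v (acmMl v^T acR) 0 0) => t _ //.
  by rewrite mulmxN mulNmx mxNE -scalemxAr -scalemxAl mxZE.
have D0 t : 0 <= t <= T -> 0 <= qf (D t) v.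
  move=> tT; have -> : qf (D t) v = qf Q (phi t *m v) + qf Ri (S11 t *m (phi t *m v)).
    by rewrite /qf /D !trmx_mul symS11 // -mxDE; congr ((_ : 'M[R]_1) 0 0); mx_ring.
  by rewrite addr_ge0 //; [exact: psdQ.2 | exact: (sym_pd_psd pdRi).2].
pose h t := qf ((phi t)^T *m S11 t *m phi t) v.
have bD : bm T (fun t => qf (D t) v) := ac_bm acvD.
have bh : bm T h := ac_bm acvH.
have hT : h T = 0 by rewrite /h S11T /qf mulmx0 mul0mx mulmx0 mul0mx mxE.
have hE t : 0 <= t <= T -> h t = h 0 - int0 (fun t => qf (D t) v) t.
  move=> tT; have [_ e] := acvH; rewrite /h e //; congr (_ + _).
  have tT' : t <= T by case/andP: tT.
  rewrite -mulN1r -(int0Z _ bD tT').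
  by apply: int0_ext => s _; rewrite mulN1r.
have acI := ac_int0 bD.
have Dh0 : int0 (fun t => qf (D t) v) T = h 0 by have := hE T TT; rewrite hT; lra.
have h_ge0 t : 0 <= t <= T -> 0 <= h t.
  move=> tT; rewrite hE // -Dh0 subr_ge0; case/andP: tT => t0 tT.
  have := int0_inc_le (bm_cst T 0) bD (_ : 0 <= t <= T) (lexx T).
  rewrite t0 tT !int0_cst ?(ltW T_gt0) // !mul0r subrr subr_ge0 => /(_ isT); apply.
  by move=> s /andP[ts sT]; rewrite D0 // sT (le_trans t0 ts).
(* phi^T Rc phi takes the same value at 0 and T, and its derivative along v is - 2 h. *)
have Ih : int0 h T = 0.
  have [_ e] := acvR; have := e T TT; rewrite phiT phi0 trmx1 !mul1mx mulmx1.
  have -> : int0 (fun t => - (2 * qf ((phi t)^T *m S11 t *m phi t) v)) T = -2 * int0 h T.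
    by rewrite -(int0Z _ bh (lexx T)); apply: int0_ext => s _; rewrite mulNr.
  lra.
have h0 : h 0 = 0.
  by apply: (int0_eq0 acvH h_ge0 _ Ih); rewrite ?T_gt0 lexx ?ltW.
rewrite h0 in Dh0.
(* The integral of the nonnegative form of D is h 0 = 0, so the form vanishes up to T, where phi = 1
   and S11 = 0 reduce D to Q. *)
have := int0_eq0 acvD D0 _ Dh0 TT; rewrite T_gt0 lexx => /(_ isT).
by rewrite /D phiT S11T trmx1 mul1mx mulmx1 mulmx0 addr0.
Qed.

End InitialCoupling.

Lemma inv_square_blowup (R : realType) (L : R -> R) (c tau : R) : 0 < c -> 0 < tau ->
  (forall t : R, 0 < t -> t < tau -> c / t ^+ 2 <= L t) ->
  L t @[t --> (0 : R)^'+] --> +oo.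
Proof.
move=> c0 tau0 hL; apply/cvgryPge => A; near=> t.
have t0 : 0 < t by near: t; exact: nbhs_right_gt.
have tt : t < tau by near: t; exact: nbhs_right_lt.
have t1 : t < 1 by near: t; exact: nbhs_right_lt.
have tA : t < c / (`|A| + 1).
  by near: t; apply: nbhs_right_lt; rewrite divr_gt0 // ltr_wpDl.
apply: le_trans (hL t t0 tt).
rewrite ler_pdivlMr ?exprn_gt0 //.
move: tA; rewrite ltr_pdivlMr ?ltr_wpDl // => tA.
have h1 : A * t ^+ 2 <= (`|A| + 1) * t ^+ 2.
  by rewrite ler_wpM2r ?sqr_ge0 // (le_trans (ler_norm A)) // lerDl.
apply: le_trans h1 _; apply: le_trans (ltW tA).
rewrite [leLHS]mulrC; apply: ler_wpM2r; first by rewrite addr_ge0.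
by rewrite expr2 -[leRHS]mul1r; apply: ler_wpM2r; exact: ltW.
Unshelve. all: by end_near.
Qed.

Lemma ln_inv_le (R : realType) (t : R) : 0 < t -> t < 1 -> ln (1 / t) <= (t ^+ 2)^-1.
Proof.
move=> t0 t1; apply: le_trans (ltW (ln_sublinear (_ : 0 < 1 / t))) _; first exact: divr_gt0.
rewrite div1r lef_pV2 ?posrE ?exprn_gt0 // expr2 -[leRHS]mul1r.
by apply: ler_wpM2r; exact: ltW.
Qed.

Theorem theorem5 (R : realType) (d : nat) (d_ge1 : (1 <= d)%N)
  (T : R) (T_gt0 : 0 < T)
  (Q Rc SigV Sigq0 : 'M[R]_d)
  (Q_neq0 : Q != 0) (Q_psd : sym_psd Q) (Rc_pd : sym_pd Rc)
  (SigV_pd : sym_pd SigV) (Sigq0_psd : sym_psd Sigq0)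
  (disp : measure_display) (Om : measurableType disp)
  (Pr : probability Om R) (W V : R -> Om -> 'cV[R]_d) (q0 : Om -> 'cV[R]_d)
  (WVq0 : noise Pr SigV Sigq0 W V q0)
  (S : R -> 'M[R]_(d + d)) (S_riccati : control_riccati T Q Rc S)
  (X : 'M[R]_d -> R -> 'M[R]_d) (Y : 'M[R]_d -> R -> R)
  (XY_def : forall (Sig : 'M[R]_d) (T0 : R), sym_psd Sig -> 0 <= T0 -> T0 < T ->
     bayes_cost T Q Rc SigV Sigq0 Pr W V q0 S Sig T0 (X Sig T0) (Y Sig T0))
  (Xs : R -> 'M[R]_d) (Ys : R -> R)
  (XYs_def : forall T0 : R, 0 <= T0 -> T0 < T ->
     known_cost T Q Rc SigV Sigq0 Pr W V q0 S T0 (Xs T0) (Ys T0)) :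
  (forall (T0 : R) (a : 'cV[R]_d), 0 <= T0 -> T0 < T ->
     (a^T *m (X r%:M T0 - Xs T0) *m a) 0 0 @[r --> +oo] --> (0 : R))
  /\
  (exists L : R -> R,
     [/\ forall T0 : R, 0 < T0 -> T0 < T ->
           Y r%:M T0 - Ys T0 @[r --> +oo] --> L T0,
         L T0 @[T0 --> (0 : R)^'+] --> +oo &
         exists c : R, exists tau0 : R,
           [/\ 0 < c, 0 < tau0, tau0 < T &
               forall T0 : R, 0 < T0 -> T0 < tau0 -> c * ln (1 / T0) <= L T0]]).
Proof.
have [p [_ [_ [_ [_ [p_known _ _ _]]]]]] := XYs_def 0 (lexx 0) T_gt0.
have pdJ := sym_pd_inv SigV_pd; have pdRi := sym_pd_inv Rc_pd.
have [p0 symp acp] := known_filter_acm T_gt0 SigV_pd.1 Sigq0_psd.1 p_known.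
have [U U0 acU] := bias_exists T_gt0 acp.
have [symS11 [S11T S12T S22T] acS11 acS12 _] := control_blocks T_gt0 S_riccati.
have acb : acm T (bias_gain S U) _ := acmD (acmM acS11 acU) acS12.
have bb := acm_bmm acb.
have scalar_psd r : 0 < r -> sym_psd (r%:M : 'M[R]_d).
  move=> r0; split=> [|v]; first by rewrite tr_scalar_mx.
  by rewrite mul_mx_scalar -scalemxAl mxZE -/(nsq v) mulr_ge0 ?nsq_ge0 // ltW.
have bayes r T0 (r0 : 0 < r) (T00 : 0 <= T0) (T0T : T0 < T) :=
  bayes_cost_value T_gt0 Rc_pd SigV_pd Sigq0_psd WVq0 S_riccati p_known U0 acU T00 T0T r0
    (XY_def r%:M T0 (scalar_psd r r0) T00 T0T).
have known T0 (T00 : 0 <= T0) (T0T : T0 < T) :=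
  known_cost_value T_gt0 Rc_pd SigV_pd Sigq0_psd WVq0 S_riccati p_known T00 T0T (XYs_def T0 T00 T0T).
have bG r : 0 < r -> bmm T (bayes_gain SigV U r).
  by move=> r0; have [] := bayes r 0 r0 (lexx 0) T_gt0.
split.
  move=> T0 a T00 T0T.
  have h := excess_mean_cvg T_gt0 pdJ U0 acU pdRi bb bG a T00 T0T.
  apply: cvg_trans h; apply: near_eq_cvg; near=> r.
  have r0 : 0 < r by near: r; apply: nbhs_pinfty_gt; exact: num_real.
  have [_ _ hX] := bayes r T0 r0 T00 T0T; have [_ hXs] := known T0 T00 T0T.
  by rewrite mulmxBr mulmxBl mxDE mxNE hX hXs addrAC subrr add0r.
have b0 : bias_gain S U 0 != 0.
  rewrite /bias_gain U0 mulmx0 add0r.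
  exact: (coupling_neq0 T_gt0 Q_psd Rc_pd symS11 S11T S12T acS11 acS12 Q_neq0).
exists (fun T0 => tail_int T T0
  (limit_integrand (invmx SigV) U (bias_gain S U) (invmx Rc) (normal_var R))).
have [c [tau [c0 tau0 tauT hL]]] :=
  limit_blowup T_gt0 pdJ U0 acU pdRi bb bG (normal_var_gt0 R) acb b0.
split.
- move=> T0 T00 T0T.
  have h := excess_variance_cvg pdJ U0 acU bb bG T00 T0T (Ri := invmx Rc) (k := normal_var R).
  apply: cvg_trans h; apply: near_eq_cvg; near=> r.
  have r0 : 0 < r by near: r; apply: nbhs_pinfty_gt; exact: num_real.
  have [_ -> _] := bayes r T0 r0 (ltW T00) T0T; have [-> _] := known T0 (ltW T00) T0T.
  by rewrite addrAC subrr add0r.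
- exact: inv_square_blowup c0 tau0 hL.
(* Below 1 one has ln (1 / T0) < 1 / T0 <= 1 / T0^2, so the constant of the inverse square bound
   also serves for the logarithm. *)
- exists c, (Num.min tau 1); split=> //.
  + by rewrite lt_min tau0 ltr01.
  + by rewrite gt_min tauT.
  + move=> T0 T00; rewrite lt_min => /andP[T0tau T01].
    apply: le_trans (hL T0 T00 T0tau).
    by rewrite ler_pM2l // ln_inv_le.
Unshelve. all: by end_near.
Qed.
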